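(* Let $q_1, q_2$ be coprime positive integers, let $X_1, X_2>0$ and $T \ge 1$ be real numbers, and suppose that \[ \mathcal{A}_{q_1,q_2}(X_1,X_2)=\{ x_1 q_1+x_2 q_2\mid x_1, x_2 \in \mathbb Z,\ |x_1|\leq X_1,\ |x_2|\leq X_2\}\subseteq[-T,T] \] does not contain a non-zero perfect square. Then for every $\varepsilon>0$, \[ |\mathcal{A}_{q_1,q_2}(X_1,X_2)| \ll_\varepsilon T^{20/27+\varepsilon}, \] where the implied constant depends only on $\varepsilon$.
   Context: $|\mathcal{A}|$ denotes the cardinality of the set $\mathcal{A}$. The notation $A \ll_\varepsilon B$ means $A \le C B$ for a constant $C>0$ depending only on $\varepsilon$ (not on $q_1,q_2,X_1,X_2,T$). *)

(* Defs.v *)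
From mathcomp Require Import all_boot all_order all_algebra finmap.
From mathcomp Require Import zify.
From mathcomp Require Import all_classical all_reals all_analysis.

Set Implicit Arguments.
Unset Strict Implicit.
Unset Printing Implicit Defensive.

Import Order.TTheory GRing.Theory Num.Theory.
Local Open Scope classical_set_scope.
Local Open Scope ring_scope.

Definition progression2 (R : realType) (q1 q2 : nat) (X1 X2 : R) : set int :=
  [set a : int | exists x1 x2 : int,
     [/\ a = x1 * q1%:Z + x2 * q2%:Z,
         `|x1%:~R : R| <= X1 & `|x2%:~R : R| <= X2]].

Definition perfect_square (a : int) : Prop := exists m : int, a = m ^+ 2.

Lemma finite_int_ball (R : realType) (X : R) :
  finite_set [set x : int | `|x%:~R : R| <= X].
Proof.
pose n := (Num.truncn X).+1.
apply: (@sub_finite_set _ _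
  ([set k%:Z | k in `I_n] `|` [set - k%:Z | k in `I_n])); last first.
  by rewrite finite_setU; split; apply/finite_image/finite_II.
move=> x /= xX.
have absx : (absz x < n)%N.
  rewrite -(ltr_nat R).
  have -> : (absz x)%:R = `|x%:~R : R| by rewrite -intr_norm -abszE.
  exact: le_lt_trans xX (truncnS_gt _).
by case: (leP 0 x) => x0; [left | right]; exists (absz x) => //=; lia.
Qed.

(* Ensures that the cardinal of fset_set (progression2 ...) is the true one:
   fset_set returns the empty set on infinite sets. *)
Lemma finite_progression2 (R : realType) (q1 q2 : nat) (X1 X2 : R) :
  finite_set (progression2 q1 q2 X1 X2).
Proof.
apply: (@sub_finite_set _ _
  ((fun x : int * int => x.1 * q1%:Z + x.2 * q2%:Z) @`
    ([set x : int | `|x%:~R : R| <= X1] `*` [set x : int | `|x%:~R : R| <= X2]))).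
  by move=> a [x1 [x2 [-> h1 h2]]]; exists (x1, x2).
by apply/finite_image/finite_setX; exact: finite_int_ball.
Qed.

(* Main.v *)
Require Import Defs.
From mathcomp Require Import all_boot all_order all_algebra finmap.
From mathcomp Require Import all_classical all_reals all_analysis.
From mathcomp Require Import finfield zify ring lra.

(** Suppose the progression is large, and put [T = t ^ (27 n)], so that [t] is a tiny power of [T].
    Let [r] be [q2] or [q1 + v q2] with a suitable [v > 0], let [q] be [q1], resp. [q2], and write
    [r = h^2 c] with [c] squarefree.  If [mu^2 = d q (mod c)] with [d > 0], Thue's lemma gives a small
    nonzero pair [m', e'] with [m' = mu e' (mod c)]; then [m = h m'] and [e = h e'] satisfy
    [m^2 = d q e^2 (mod r)], and the square [m^2], as a combination of [r] and [q], lies in the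
    progression as soon as [d] is small.  So one needs a small [d] making [d q] a square modulo every
    prime divisor of [c]; by orthogonality, it exists up to [D] unless some nonprincipal real character
    modulo a divisor of [c] has a nearly trivial sum over [1 .. D].

    - If both [X1] and [X2] exceed about [T^(7/27)], take [D = t^2] and let [v] run over [t] consecutive
      integers.  A failure for every [v] would give [t] distinct real characters with nearly trivial
      sums, which a large-values estimate excludes.
    - If one of them, say [X1], is smaller, then [X2] exceeds about [T^(13/27)], so
      [q2 <= T^(14/27)]; take [r = q2] and [D] about [T^(6/27)].  Burgess' bound, through the
      fourth moment of short sums and the square-root bound for complete quartic character sums
      (proved by Stepanov's method), excludes large sums. *)

Set Implicit Arguments.
Unset Strict Implicit.
Unset Printing Implicit Defensive.

Import Order.TTheory GRing.Theory Num.Theory.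

(** * Stepanov's method *)

Section Stepanov.
Local Open Scope ring_scope.

(** Where the exponents come from, in units of 1/27 of the logarithm of [T], with [X1 X2] of size
    20. In the long case the square stays below [r Y], [Y] of size 7, and [v] is about [X2 / Y]; a
    tiny [d] is affordable once [q2 <= Y X1], that is once [Y X1 X2] exceeds [X2 q2], which is at
    most [T]: hence 7 + 20 = 27. There [d] has to be a tiny power of [T] although [r] may be as
    large as [T], a range where no bound for a single character sum is available; only an average
    over many moduli helps. In the short case 13 is left for [X2] and 14 for [q2], and [d] may go up
    to [X1 X2 / q2], of size 6. This length lies below the square root of the modulus, out of reach
    of completion, but above its power 3/8, where Burgess' method with fourth moments begins to
    save.

    Divisor functions, and the number of subsets of the primes of a modulus, are never estimated
    closely: fixed powers of them are at most [t], and a few spare powers of [t] in the exponents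
    pay for them. *)

Lemma dvdp_XsubC_exp (F : fieldType) (p : nat) (q : {poly F}) (x : F) (l : nat) :
  p \in [pchar F] -> (l <= p)%N -> (forall k, (k < l)%N -> (q^`(k)).[x] = 0) ->
  ('X - x%:P) ^+ l %| q.
Proof.
move=> charF lep vanish; have p_pr := pcharf_prime charF.
(* Passage from ordinary to divided derivatives: [k!] is invertible because [k < l <= p]. *)
have co k : (k < l)%N -> (q^`N(k)).[x] = 0.
  move=> kl; have := vanish k kl; rewrite nderivn_def hornerMn => /eqP.
  rewrite -mulr_natr mulf_eq0 => /orP[/eqP //|].
  rewrite -(dvdn_pcharf charF) => pk.
  have : (p <= k)%N.
    elim: k pk {kl} => [|k IH].
      by rewrite fact0 dvdn1 => /eqP p1; have := p_pr; rewrite p1.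
    rewrite factS Euclid_dvdM // => /orP[/dvdn_leq -> //|/IH]; lia.
  lia.
suff -> : q = \sum_(i < size q) q^`N(i).[x] *: ('X - x%:P) ^+ i.
  apply: (big_ind (fun u => _ %| u)); first exact: dvdp0.
    by move=> u w; exact: dvdp_add.
  move=> i _; case: (ltnP i l) => il.
    by rewrite co // scale0r dvdp0.
  by rewrite -mul_polyC dvdp_mull // dvdp_exp2l.
have E : q = (q \Po ('X + x%:P)) \Po ('X - x%:P).
  by rewrite -comp_polyA comp_polyD comp_polyX comp_polyC subrK comp_polyXr.
rewrite {1}E.
have -> : q \Po ('X + x%:P) = \sum_(i < size q) q^`N(i).[x] *: 'X^i.
  rewrite /comp_poly addrC.
  rewrite nderiv_taylor; last exact: mulrC.
  rewrite size_map_polyC; apply: eq_bigr => i _.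
  have -> : (map_poly polyC q)^`N(i) = map_poly polyC (q^`N(i)).
    by apply/polyP => j; rewrite coef_nderivn !coef_map /= coef_nderivn rmorphMn.
  by rewrite horner_map /= mul_polyC.
rewrite raddf_sum /=; apply: eq_bigr => i _.
by rewrite comp_polyZ comp_Xn_poly.
Qed.

Lemma roots_mult_size (F : fieldType) (q : {poly F}) (l : nat) (s : seq F) :
  q != 0 -> uniq s -> (forall x, x \in s -> ('X - x%:P) ^+ l %| q) ->
  (l * size s < size q)%N.
Proof.
move=> q0 us dv.
have D : (\prod_(x <- s) ('X - x%:P)) ^+ l %| q.
  elim: s us dv => [|x s IH] /=; first by rewrite big_nil expr1n dvd1p.
  move=> /andP[xs us] dv; rewrite big_cons exprMn Gauss_dvdp.
    rewrite dv ?mem_head //= IH // => y ys; apply: dv; rewrite inE ys orbT //.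
  apply/coprimep_expl/coprimep_expr.
  by rewrite coprimep_sym coprimep_XsubC root_prod_XsubC.
have N0 : (\prod_(x <- s) ('X - x%:P)) ^+ l != 0.
  by rewrite expf_neq0 // monic_neq0 // monic_prod_XsubC.
have := dvdp_leq q0 D.
have := size_exp (\prod_(x <- s) ('X - x%:P)) l.
rewrite size_prod_XsubC /= mulnC => <-; move: N0; rewrite -size_poly_gt0.
by move=> ? ?; rewrite prednK.
Qed.

Lemma derivXM (R : comNzRingType) (q u : {poly R}) d :
  (q ^+ d.+1 * u)^`() = q ^+ d * (q^`() * u *+ d.+1 + q * u^`()).
Proof.
rewrite derivM deriv_exp /= exprS mulrDr mulrnAl mulrnAr; congr (_ + _).
  by rewrite mulrA [q^`() * _]mulrC.
by rewrite mulrA [q * _]mulrC.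
Qed.

(** Differentiation of one summand, over abstract ring elements so that [ring] applies: [X] stands
    for a power of ['X^p], whose derivative is the final [0], and the hypothesis is the logarithmic
    derivative of [g = f ^+ n], which absorbs [g']. *)
Lemma stepanov_coef_step (A : comNzRingType) (a f R W R' W' g g' X : A) (d n : nat) :
  f * g' = a * g *+ n ->
  a * ((R + W * g) * X) *+ d + f * ((R' + (W' * g + W * g')) * X + (R + W * g) * 0)
  = (a * R *+ d + f * R' + (a * W *+ (d + n) + f * W') * g) * X.
Proof.
move=> H; transitivity (a * ((R + W * g) * X) *+ d + f * (R' + W' * g) * X + W * (f * g') * X).
  ring.
rewrite H; ring.
Qed.

Variables (F : finFieldType) (p : nat).
Hypotheses (card_F : #|F| = p) (charF : p \in [pchar F]).
Variables (f h : {poly F}) (b : F).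
Hypotheses (size_f : size f = 5%N) (f0 : f.[0] != 0).
Hypotheses (fE : f = ('X - b%:P) * h) (hb : h.[b] != 0).

Variable n : nat.
Hypothesis p_odd : p = (2 * n).+1.
Hypothesis n_gt0 : (0 < n)%N.
Let g := f ^+ n.

Let f_neq0 : f != 0. Proof. by rewrite -size_poly_gt0 size_f. Qed.

Let fpE : 'X^p %| f ^+ p - (f.[0])%:P.
Proof.
have charP : p \in [pchar {poly F}] by rewrite pchar_poly.
have [u uE] : exists u, f = u * 'X + (f.[0])%:P.
  have : root (f - (f.[0])%:P) 0 by rewrite /root !hornerE subrr.
  by move=> /factor_theorem[u uE]; exists u; rewrite -[f in LHS](subrK (f.[0])%:P) uE subr0.
rewrite [in X in X - _]uE.
have -> : (u * 'X + (f.[0])%:P) ^+ p = (u * 'X) ^+ p + (f.[0])%:P ^+ p.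
  by rewrite -!(pFrobenius_autE charP) rmorphD.
rewrite -rmorphXn /= -[in f.[0] ^+ _]card_F expf_card addrK exprMn dvdp_mull //.
Qed.

(* Multiplying [r + s g] by [(r - s g) f] gives [r^2 f = s^2 f^p = s^2 f(0) (mod X^p)]; the degrees turn
   this into an equality, contradicted by the parity of the multiplicity of the simple root [b]. *)
Lemma stepanov_indep (r s : {poly F}) (B : nat) :
  (size r <= B)%N -> (size s <= B)%N -> (2 * B + 4 <= p)%N ->
  'X^p %| r + s * g -> r = 0 /\ s = 0.
Proof.
move=> rB sB Bp dv.
have E : r ^+ 2 * f = s ^+ 2 * (f.[0])%:P.
  apply/eqP; rewrite -subr_eq0; apply/negPn/negP => N0.
  have D : 'X^p %| r ^+ 2 * f - s ^+ 2 * (f.[0])%:P.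
    have -> : r ^+ 2 * f - s ^+ 2 * (f.[0])%:P =
      (r + s * g) * (r - s * g) * f + s ^+ 2 * (f ^+ p - (f.[0])%:P).
      rewrite [f ^+ p](_ : _ = f * (g * g)); last by rewrite p_odd exprS mul2n -addnn exprD.
      by ring.
    apply: dvdp_add; last by rewrite dvdp_mull // fpE.
    by rewrite -mulrA dvdp_mulr.
  have := dvdp_leq N0 D; rewrite size_polyXn.
  have := size_polyD (r ^+ 2 * f) (- (s ^+ 2 * (f.[0])%:P)); rewrite size_polyN.
  have := size_polyMleq (r ^+ 2) f; have := size_polyMleq (s ^+ 2) (f.[0])%:P.
  rewrite !expr2; have := size_polyMleq r r; have := size_polyMleq s s.
  have := size_polyC_leq1 f.[0]; rewrite size_f.
  move=> h1 h2 h3 h4 h5 h6 h7.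
  have h8 : (size (s * s * (f.[0])%:P)%R <= 2 * B + 4)%N.
    by move: sB h1 h2 h4; clear; lia.
  have h9 : (size (r * r * f)%R <= 2 * B + 4)%N.
    by move: rB h3 h5; clear; lia.
  have := leq_trans h7 h6; rewrite ltnNge geq_max.
  by rewrite (leq_trans h8 Bp) (leq_trans h9 Bp).
have [s0|s0] := eqVneq s 0.
  split=> //; apply/eqP; move: E; rewrite s0 expr0n /= mul0r => /eqP.
  by rewrite mulf_eq0 (negPf f_neq0) orbF expf_eq0.
have [r0|r0] := eqVneq r 0.
  move: E; rewrite r0 expr0n /= mul0r => /esym/eqP.
  by rewrite mulf_eq0 polyC_eq0 (negPf f0) orbF expf_eq0 (negPf s0).
have h0 : h != 0 by apply: contraNneq hb => ->; rewrite horner0.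
have X0 : 'X - b%:P != 0 by rewrite polyXsubC_eq0.
move: (f.[0]) f0 E => c c0 E; have := congr1 (mup b) E.
rewrite fE !expr2 !mupM ?mulf_neq0 ?polyC_eq0 //.
rewrite (@mupNroot _ b (_%:P)) ?rootC //.
rewrite (@mupNroot _ b h) //.
by rewrite (@mup_XsubCX _ 1 b b) eqxx !addnn !addn0 addn1 => /(congr1 odd) /=; rewrite !odd_double.
Qed.

(* Coefficients of the [k]-th derivative of [f^l (r + s g) X^(j p)]: it is again of the form
   [f^(l - k) (r_k + s_k g) X^(j p)], and [c] is [0] for [r_k] and [n] (from [g = f^n]) for [s_k]. *)
Fixpoint stepanov_coef (l c k : nat) (u : {poly F}) : {poly F} :=
  if k is k'.+1 then
    let w := stepanov_coef l c k' u in f^`() * w *+ (l - k' + c) + f * w^`()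
  else u.

Lemma stepanov_coef_sub l c k : {morph stepanov_coef l c k : u w / u - w}.
Proof.
elim: k => //= k IH u w; rewrite IH derivB; ring.
Qed.

Lemma size_stepanov_coef l c k (u : {poly F}) B : (0 < B)%N -> (size u <= B)%N ->
  (size (stepanov_coef l c k u) <= B + 3 * k)%N.
Proof.
move=> B0 uB; elim: k => [|k IH] /=; first by rewrite muln0 addn0.
move: (stepanov_coef l c k u) IH => w wB.
apply: leq_trans (size_polyD _ _) _; rewrite geq_max; apply/andP; split.
  rewrite -mulr_natr; apply: leq_trans (size_polyMleq _ _) _.
  have := size_polyMleq f^`() w; have := lt_size_deriv f_neq0; rewrite size_f.
  have : (size ((l - k + c)%:R : {poly F}) <= 1)%N.
    by rewrite -polyC_natr size_polyC_leq1.
  lia.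
apply: leq_trans (size_polyMleq _ _) _; rewrite size_f.
have [->|w0] := eqVneq w 0; first by rewrite deriv0 size_poly0; lia.
have := lt_size_deriv w0; lia.
Qed.

Lemma derivn_stepanov l k (J : nat) (r s : 'I_J -> {poly F}) : (k <= l)%N ->
  (f ^+ l * \sum_(j < J) (r j + s j * g) * 'X^(j * p))^`(k) =
  f ^+ (l - k) * \sum_(j < J) (stepanov_coef l 0 k (r j) + stepanov_coef l n k (s j) * g) * 'X^(j * p).
Proof.
elim: k => [|k IH] kl; first by rewrite subn0 derivn0.
rewrite derivnS IH ?(ltnW kl) //.
have gD : f * g^`() = f^`() * g *+ n.
  have gE : g = f * f ^+ n.-1 by rewrite -exprS prednK.
  by rewrite {1}/g deriv_exp mulrnAr mulrCA -gE.
have XD j : ('X^(j * p))^`() = 0 :> {poly F}.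
  by rewrite derivXn mulrnA -mulr_natr -polyC_natr (pcharf0 charF) mulr0.
have -> : (l - k)%N = (l - k.+1).+1 by lia.
set d := (l - k.+1)%N.
set S := \sum_(j < J) _.
rewrite derivXM; congr (_ * _); rewrite /S raddf_sum /= !mulr_sumr -sumrMnl -big_split /=.
apply: eq_bigr => j _.
set R := stepanov_coef l 0 k (r j); set W := stepanov_coef l n k (s j).
rewrite derivM XD derivD derivM.
have -> : (l - k + 0 = d.+1)%N by rewrite /d; move: kl; clear; lia.
have -> : (l - k + n = d.+1 + n)%N by rewrite /d; move: kl; clear; lia.
exact: stepanov_coef_step.
Qed.

(** Modulo ['X^p] only the summand [j = 0] survives, and [stepanov_indep] kills it; division by
    ['X^p] then lowers the other indices. Hence a nonzero coefficient vector gives a nonzero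
    auxiliary polynomial. *)
Lemma stepanov_eq0 (J B : nat) (r s : nat -> {poly F}) :
  (forall j, size (r j) <= B)%N -> (forall j, size (s j) <= B)%N ->
  (2 * B + 4 <= p)%N ->
  \sum_(j < J) (r j + s j * g) * 'X^(j * p) = 0 ->
  forall j, (j < J)%N -> r j = 0 /\ s j = 0.
Proof.
move=> + + Bp; elim: J r s => [|J IH] r s rB sB //.
rewrite big_ord_recl mul0n expr0 mulr1.
have -> : \sum_(i < J) (r (lift ord0 i) + s (lift ord0 i) * g) * 'X^(lift ord0 i * p) =
   (\sum_(i < J) (r i.+1 + s i.+1 * g) * 'X^(i * p)) * 'X^p.
  rewrite mulr_suml; apply: eq_bigr => i _.
  by rewrite -mulrA -exprD /= /bump /= add1n mulSn addnC.
set S := \sum_(i < J) _ => E.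
have [r0 s0] : r 0%N = 0 /\ s 0%N = 0.
  apply: (stepanov_indep (rB 0%N) (sB 0%N) Bp).
  by move/eqP: E; rewrite addr_eq0 => /eqP ->; rewrite dvdpNr dvdp_mull.
move: E; rewrite r0 s0 mul0r !add0r => /eqP.
rewrite mulf_eq0 expf_eq0 polyX_eq0 andbF orbF => /eqP S0 [_|j] //.
by rewrite ltnS => jJ; exact: (IH (fun j => r j.+1) (fun j => s j.+1)).
Qed.

Definition coef_polys (J B : nat) (u : {ffun 'I_J * bool * 'I_B -> F}) (c : bool) (j : nat) :
  {poly F} := if insub j is Some i then \poly_(k < B) (if insub k is Some k' then u (i, c, k') else 0) else 0.

Lemma size_coef_polys (J B : nat) (u : {ffun 'I_J * bool * 'I_B -> F}) c j :
  (size (coef_polys u c j) <= B)%N.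
Proof.
rewrite /coef_polys; case: insubP => [i _ _|_]; last by rewrite size_poly0.
exact: size_poly.
Qed.

Lemma coef_polys_sub (J B : nat) c j :
  {morph (fun u : {ffun 'I_J * bool * 'I_B -> F} => coef_polys u c j) : u w / u - w}.
Proof.
move=> u w; rewrite /coef_polys; case: insubP => [i _ _|_]; last by rewrite subr0.
apply/polyP => k; rewrite coefB !coef_poly.
case: ifP => kB; last by rewrite subr0.
by rewrite insubT !ffunE.
Qed.

Lemma coef_polys_inj (J B : nat) (u : {ffun 'I_J * bool * 'I_B -> F}) :
  (forall c j, (j < J)%N -> coef_polys u c j = 0) -> u = 0.
Proof.
move=> H; apply/ffunP => -[[i c] k]; rewrite ffunE.
have := congr1 (fun q : {poly F} => q`_k) (H c i (ltn_ord i)).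
by rewrite /coef_polys (valK i) coef0 coef_poly ltn_ord (valK k).
Qed.

(** The [k]-th derivative without its power of [f], as seen at the points where [g] takes the value
    [e]: there [g] becomes [e], and ['X^(j * p)] becomes ['X^j] because [x ^+ p = x]. The degree
    drops from about [J p] to about [B + 3 k + J], so that identical vanishing costs few linear
    conditions. *)
Definition stepanov_poly l J B (e : F) (u : {ffun 'I_J * bool * 'I_B -> F}) k :=
  \sum_(j < J) (stepanov_coef l 0 k (coef_polys u false j) +
                stepanov_coef l n k (coef_polys u true j) * e%:P) * 'X^j.

Lemma size_stepanov_poly l J B e (u : {ffun 'I_J * bool * 'I_B -> F}) k :
  (0 < B)%N -> (size (stepanov_poly l e u k) <= B + 3 * k + J)%N.
Proof.
move=> B0; apply: leq_trans (size_sum _ _ _) _; apply/bigmax_leqP => j _.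
apply: leq_trans (size_polyMleq _ _) _; rewrite size_polyXn addnS /=.
apply: leq_add (ltnW (ltn_ord j)).
apply: leq_trans (size_polyD _ _) _; rewrite geq_max size_stepanov_coef ?size_coef_polys //=.
apply: leq_trans (size_polyMleq _ _) _.
have := size_stepanov_coef l n k B0 (size_coef_polys u true j).
have := size_polyC_leq1 e; clear; lia.
Qed.

Lemma stepanov_poly_sub l J B e k :
  {morph (fun u : {ffun 'I_J * bool * 'I_B -> F} => stepanov_poly l e u k) : u w / u - w}.
Proof.
move=> u w; rewrite /stepanov_poly -sumrB; apply: eq_bigr => j _.
rewrite !coef_polys_sub !stepanov_coef_sub; ring.
Qed.

(** Linear algebra by pigeonhole: [2 J B] coefficients against [l (B + 3 l + J)] linear conditions,
    so two vectors have the same image and their difference lies in the kernel. *)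
Lemma stepanov_exists l J B e : (0 < B)%N -> (l * (B + 3 * l + J) < 2 * J * B)%N ->
  exists u : {ffun 'I_J * bool * 'I_B -> F},
    u != 0 /\ forall k, (k < l)%N -> stepanov_poly l e u k = 0.
Proof.
move=> B0 lt; set M := (B + 3 * l + J)%N.
pose L (u : {ffun 'I_J * bool * 'I_B -> F}) : {ffun 'I_l * 'I_M -> F} :=
  [ffun x : 'I_l * 'I_M => (stepanov_poly l e u (x.1 : 'I_l))`_(x.2 : 'I_M)].
have : ~~ injectiveb L.
  apply/negP => /injectiveP /leq_card; rewrite !card_ffun !card_prod card_bool !card_ord.
  rewrite leq_exp2l; last by rewrite card_F prime_gt1 // (pcharf_prime charF).
  by move: lt; clear; lia.
case/injectivePn => u [w uw E]; exists (u - w); split; first by rewrite subr_eq0.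
move=> k kl; rewrite stepanov_poly_sub; apply/polyP => i; rewrite coef0 coefB.
case: (ltnP i M) => iM.
  have := congr1 (fun v : {ffun _} => v (Ordinal kl, Ordinal iM)) E.
  by rewrite !ffunE /= => ->; rewrite subrr.
have H (v : {ffun 'I_J * bool * 'I_B -> F}) : (stepanov_poly l e v k)`_i = 0.
  apply: nth_default; apply: leq_trans (size_stepanov_poly l e v k B0) _.
  by apply: leq_trans iM; rewrite /M; move: kl; clear; lia.
by rewrite !H subrr.
Qed.

(** The auxiliary polynomial [f ^+ l * S] vanishes to order [l] at every point counted, so [l] times
    their number is at most its degree; the four terms of the bound come from [f ^+ l], the
    coefficients, [g] and the top power of ['X^p]. *)
Lemma stepanov_count l J B (e : F) : (0 < B)%N -> (2 * B + 4 <= p)%N ->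
  (l <= p)%N -> (0 < J)%N -> (l * (B + 3 * l + J) < 2 * J * B)%N ->
  (l * #|[pred x | g.[x] == e]| <= 4 * l + B + 4 * n + J.-1 * p)%N.
Proof.
move=> B0 Bp lp J0 lt.
have [u [u0 uE]] := stepanov_exists e B0 lt.
pose r := coef_polys u false; pose s := coef_polys u true.
set S := \sum_(j < J) (r j + s j * g) * 'X^(j * p).
have S0 : S != 0.
  apply: contraNneq u0 => S0; apply/eqP/coef_polys_inj => c j jJ.
  have := stepanov_eq0 (size_coef_polys u false) (size_coef_polys u true) Bp S0 jJ.
  by case: c => -[].
have FS0 : f ^+ l * S != 0 by rewrite mulf_neq0 // expf_neq0.
have dv x : x \in enum [pred x | g.[x] == e] -> ('X - x%:P) ^+ l %| f ^+ l * S.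
  rewrite mem_enum inE => /eqP gx.
  apply: (dvdp_XsubC_exp charF lp) => k kl.
  rewrite (derivn_stepanov (fun j => r j) (fun j => s j) (ltnW kl)) hornerM.
  have := congr1 (fun q => q.[x]) (uE k kl); rewrite horner0 /stepanov_poly !horner_sum.
  move=> E; rewrite [X in _ * X](_ : _ = 0) ?mulr0 // -[RHS]E.
  apply: eq_bigr => j _; rewrite !(hornerM, hornerD, hornerXn, hornerC) gx mulnC exprM -[x ^+ p](_ : x = _) //.
  by rewrite -card_F expf_card.
have := roots_mult_size FS0 (enum_uniq _) dv; rewrite -cardE => H.
rewrite -ltnS; apply: leq_trans H _.
have E1 : (size (f ^+ l) <= (4 * l).+1)%N.
  by have := size_exp f l; rewrite size_f /= => <-; exact: leqSpred.
have Eg : (size g <= (4 * n).+1)%N.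
  by have := size_exp f n; rewrite size_f /= => <-; exact: leqSpred.
have E2 : (size S <= B + 4 * n + J.-1 * p)%N.
  apply: leq_trans (size_sum _ _ _) _; apply/bigmax_leqP => j _.
  apply: leq_trans (size_polyMleq _ _) _; rewrite size_polyXn addnS /=.
  apply: leq_add; last by rewrite leq_mul2r; have := ltn_ord j; move: J0; clear; lia.
  apply: leq_trans (size_polyD _ _) _; rewrite geq_max.
  apply/andP; split; first by apply: leq_trans (size_coef_polys _ _ _) _; rewrite leq_addr.
  apply: leq_trans (size_polyMleq _ _) _.
  by have := size_coef_polys u true j; move: Eg; rewrite -/s; clear; lia.
apply: leq_trans (size_polyMleq _ _) _.
apply: leq_trans (leq_pred _) _; apply: leq_trans (leq_add E1 E2) _.
by clear; lia.
Qed.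
End Stepanov.

(** * Quadratic characters *)

Section QuadraticCharacter.
Local Open Scope ring_scope.
Variables (F : finFieldType) (n : nat).
Hypotheses (card_F : #|F| = (2 * n).+1) (charF : (2 * n).+1 \in [pchar F]).

(* Euler's criterion; the value at [0] is [0]. *)
Definition qchar (x : F) : int :=
  let e := x ^+ n in (e == 1)%:R - (e == -1)%:R.

Let n_gt0 : (0 < n)%N.
Proof. by have := finNzRing_gt1 F; rewrite card_F; case: n. Qed.

Let one_neqN1 : (1 : F) != -1.
Proof.
apply/eqP => E; have H : (2%:R : F) == 0 by rewrite mulr2n {1}E addNr.
move: H; rewrite -(dvdn_pcharf charF) dvdn_prime2 ?(pcharf_prime charF) // => /eqP.
by clear; lia.
Qed.

Lemma qchar_euler (x : F) : [\/ x ^+ n = 1, x ^+ n = -1 | x = 0].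
Proof.
have [->|x0] := eqVneq x 0; first by constructor 3.
have : (x ^+ n - 1) * (x ^+ n + 1) == 0.
  rewrite -subr_sqr expr1n -exprM subr_eq0 mulnC; apply/eqP.
  by apply: (mulIf x0); rewrite -exprSr -card_F expf_card mul1r.
rewrite mulf_eq0 subr_eq0 addr_eq0 => /orP[/eqP|/eqP] ->; by [constructor 1|constructor 2].
Qed.

Lemma qcharM x y : qchar (x * y) = qchar x * qchar y.
Proof.
rewrite /qchar exprMn.
have E0 : (0 : F) ^+ n = 0 by rewrite expr0n -(prednK n_gt0).
have N1 := negPf one_neqN1.
have Z1 : (0 == 1 :> F) = false by rewrite eq_sym oner_eq0.
have Z2 : (0 == -1 :> F) = false by rewrite eq_sym oppr_eq0 oner_eq0.
have N2 : (-1 == 1 :> F) = false by rewrite eq_sym.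
case: (qchar_euler x) => ->; case: (qchar_euler y) => ->; rewrite ?E0
  ?(mulr1, mul1r, mulrN1, opprK, mulr0, mul0r, oppr0, eqxx, N1, N2, Z1, Z2) //.
Qed.

Lemma qchar_norm x : `|qchar x| <= 1.
Proof. by rewrite /qchar; case: (_ == 1); case: (_ == -1). Qed.

Lemma qchar_sqr x : x != 0 -> qchar x ^+ 2 = 1.
Proof.
rewrite /qchar => x0; case: (qchar_euler x) => [->|->|/eqP]; last by rewrite (negPf x0).
  by rewrite eqxx (negPf one_neqN1).
by rewrite eqxx [-1 == 1]eq_sym (negPf one_neqN1).
Qed.

Let roots_bound (s : seq F) : uniq s -> all (fun x => x ^+ n == 1) s -> (size s <= n)%N.
Proof.
move=> us /allP h; have P0 : 'X^n - 1 != 0 :> {poly F}.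
  by rewrite -size_poly_eq0 size_XnsubC.
have := max_poly_roots P0 _ us; rewrite size_XnsubC // ltnS; apply.
by apply/allP => x /h /eqP xn; rewrite /root !hornerE xn subrr.
Qed.

Lemma qchar_sum0 : \sum_(x : F) qchar x = 0.
Proof.
have [a a0 an] : exists2 a : F, a != 0 & a ^+ n = -1.
  suff /exists_inP[a a0 /eqP an] : [exists (a : F | a != 0), a ^+ n == -1] by exists a.
  apply: contraT; rewrite negb_exists_in => /forall_inP H.
  have := @roots_bound (enum [pred x : F | x != 0]) (enum_uniq _); rewrite -cardE.
  have -> : #|[pred x : F | x != 0]| = (2 * n)%N.
    by have := cardC1 (0 : F); rewrite card_F.
  have h : all (fun x : F => x ^+ n == 1) (enum [pred x : F | x != 0]).
    apply/allP => x; rewrite mem_enum inE => x0.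
    have := H x x0; case: (qchar_euler x) => [->|->|/eqP]; rewrite ?eqxx //.
    by rewrite (negPf x0).
  by move=> /(_ h); move: n_gt0; clear; lia.
have E : \sum_(x : F) qchar x = - \sum_(x : F) qchar x.
  rewrite [LHS](reindex_inj (mulfI a0)) -sumrN; apply: eq_bigr => x _.
  rewrite qcharM [qchar a](_ : _ = -1) ?mulN1r //.
  by rewrite /qchar an eqxx [-1 == 1]eq_sym (negPf one_neqN1).
by move: E; lia.
Qed.

(** Were [x] with [x ^+ n = 1] not a square, the nonzero squares would be fewer than [n], since
    ['X^n - 1] has at most [n] roots and [x] is one more. But squaring is at most two-to-one on the
    [2 n] nonzero elements: [inj] codes [y] by its square and one bit telling whether [y] is the
    chosen root. *)
Lemma qchar_ge0_sqr (x : F) : 0 <= qchar x -> exists y : F, y ^+ 2 = x.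
Proof.
case: (qchar_euler x) => [x1|xN|->]; last by exists 0; rewrite expr0n.
  move=> _; pose im := [pred z : F | [exists y, (y != 0) && (y ^+ 2 == z)]].
  have [/existsP[y /andP[_ /eqP yE]]|xim] := boolP (x \in im); first by exists y.
  have x0 : x \notin enum im by rewrite mem_enum.
  have := @roots_bound (x :: enum im); rewrite /= x0 enum_uniq => /(_ isT).
  have -> : (x ^+ n == 1) && all (fun z => z ^+ n == 1) (enum im).
    rewrite x1 eqxx /=; apply/allP => z; rewrite mem_enum => /existsP[y /andP[y0 /eqP <-]].
    apply/eqP; apply: (mulIf y0); by rewrite -exprM -exprSr -card_F expf_card mul1r.
  rewrite -cardE => /(_ isT) H.
  pose c z : F := odflt 0 [pick y | y ^+ 2 == z].
  pose inj (y : {y : F | y != 0}) : {z | z \in im} * bool :=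
    (exist _ (val y ^+ 2) (introT existsP (ex_intro _ (val y) (introT andP (conj (valP y) (eqxx _))))), val y == c (val y ^+ 2)).
  have inj_inj : injective inj.
    move=> y1 y2 [E1 E2]; apply: val_inj => /=.
    have cE : c (val y1 ^+ 2) ^+ 2 = val y1 ^+ 2.
      rewrite /c; case: pickP => [w /eqP //|/(_ (val y1))]; by rewrite eqxx.
    move: E2; rewrite -E1; case: eqP => [e1 /esym/eqP e2|/eqP n1 /esym/negbT n2].
      by rewrite [LHS]e1 e2.
    have g (y : F) : y ^+ 2 = val y1 ^+ 2 -> y != c (val y1 ^+ 2) -> y = - c (val y1 ^+ 2).
      move=> yE; rewrite -cE in yE; move: yE => /eqP; rewrite eqf_sqr => /orP[->|/eqP //] //.
    by rewrite [LHS]g // [RHS]g.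
  have := leq_card _ inj_inj; rewrite card_prod card_bool !card_sig.
  have -> : #|[pred x : F | x != 0]| = (2 * n)%N.
    by have := cardC1 (0 : F); rewrite card_F.
  rewrite [#|[pred x | x \in im]|](_ : _ = #|im|); last by apply: eq_card.
  by rewrite mulnC leq_pmul2r // leqNgt H.
by rewrite /qchar xN eqxx [-1 == 1]eq_sym (negPf one_neqN1).
Qed.

End QuadraticCharacter.

(** * Complete quartic character sums *)

Section QuarticSum.
Local Open Scope ring_scope.
Variables (F : finFieldType) (n : nat).
Hypotheses (card_F : #|F| = (2 * n).+1) (charF : (2 * n).+1 \in [pchar F]).

Lemma sqrt_nat m : exists l, (l ^ 2 <= m < l.+1 ^ 2)%N.
Proof.
elim: m => [|m [l /andP[l1 l2]]]; first by exists 0%N.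
case: (ltnP m.+1 (l.+1 ^ 2)) => h; first by exists l; rewrite h (leqW l1).
exists l.+1; rewrite h /=; move: l2; rewrite !expnS !expn0; clear; nia.
Qed.

(** Stepanov's method bounds the number of [x] where [f ^+ n] is [1], and likewise [-1], by
    [p / 2 + O(sqrt p)] from above. At most four [x] lie in neither class, so both counts are within
    [O(sqrt p)] of [p / 2]. Only the root [- b1] has to be simple; the other shifts may coincide. *)
Lemma qchar_quartic_sum_nz (b1 b2 b3 b4 : F) : (64 ^ 2 < (2 * n).+1)%N ->
  b1 != 0 -> b2 != 0 -> b3 != 0 -> b4 != 0 ->
  b1 != b2 -> b1 != b3 -> b1 != b4 ->
  (\sum_x qchar n ((x + b1) * (x + b2) * (x + b3) * (x + b4))) ^+ 2 <= (64 ^ 2 * (2 * n).+1)%:R.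
Proof.
move=> p_large n1 n2 n3 n4 b12 b13 b14; set p := (2 * n).+1 in p_large *.
pose s := [:: - b1; - b2; - b3; - b4].
pose h := \prod_(z <- [:: - b2; - b3; - b4]) ('X - z%:P).
pose f := \prod_(z <- s) ('X - z%:P).
have fE : f = ('X - (- b1)%:P) * h by rewrite /f big_cons.
have fx x : f.[x] = (x + b1) * (x + b2) * (x + b3) * (x + b4).
  by rewrite /f !big_cons big_nil !hornerE !opprK /= mulr1.
have f0 : f.[0] != 0 by rewrite fx !add0r !mulf_neq0.
have hb : h.[- b1] != 0.
  rewrite /h !big_cons big_nil !hornerE !opprK /= mulr1 !mulf_neq0 //;
  by rewrite addrC subr_eq0 eq_sym.
have sf : size f = 5%N by rewrite /f size_prod_XsubC.
have n_gt0 : (0 < n)%N by move: p_large; rewrite /p; case: (n).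
have [l /andP[l1 l2]] := sqrt_nat p.
(* [2 J >= l + 13] and [B] about [p / 2] give [2 J B] a surplus of about [13 p / 2] over [l B],
   which covers [l (3 l + J)], about [7 p / 2]. On the other side [J p / l] is still
   [p / 2 + O(sqrt p)], as [l] is about [sqrt p]. *)
pose J := (l./2 + 7)%N; pose B := ((p - 4) %/ 2)%N.
have Bp : (2 * B + 4 <= p)%N by move: p_large; rewrite /B; clear; lia.
have B0 : (0 < B)%N by move: p_large; rewrite /B; clear; lia.
have J2 : (l + 13 <= 2 * J <= l + 14)%N by rewrite /J; clear; lia.
have J0 : (0 < J)%N by move: J2; clear; lia.
have B2 : (p - 5 <= 2 * B)%N by rewrite /B; clear; lia.
have l64 : (64 <= l)%N.
  by rewrite leqNgt; apply/negP => l64; move: l64 l2 p_large; clear; rewrite !expnS !expn0; nia.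
have lp : (l <= p)%N by move: l1; clear; rewrite !expnS !expn0; nia.
have lt : (l * (B + 3 * l + J) < 2 * J * B)%N.
  have H1 : (2 * (l * (B + 3 * l + J)) <= 2 * l * B + 7 * p + 14 * l)%N.
    by move: l1 J2; clear; rewrite !expnS !expn0; nia.
  have H2 : (2 * l * B + 26 * B <= 2 * (2 * J * B))%N by move: J2; clear; nia.
  have H3 : (64 * l <= p)%N by move: l1 l64; clear; rewrite !expnS !expn0; nia.
  by move: H1 H2 H3 B2 l64; clear; lia.
pose N e := #|[pred x : F | (f ^+ n).[x] == e]|.
have NB e : (2 * N e <= p + 17 * l + 42)%N.
  have := stepanov_count card_F charF sf f0 fE hb (erefl _) n_gt0 e B0 Bp lp J0 lt.
  rewrite -/(N e) -/p => H.
  have H1 : (l * (2 * N e) <= 8 * l + 5 * p + (l + 12) * p)%N.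
    have : (2 * (J.-1 * p) <= (l + 12) * p)%N by move: J2; clear; nia.
    have : (2 * B <= p)%N by move: Bp; clear; lia.
    have : (2 * (4 * n) <= 4 * p)%N by rewrite /p; clear; lia.
    by move: H; clear; lia.
  have H2 : (p <= l * (l + 2))%N by move: l2; clear; rewrite !expnS !expn0; nia.
  have : (l * (2 * N e) <= l * (p + 17 * l + 42))%N by move: H1 H2; clear; nia.
  by rewrite leq_pmul2l //; move: l64; clear; lia.
have Nsum : (p <= N 1%R + N (-1)%R + 4)%N.
  rewrite /p -card_F -sum1_card /N -!sum1_card.
  rewrite [(\sum_(x in [pred x | _ == 1%R]) 1)%N]big_mkcond [(\sum_(x in [pred x | _ == (-1)%R]) 1)%N]big_mkcond /=.
  have : (\sum_(x : F | x \in s) 1 <= 4)%N by rewrite sum1_card; exact: (card_size s).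
  rewrite [(\sum_(x | x \in s) 1)%N]big_mkcond => H.
  apply: leq_trans (leq_add (leqnn _) H); rewrite -!big_split /=.
  apply: leq_sum => x _; have := root_prod_XsubC s x; rewrite -/f.
  move: (x \in s) => rs rE; rewrite !inE horner_exp.
  case: (qchar_euler card_F f.[x]) => [->|->|].
  - by rewrite eqxx -addnA leq_addr.
  - by rewrite eqxx addnAC leq_addl.
  - by move/eqP; rewrite -[_ == 0]/(root f x) rE => ->; rewrite leq_addl.
have SE : \sum_x qchar n ((x + b1) * (x + b2) * (x + b3) * (x + b4)) = (N 1)%:R - (N (-1))%:R.
  have NE e : (N e)%:R = \sum_x ((f.[x] ^+ n == e)%:R : int).
    rewrite /N -sum1_card big_mkcond natr_sum; apply: eq_bigr => y _.
    by rewrite inE horner_exp; case: (_ == e).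
  by rewrite !NE -sumrB; apply: eq_bigr => y _; rewrite fx.
have NB1 := NB 1; have NB2 := NB (-1).
have : `|(N 1)%:R - (N (-1))%:R : int| <= (64 * l)%:R.
  by move: NB1 NB2 Nsum l64; clear; move: (N _) (N _); lia.
rewrite SE; set D := _ - _ => H.
have -> : D ^+ 2 = `|D| ^+ 2 by rewrite -normrX ger0_norm ?sqr_ge0.
apply: le_trans (lerXn2r 2 _ _ H) _; rewrite ?nnegrE ?normr_ge0 ?ler0n //.
by rewrite -natrX ler_nat expnMn leq_mul2l l1 orbT.
Qed.

(** The trivial bound [p] suffices for [p <= 64 ^ 2]; beyond, some [x0] is not a root, and
    translating by it makes all four shifts nonzero. *)
Lemma qchar_quartic_sum (b1 b2 b3 b4 : F) :
  b1 != b2 -> b1 != b3 -> b1 != b4 ->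
  (\sum_x qchar n ((x + b1) * (x + b2) * (x + b3) * (x + b4))) ^+ 2 <= (64 ^ 2 * (2 * n).+1)%:R.
Proof.
move=> b12 b13 b14; set p := (2 * n).+1.
set S := \sum_x _.
have Sp : `|S| <= p%:R.
  apply: le_trans (ler_norm_sum _ _ _) _; rewrite /p -card_F -sum1_card natr_sum.
  by apply: ler_sum => x _; exact: qchar_norm.
case: (leqP p (64 ^ 2)) => p_large.
  have -> : S ^+ 2 = `|S| ^+ 2 by rewrite -normrX ger0_norm ?sqr_ge0.
  apply: le_trans (lerXn2r 2 _ _ Sp) _; rewrite ?nnegrE ?normr_ge0 ?ler0n //.
  by rewrite -natrX ler_nat expnS expn1 leq_mul2r p_large orbT.
have [x0 x0E] : exists x0 : F, x0 \notin [:: - b1; - b2; - b3; - b4].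
  apply/existsP; apply: contraT; rewrite negb_exists => /forallP H.
  have : (#|F| <= size [:: - b1; - b2; - b3; - b4])%N.
    apply: leq_trans (card_size _); apply/subset_leq_card/fintype.subsetP => x _.
    by have := H x; rewrite negbK.
  by rewrite card_F -/p /=; move: p_large; clear; lia.
have SE : S = \sum_x qchar n ((x + (b1 + x0)) * (x + (b2 + x0)) * (x + (b3 + x0)) * (x + (b4 + x0))).
  by rewrite /S (reindex_inj (addIr x0)); apply: eq_bigr => x _; rewrite -!addrA ![x0 + _]addrC.
rewrite SE; apply: qchar_quartic_sum_nz => //; rewrite ?(inj_eq (addIr x0)) //.
all: by rewrite addrC addr_eq0; move: x0E; rewrite !inE !negb_or => /and4P[].
Qed.
End QuarticSum.

(** * Sums of periodic functions *)

Section PeriodicSums.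
Local Open Scope ring_scope.

Definition periodic (c : nat) (f : nat -> int) := forall n, f (n + c)%N = f n.

Lemma periodic_mul c f k n : periodic c f -> f (n + k * c)%N = f n.
Proof.
move=> H; elim: k => [|k IH]; first by rewrite mul0n addn0.
by rewrite mulSn [(c + _)%N]addnC addnA H.
Qed.

Lemma periodic_modn c f n : periodic c f -> f (n %% c)%N = f n.
Proof. by move=> H; rewrite {2}(divn_eq n c) addnC periodic_mul. Qed.

Lemma periodic_dvd c d f : (c %| d)%N -> periodic c f -> periodic d f.
Proof. by move=> /dvdnP[k ->] H n; exact: periodic_mul. Qed.

Lemma periodicM c f g : periodic c f -> periodic c g -> periodic c (fun n => f n * g n).
Proof. by move=> F G n; rewrite F G. Qed.

Lemma sum_crt m n f g : coprime m n -> periodic m f -> periodic n g ->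
  \sum_(i < m * n) f i * g i = (\sum_(i < m) f i) * (\sum_(j < n) g j).
Proof.
move=> co pf pg; case: (posnP m) => [m0|m0].
  by rewrite m0 mul0n !big_ord0 mul0r.
case: (posnP n) => [n0|n0].
  by rewrite n0 muln0 !big_ord0 mulr0.
rewrite big_distrlr /= pair_big /=.
pose h (k : 'I_(m * n)) : 'I_m * 'I_n := (Ordinal (ltn_pmod k m0), Ordinal (ltn_pmod k n0)).
have hi : injective h.
  move=> k1 k2 [/eqP e1 /eqP e2]; apply: val_inj => /=.
  have : (k1 == k2 %[mod m * n])%N by rewrite chinese_remainder // e1 e2.
  by rewrite !modn_small // => /eqP.
have hb : bijective h by apply: inj_card_bij => //; rewrite card_prod !card_ord.
rewrite (reindex h) /=; last exact: onW_bij.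
by apply: eq_bigr => k _; rewrite !periodic_modn.
Qed.

Lemma sum_shift c f a : periodic c f -> \sum_(i < c) f (a + i)%N = \sum_(i < c) f i.
Proof.
move=> H; elim: a => [//|a <-]; case: c H => [|c] H; first by rewrite !big_ord0.
rewrite big_ord_recr [RHS]big_ord_recl /= addrC addSnnS H addn0; congr (_ + _).
by apply: eq_bigr => i _; rewrite addSnnS.
Qed.

Lemma sum_periodic c f N : (0 < c)%N -> periodic c f -> \sum_(i < c) f i = 0 ->
  (forall n, `|f n| <= 1) -> `|\sum_(i < N) f i.+1| <= c%:R.
Proof.
move=> c0 H S0 f1; rewrite (divn_eq N c); move: (N %/ c)%N => k.
have -> : \sum_(i < k * c + N %% c) f i.+1 = \sum_(i < N %% c) f (k * c + i).+1.
  rewrite big_split_ord /= [X in X + _](_ : _ = 0) ?add0r //.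
  elim: k => [|k IH]; first by rewrite mul0n big_ord0.
  rewrite mulSn addnC big_split_ord /= IH add0r -[RHS]S0 -(sum_shift (k * c).+1 H).
  by apply: eq_bigr => i _; rewrite addSn.
apply: le_trans (ler_norm_sum _ _ _) _.
apply: le_trans (_ : (\sum_(i < N %% c) 1) <= _); first exact: ler_sum.
by rewrite sumr_const card_ord ler_nat ltnW // ltn_pmod.
Qed.

End PeriodicSums.

(** * Legendre symbols, and real characters to squarefree odd moduli *)

Section Legendre.
Local Open Scope ring_scope.

Definition chi (p n : nat) : int := qchar (p.-1)./2 (n%:R : 'F_p).

Definition oddprime p := prime p && odd p.

Section OnePrime.
Variable p : nat.
Hypothesis op : oddprime p.
Let p_pr : prime p. Proof. by case/andP: op. Qed.

Let pE : p = (2 * (p.-1)./2).+1.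
Proof.
have := prime_gt0 p_pr; case/andP: op => _; case: (p) => //= q oq _.
by rewrite mul2n even_halfK // -[odd q]negbK -oddS oq.
Qed.

Let cF : #|'F_p| = (2 * (p.-1)./2).+1.
Proof. by rewrite card_Fp. Qed.

Let chF : (2 * (p.-1)./2).+1 \in [pchar 'F_p].
Proof. by rewrite -pE pchar_Fp. Qed.

Lemma chi_mod n : chi p (n %% p) = chi p n.
Proof. by rewrite /chi Fp_nat_mod. Qed.

Lemma chi_periodic : periodic p (chi p).
Proof. by move=> n; rewrite -chi_mod modnDr chi_mod. Qed.

Lemma chiM m n : chi p (m * n) = chi p m * chi p n.
Proof. by rewrite /chi natrM (qcharM cF chF). Qed.

Lemma chi_norm n : `|chi p n| <= 1.
Proof. exact: qchar_norm. Qed.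

Lemma chi_sqr n : ~~ (p %| n)%N -> chi p n ^+ 2 = 1.
Proof. by rewrite (dvdn_pcharf (pchar_Fp p_pr)) => n0; rewrite /chi (qchar_sqr cF chF). Qed.

Lemma sum_Fp (f : 'F_p -> int) : \sum_x f x = \sum_(i < p) f (i : nat)%:R.
Proof.
pose g (i : nat) := f i%:R; rewrite -(big_mkord xpredT g).
transitivity (\sum_(0 <= i < (Zp_trunc (pdiv p)).+2) g i); last by rewrite Fp_cast.
by rewrite big_mkord; apply: eq_bigr => x _; rewrite /g natr_Zp.
Qed.

Lemma chi_sum0 : \sum_(i < p) chi p i = 0.
Proof. by rewrite -(sum_Fp (qchar _)) (qchar_sum0 cF chF). Qed.

Lemma chi_ge0_sqr n : 0 <= chi p n -> exists m, (m ^ 2 = n %[mod p])%N.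
Proof.
move=> /(qchar_ge0_sqr cF chF)[y yE]; exists (y : nat).
have := val_Fp_nat p_pr n; have := val_Fp_nat p_pr (y ^ 2).
by rewrite natrX natr_Zp yE => -> ->.
Qed.

Lemma chi_quartic_sum (b1 b2 b3 b4 : nat) :
  ~~ (b1 == b2 %[mod p]) -> ~~ (b1 == b3 %[mod p]) -> ~~ (b1 == b4 %[mod p]) ->
  (\sum_(x < p) chi p (x + b1) * chi p (x + b2) * chi p (x + b3) * chi p (x + b4)) ^+ 2
  <= (64 ^ 2 * p)%:R.
Proof.
have H b c : ~~ (b == c %[mod p]) -> (b%:R : 'F_p) != c%:R.
  by apply: contra => /eqP E; rewrite -!val_Fp_nat // E.
move=> /H h2 /H h3 /H h4; have := qchar_quartic_sum cF chF h2 h3 h4.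
rewrite -pE sum_Fp; congr (_ ^+ 2 <= _); apply: eq_bigr => i _.
by rewrite /chi !natrD !(qcharM cF chF).
Qed.

End OnePrime.

(** The Jacobi symbol modulo [cond s]. Keeping the list of primes instead of the modulus makes
    divisors sublists and leaves the local factors at hand. *)
Definition psi (s : seq nat) (n : nat) : int := \prod_(p <- s) chi p n.
Definition cond (s : seq nat) : nat := (\prod_(p <- s) p)%N.

Lemma cond_cons p s : cond (p :: s) = (p * cond s)%N.
Proof. by rewrite /cond big_cons. Qed.

Lemma cond_gt0 s : all prime s -> (0 < cond s)%N.
Proof.
elim: s => [|p s IH] /=; first by rewrite /cond big_nil.
by move=> /andP[pp ps]; rewrite cond_cons muln_gt0 prime_gt0 // IH.
Qed.

Lemma dvdn_cond p s : p \in s -> (p %| cond s)%N.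
Proof.
elim: s => [//|q s IH]; rewrite inE cond_cons => /orP[/eqP ->|/IH h].
  exact: dvdn_mulr.
exact: dvdn_mull.
Qed.

Lemma coprime_cond p s : prime p -> all prime s -> coprime p (cond s) = (p \notin s).
Proof.
move=> pp; elim: s => [|q s IH] /=; first by rewrite /cond big_nil coprimen1.
move=> /andP[qp ps]; rewrite cond_cons coprimeMr IH // inE negb_or; congr (_ && _).
by rewrite prime_coprime // dvdn_prime2.
Qed.

Lemma oddprime_prime s : all oddprime s -> all prime s.
Proof. by apply: sub_all => p /andP[]. Qed.

Lemma psi_cons p s n : psi (p :: s) n = chi p n * psi s n.
Proof. by rewrite /psi big_cons. Qed.

Lemma psiM s m n : all oddprime s -> psi s (m * n) = psi s m * psi s n.
Proof.
elim: s => [|p s IH] /=; first by rewrite /psi !big_nil mulr1.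
by move=> /andP[op os]; rewrite !psi_cons chiM // IH // mulrACA.
Qed.

Lemma psi_periodic s : all oddprime s -> periodic (cond s) (psi s).
Proof.
elim: s => [|p s IH] /=; first by move=> _ n; rewrite /psi !big_nil.
move=> /andP[op os] n; rewrite !psi_cons cond_cons.
rewrite [(p * _)%N]mulnC (periodic_mul _ _ (chi_periodic op)) mulnC.
by rewrite (periodic_mul _ _ (IH os)).
Qed.

Lemma psi_norm s n : `|psi s n| <= 1.
Proof.
elim: s => [|p s IH]; first by rewrite /psi big_nil normr1.
rewrite psi_cons normrM; apply: mulr_ile1 => //; exact: chi_norm.
Qed.

Lemma sum_prod_periodic s (phi : nat -> nat -> int) : uniq s -> all prime s ->
  (forall p, p \in s -> periodic p (phi p)) ->
  \sum_(x < cond s) \prod_(p <- s) phi p x = \prod_(p <- s) \sum_(x < p) phi p x.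
Proof.
elim: s => [|p s IH] /=; first by move=> _ _ _; rewrite /cond big_nil big_ord1 !big_nil.
move=> /andP[ps us] /andP[pp As] per.
have per' q : q \in s -> periodic q (phi q) by move=> qs; apply: per; rewrite inE qs orbT.
rewrite big_cons -IH // cond_cons -(@sum_crt _ _ (phi p) (fun x => \prod_(q <- s) phi q x)); first by apply: eq_bigr => i _; rewrite big_cons.
- by rewrite coprime_cond.
- by apply: per; rewrite mem_head.
- elim: s per' {IH ps us As per} => [|q s IH] per' n; first by rewrite !big_nil.
  rewrite !big_cons cond_cons {1}mulnC (periodic_mul _ _ (per' q (mem_head _ _))).
  rewrite mulnC [X in _ * X](_ : _ = \prod_(q <- s) phi q n) // mulnC.
  rewrite -[RHS](periodic_mul q _ (IH _)) // => r rs; apply: per'.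
  by rewrite inE rs orbT.
Qed.

Lemma psi_sum0 s : uniq s -> all oddprime s -> s != [::] -> \sum_(i < cond s) psi s i = 0.
Proof.
move=> us os; rewrite /psi sum_prod_periodic ?oddprime_prime //.
  case: s us os => [//|p s] _ /= /andP[op _] _.
  by rewrite big_cons chi_sum0 // mul0r.
by move=> p /(allP os) op; exact: chi_periodic.
Qed.

Lemma psi_sum_bound s N : uniq s -> all oddprime s -> s != [::] ->
  `|\sum_(i < N) psi s i.+1| <= (cond s)%:R.
Proof.
move=> us os s0; apply: sum_periodic; first exact/cond_gt0/oddprime_prime.
- exact: psi_periodic.
- exact: psi_sum0.
- exact: psi_norm.
Qed.

(** The factor [chi p] occurs once in the product, and [p] is coprime to the period [M] of
    everything else, so the Chinese remainder theorem splits off the vanishing sum of [chi p]. The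
    other primes may be shared. *)
Lemma psi_orth s s' p N : uniq s -> all oddprime s -> all oddprime s' ->
  p \in s -> p \notin s' ->
  `|\sum_(i < N) psi s i.+1 * psi s' i.+1| <= (cond s * cond s')%:R.
Proof.
move=> us os os' ps ps'; have op := allP os p ps; have pp : prime p by case/andP: op.
have sE : perm_eq s (p :: rem p s) by exact: perm_to_rem.
have psiE n : psi s n = chi p n * psi (rem p s) n by rewrite -psi_cons; exact: perm_big.
have condE : cond s = (p * cond (rem p s))%N by rewrite -cond_cons; exact: perm_big.
have os2 : all oddprime (rem p s) by apply/allP => q /mem_rem /(allP os).
have ps2 : p \notin rem p s by rewrite mem_rem_uniq // inE eqxx.
set M := (cond (rem p s) * cond s')%N.
have pM : periodic M (fun n => psi (rem p s) n * psi s' n).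
  apply: periodicM.
    apply: periodic_dvd (psi_periodic os2); exact: dvdn_mulr.
  apply: periodic_dvd (psi_periodic os'); exact: dvdn_mull.
have -> : (cond s * cond s')%N = (p * M)%N by rewrite condE mulnA.
have co : coprime p M by rewrite coprimeMr !coprime_cond ?oddprime_prime // ps2.
under eq_bigr => i _ do rewrite psiE -mulrA.
apply: (@sum_periodic _ (fun n => chi p n * (psi (rem p s) n * psi s' n))).
- by rewrite !muln_gt0 prime_gt0 // !cond_gt0 // oddprime_prime.
- apply: periodicM.
    apply: periodic_dvd (chi_periodic op); exact: dvdn_mulr.
  apply: periodic_dvd pM; exact: dvdn_mull.
- by rewrite (sum_crt co (chi_periodic op) pM) chi_sum0 // mul0r.
- by move=> n; rewrite !normrM !mulr_ile1 ?normr_ge0 ?psi_norm ?chi_norm ?mulr_ge0.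
Qed.

(* [\prod_(p in s) (1 + chi p (d sg))] is positive exactly when [d] qualifies; expanding it over the
   subsets of [s], the empty one contributes [D]. The value [0] of [chi] is allowed, so [d] need not
   be coprime to the moduli. *)
Lemma class_exists (s : seq nat) (sg D : nat) (B : int) : uniq s -> all oddprime s -> 0 <= B ->
  (forall v, v != [::] -> uniq v -> {subset v <= s} -> `|\sum_(d < D) psi v d.+1| <= B) ->
  2 ^+ size s * B < D%:R ->
  exists d, (0 < d <= D)%N /\ forall p, p \in s -> 0 <= chi p (d * sg).
Proof.
move=> us os B0 H lt.
pose T u t := \sum_(d < D) psi u d.+1 * \prod_(p <- t) (1 + chi p sg * chi p d.+1).
(* [u] collects the primes whose character was taken in the expansion, [t] those still to be
   expanded. *)
have key t u : uniq (u ++ t) -> {subset u ++ t <= s} ->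
    `|T u t - (u == [::])%:R * D%:R| <= 2 ^+ size t * B.
  elim: t u => [|p t IH] u.
    rewrite cats0 => uu su; rewrite /T expr0 mul1r.
    under eq_bigr => d _ do rewrite big_nil mulr1.
    have [->|u0] := eqVneq u [::]; last by rewrite mul0r subr0; exact: H.
    under eq_bigr => d _ do rewrite /psi big_nil.
    by rewrite sumr_const card_ord /= mulr1n mul1r subrr normr0.
  rewrite -cat_rcons => uu su.
  have TE : T u (p :: t) = T u t + chi p sg * T (rcons u p) t.
    rewrite /T mulr_sumr -big_split /=; apply: eq_bigr => d _.
    have -> : psi (rcons u p) d.+1 = chi p d.+1 * psi u d.+1.
      by rewrite -psi_cons; apply: perm_big; rewrite perm_rcons.
    rewrite big_cons; ring.
  have h1 := IH _ uu su; have h2 := IH u.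
  have sub : subseq (u ++ t) (rcons u p ++ t).
    by rewrite cat_rcons cat_subseq // subseq_cons.
  have {}h2 := h2 (subseq_uniq sub uu) (fun x hx => su x (mem_subseq sub hx)).
  rewrite TE addrAC; apply: le_trans (ler_normD _ _) _.
  have -> : 2 ^+ size (p :: t) * B = 2 ^+ size t * B + 2 ^+ size t * B by rewrite /= exprS; ring.
  apply: lerD => //; rewrite normrM.
  rewrite [rcons _ _ == _](_ : _ = false) ?mul0r ?subr0 in h1; last by case: (u).
  by apply: le_trans h1; rewrite ler_piMl // chi_norm.
have := key s [::] us (fun x hx => hx); rewrite eqxx mul1r => h.
have Tpos : T [::] s != 0.
  by apply: contraTneq h => ->; rewrite sub0r normrN -ltNge normr_nat.
have [d dE] : exists d : 'I_D, psi [::] d.+1 * \prod_(p <- s) (1 + chi p sg * chi p d.+1) != 0.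
  apply/existsP; apply: contraT; rewrite negb_exists => /forallP hd; case/eqP: Tpos.
  by apply: big1 => d _; have := hd d; rewrite negbK => /eqP.
exists d.+1; split; first by rewrite ltn_ord.
move=> p ps; rewrite chiM ?(allP os p ps) //; move: dE.
rewrite mulf_eq0 negb_or => /andP[_]; rewrite prodf_seq_neq0 => hd; have /= := allP hd p ps.
have := chi_norm p sg; have := chi_norm p d.+1; move: (chi p sg) (chi p d.+1); clear.
move=> x y hy hx; have : x = -1 \/ x = 0 \/ x = 1 by lia.
have : y = -1 \/ y = 0 \/ y = 1 by lia.
by case=> [|[]] -> [|[]] ->.
Qed.

Lemma sqr_mod_cond s n : uniq s -> all prime s ->
  (forall p, p \in s -> exists m, (m ^ 2 = n %[mod p])%N) ->
  exists m, (m ^ 2 = n %[mod cond s])%N.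
Proof.
elim: s => [|p s IH] /=; first by move=> _ _ _; exists 0%N; rewrite /cond big_nil !modn1.
move=> /andP[ps us] /andP[pp As] H.
have [m1 h1] := H p (mem_head _ _).
have [m2 h2] := IH us As (fun q qs => H q (mem_behead (s := p :: s) qs)).
have co : coprime p (cond s) by rewrite coprime_cond.
exists (chinese p (cond s) m1 m2); rewrite cond_cons; apply/eqP.
rewrite chinese_remainder //; apply/andP; split; apply/eqP.
  by rewrite -modnXm chinese_modl // modnXm.
by rewrite -modnXm chinese_modr // modnXm.
Qed.

Lemma squarefree_decomp r : (0 < r)%N ->
  exists h s, [/\ uniq s, all prime s & r = (h ^ 2 * cond s)%N].
Proof.
elim/ltn_ind: r => r IH r0; have [r1|r1] := leqP r 1.
  by exists 1%N, [::]; split=> //; rewrite /cond big_nil; lia.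
have pp := pdiv_prime r1; have pr := pdiv_dvd r.
set p := pdiv r in pp pr; set r' := (r %/ p)%N.
have rE : r = (p * r')%N by rewrite mulnC divnK.
have r'0 : (0 < r')%N by move: r0; rewrite rE muln_gt0 => /andP[].
have r'r : (r' < r)%N by rewrite rE -[X in (X < _)%N]mul1n ltn_pmul2r // prime_gt1.
have [h [s [us ps r'E]]] := IH _ r'r r'0.
have [pis|pns] := boolP (p \in s); last first.
  by exists h, (p :: s); split=> /=; rewrite ?pns ?pp // cond_cons rE r'E mulnCA.
exists (h * p)%N, (rem p s); split; first exact: rem_uniq.
  by apply/allP => q /mem_rem /(allP ps).
have condE : cond s = (p * cond (rem p s))%N by rewrite -cond_cons; exact/perm_big/perm_to_rem.
rewrite [LHS]rE [in LHS]r'E condE expnMn -(mulnn p); move: (h ^ 2)%N (cond _) => a b.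
by clear; lia.
Qed.

End Legendre.

(** * The divisor bound *)

Section DivisorBound.
Local Open Scope nat_scope.

Definition tau n := size (divisors n).

Lemma size_divisors_le_tau (s : seq nat) n : 0 < n -> uniq s -> {in s, forall d, d %| n} -> size s <= tau n.
Proof. by move=> n0 us H; apply: uniq_leq_size => // d /H; rewrite dvdn_divisors. Qed.

Lemma tau_gt0 n : 0 < n -> 0 < tau n.
Proof. by move=> n0; apply: (@size_divisors_le_tau [:: 1]) => // d; rewrite inE => /eqP ->; rewrite dvd1n. Qed.

Lemma tau_pfactorM p e m : prime p -> 0 < m -> ~~ (p %| m) -> tau (p ^ e * m) <= e.+1 * tau m.
Proof.
move=> pp m0 pm; have pe0 : 0 < p ^ e by rewrite expn_gt0 prime_gt0.
have n0 : 0 < p ^ e * m by rewrite muln_gt0 pe0.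
have -> : e.+1 * tau m = size [seq p ^ i * x | i <- iota 0 e.+1, x <- divisors m].
  by rewrite size_allpairs size_iota.
apply: uniq_leq_size; first exact: divisors_uniq.
move=> d; rewrite -dvdn_divisors // => dn; have d0 := dvdn_gt0 n0 dn.
apply/allpairsP; exists (logn p d, d`_p^'); split.
- change (is_true (logn p d \in iota 0 e.+1)); rewrite mem_iota /= add0n ltnS; apply: leq_trans (dvdn_leq_log p n0 dn) _.
  by rewrite lognM // pfactorK // [logn p m](_ : _ = 0) ?addn0 //; apply/eqP; rewrite lognE; case: ifP => // /and3P[_ _]; rewrite (negPf pm).
- change (is_true (d`_p^' \in divisors m)); rewrite -dvdn_divisors //.
  have := partn_dvd p^' n0 dn; rewrite partnM // [(p ^ e)`_p^'](_ : _ = 1) ?mul1n.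
    by move/dvdn_trans; apply; exact: dvdn_part.
  by apply: part_p'nat; rewrite pnatNK pnatX pnat_id.
- by rewrite -p_part partnC.
Qed.

Lemma tau_prod (s : seq nat) (e : nat -> nat) : uniq s -> all prime s ->
  tau (\prod_(p <- s) p ^ e p) <= \prod_(p <- s) (e p).+1.
Proof.
elim: s => [|p s IH] /=; first by rewrite !big_nil.
move=> /andP[ps us] /andP[pp As]; rewrite !big_cons.
apply: leq_trans (tau_pfactorM _ pp _ _) _.
- elim: s As {IH ps us} => [|q s IH] /=; first by rewrite big_nil.
  by move=> /andP[qp /IH h]; rewrite big_cons muln_gt0 expn_gt0 prime_gt0.
- rewrite -prime_coprime //; elim: s As ps {IH us} => [|q s IH] /=; first by rewrite big_nil coprimen1.
  move=> /andP[qp As]; rewrite inE negb_or => /andP[pq /(IH As) h].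
  by rewrite big_cons coprimeMr h coprimeXr // prime_coprime // dvdn_prime2.
- by rewrite leq_mul2l IH // orbT.
Qed.

Lemma expS_bound j e : 0 < j -> e.+1 ^ j <= j ^ j * 2 ^ e.
Proof.
move=> j0; have h : e.+1 <= j * 2 ^ (e %/ j).
  have h1 : e.+1 <= j * (e %/ j).+1 by rewrite mulnC mulSn {1}(divn_eq e j) addnC -addSn leq_add2r ltn_pmod.
  by apply: leq_trans h1 _; rewrite leq_pmul2l // ltn_expl.
rewrite -(leq_exp2r _ _ j0) in h; apply: leq_trans h _.
by rewrite expnMn leq_mul2l -expnM leq_pexp2l ?orbT // leq_trunc_div.
Qed.

(** Large primes cost no constant, since [e.+1 <= 2 ^ e] and [2 ^ j <= p]; only the finitely many
    small ones cost [j ^ j] each. *)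
Lemma pfactor_bound j p e : 0 < j -> prime p ->
  e.+1 ^ j <= (if p < 2 ^ j then j ^ j else 1) * p ^ e.
Proof.
move=> j0 pp; case: ltnP => h.
  apply: leq_trans (expS_bound e j0) _; rewrite leq_mul2l; apply/orP; right.
  by case: e => [|e]; rewrite ?expn0 // leq_exp2r // prime_gt1.
rewrite mul1n; apply: leq_trans (_ : (2 ^ e) ^ j <= _).
  by rewrite leq_exp2r // ltn_expl.
by rewrite -expnM mulnC expnM; case: e => // e; rewrite leq_exp2r.
Qed.

Lemma tau_exp_bound j : 0 < j -> exists2 C, 0 < C & forall m, 0 < m -> tau m ^ j <= C * m.
Proof.
move=> j0; exists ((j ^ j) ^ (2 ^ j)); first by rewrite !expn_gt0 j0.
move=> m m0.
have mE : m = \prod_(p <- primes m) p ^ logn p m.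
  by rewrite {1}(prod_prime_decomp m0) prime_decompE big_map.
have As : all prime (primes m) by apply/allP => p; rewrite mem_primes => /andP[].
have := tau_prod (fun p => logn p m) (primes_uniq m) As; rewrite -mE => h.
rewrite -(leq_exp2r _ _ j0) in h; apply: leq_trans h _.
have -> : (j ^ j) ^ (2 ^ j) * m = (j ^ j) ^ (2 ^ j) * \prod_(p <- primes m) p ^ logn p m by rewrite -mE.
have cnt : count (fun p => p < 2 ^ j) (primes m) <= 2 ^ j.
  rewrite -size_filter -[X in _ <= X](size_iota 0); apply: uniq_leq_size.
    by rewrite filter_uniq // primes_uniq.
  by move=> p; rewrite mem_filter mem_iota => /andP[].
apply: leq_trans (_ : (j ^ j) ^ count (fun p => p < 2 ^ j) (primes m) * \prod_(p <- primes m) p ^ logn p m <= _); last first.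
  by rewrite leq_mul2r leq_pexp2l ?orbT // expn_gt0 j0.
elim: (primes m) As {cnt mE} => [|p s IH] /=; first by rewrite !big_nil exp1n.
move=> /andP[pp /IH {}IH]; rewrite !big_cons expnMn.
apply: leq_trans (leq_mul (pfactor_bound _ j0 pp) IH) _.
rewrite mulnACA [X in _ <= X * _](_ : _ = (if p < 2 ^ j then j ^ j else 1) * (j ^ j) ^ count (fun p => p < 2 ^ j) s) //.
by case: ifP => _; rewrite ?expnD ?expn1 ?mul1n ?add0n.
Qed.

(** Exponent [2 k M] in [tau_exp_bound]: [C m <= t ^ M * t ^ M], whence the [2 M]-th root can be
    taken. This lets [t] absorb every divisor function that occurs. *)
Lemma tau_small k M : 0 < M -> exists t0, forall t m, t0 <= t -> 0 < m -> m <= t ^ M -> tau m ^ k <= t.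
Proof.
move=> M0; case: (posnP k) => [->|k0].
  by exists 1 => t m t1 _ _; rewrite expn0.
have [C C0 H] := @tau_exp_bound (k * (2 * M)) ltac:(by rewrite !muln_gt0 k0 M0).
exists C => t m tC m0 mt.
rewrite -(@leq_exp2r _ _ (2 * M)) ?muln_gt0 ?M0 // -expnM.
apply: leq_trans (H m m0) _; rewrite mul2n -addnn expnD.
have t0 : 0 < t := leq_trans C0 tC; apply: leq_mul => //; apply: leq_trans tC _.
by case: (M) M0 => // M' _; rewrite expnS leq_pmulr // expn_gt0 t0.
Qed.

Lemma tau_cond s : uniq s -> all prime s -> 2 ^ size s <= tau (cond s).
Proof.
elim: s => [|p s IH] /=; first by rewrite /cond big_nil.
move=> /andP[ps us] /andP[pp As]; have c0 := cond_gt0 As.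
rewrite cond_cons expnS; apply: leq_trans (_ : 2 * tau (cond s) <= _).
  by rewrite leq_mul2l IH.
have -> : 2 * tau (cond s) = size (divisors (cond s) ++ map (muln p) (divisors (cond s))).
  by rewrite size_cat size_map addnn mul2n.
apply: size_divisors_le_tau; first by rewrite muln_gt0 prime_gt0.
- rewrite cat_uniq divisors_uniq map_inj_uniq ?divisors_uniq ?andbT /=; last first.
    by move=> x y /eqP; rewrite eqn_pmul2l ?prime_gt0 // => /eqP.
  apply/hasPn => d /mapP[x _ ->]; rewrite -dvdn_divisors //; apply/negP => h.
  have := dvdn_trans (dvdn_mulr x (dvdnn p)) h.
  by have := coprime_cond pp As; rewrite ps prime_coprime // => /negPf ->.
- move=> d; rewrite mem_cat => /orP[|/mapP[x + ->]]; rewrite -dvdn_divisors // => h.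
    exact: dvdn_mull.
  by rewrite dvdn_mul.
Qed.

(** The gcd is at most the sum of all common divisors, and a divisor [g] contributes [g] at each of
    at most [N / g] multiples. *)
Lemma sum_gcd_le c N : 0 < c -> \sum_(1 <= x < N.+1) gcdn x c <= N * tau c.
Proof.
move=> c0; apply: leq_trans (_ : \sum_(g <- divisors c) \sum_(1 <= x < N.+1 | g %| x) g <= _).
  rewrite (exchange_big_dep xpredT) //= big_nat [X in _ <= X]big_nat; apply: leq_sum => x xN.
  rewrite (big_rem (gcdn x c)) /= ?dvdn_gcdl ?leq_addr //.
  by rewrite -dvdn_divisors // dvdn_gcdr.
have H g : g \in divisors c -> \sum_(1 <= x < N.+1 | g %| x) g <= N.
  rewrite -dvdn_divisors // => gc; have g0 := dvdn_gt0 c0 gc.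
  rewrite big_mkcond (eq_bigr (fun x => (g %| x) * g)); last first.
    by move=> x _; case: (g %| x); rewrite ?mul1n.
  by rewrite -big_distrl /= -divn_count_dvd leq_trunc_div.
apply: leq_trans (_ : \sum_(g <- divisors c) N <= _); first by rewrite big_seq [X in _ <= X]big_seq; exact: leq_sum.
by rewrite big_const_seq count_predT iter_addn_0 mulnC.
Qed.
End DivisorBound.

(** * Fourth moments of short character sums *)

Section FourthMoment.
Local Open Scope ring_scope.

Lemma pow4_sum (L : nat) (f : 'I_L -> int) :
  (\sum_b f b) ^+ 4 = \sum_b1 \sum_b2 \sum_b3 \sum_b4 f b1 * f b2 * f b3 * f b4.
Proof.
rewrite !exprS expr0 mulr1 mulr_suml; apply: eq_bigr => b1 _.
rewrite mulr_suml mulr_sumr; apply: eq_bigr => b2 _.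
rewrite mulr_suml !mulr_sumr; apply: eq_bigr => b3 _.
by rewrite !mulr_sumr; apply: eq_bigr => b4 _; rewrite !mulrA.
Qed.

Variable s : seq nat.
Hypotheses (us : uniq s) (os : all oddprime s).
Let c := cond s.
Let ps : all prime s := oddprime_prime os.
Let c0 : (0 < c)%N := cond_gt0 ps.

Definition shifted_sum4 (b1 b2 b3 b4 : nat) : int :=
  \sum_(x < c) psi s (x + b1) * psi s (x + b2) * psi s (x + b3) * psi s (x + b4).

Lemma shifted_sum4_le b1 b2 b3 b4 : `|shifted_sum4 b1 b2 b3 b4| <= c%:R.
Proof.
apply: le_trans (ler_norm_sum _ _ _) _.
apply: le_trans (_ : (\sum_(i < c) 1) <= _); last by rewrite sumr_const card_ord.
by apply: ler_sum => x _; rewrite !normrM !mulr_ile1 ?mulr_ge0 ?psi_norm.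
Qed.

(* At a prime [p] of the modulus the complete sum is [O(sqrt p)] unless [b1] coincides modulo [p] with one
   of the other shifts; this collects the exceptional primes of one such coincidence. *)
Definition common_part (d : nat) : nat := (\prod_(p <- s) if p %| d then p else 1)%N.

Lemma common_part_le d : (0 < d)%N -> (common_part d <= gcdn d c)%N.
Proof.
move=> d0; apply: dvdn_leq; first by rewrite gcdn_gt0 d0.
rewrite /common_part /c; elim: s us ps => [|p t IH] /=; first by rewrite big_nil dvd1n.
move=> /andP[pt ut] /andP[pp pts]; rewrite big_cons cond_cons.
have {}IH := IH ut pts; case: ifP => pd; last first.
  by rewrite mul1n; apply: dvdn_trans IH _; rewrite dvdn_gcd dvdn_gcdl dvdn_mull ?dvdn_gcdr.
have := coprime_cond pp pts; rewrite pt => co.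
move: IH; rewrite dvdn_gcd => /andP[h1 h2].
have co' : coprime p (\prod_(q <- t) if q %| d then q else 1).
  exact: coprime_dvdr h2 co.
by rewrite dvdn_gcd Gauss_dvd // pd h1 /= dvdn_mul.
Qed.

Lemma shifted_sum4_prod b1 b2 b3 b4 : shifted_sum4 b1 b2 b3 b4 =
  \prod_(p <- s) \sum_(x < p) chi p (x + b1) * chi p (x + b2) * chi p (x + b3) * chi p (x + b4).
Proof.
rewrite -(@sum_prod_periodic s (fun p x => chi p (x + b1) * chi p (x + b2) * chi p (x + b3) * chi p (x + b4))) //.
  by apply: eq_bigr => x _; rewrite /psi -!big_split.
move=> p /(allP os) op n.
by rewrite ![(n + p + _)%N]addnAC !(chi_periodic op).
Qed.

Definition ndist (a b : nat) : nat := ((a - b) + (b - a))%N.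

Lemma ndist_mod p a b : (a == b %[mod p])%N -> (p %| ndist a b)%N.
Proof.
rewrite /ndist; have [ab|ba] := leqP a b.
  by rewrite eq_sym eqn_mod_dvd // (eqP ab).
by rewrite eqn_mod_dvd ?(ltnW ba) // (eqP (ltnW ba)) addn0.
Qed.

(** Prime by prime: if [p] divides one of the three distances, the trivial bound [p * p] is paid by
    one [p] from [c] and one from [common_part]; otherwise the quartic sum bound applies. *)
Lemma shifted_sum4_sqr b1 b2 b3 b4 :
  shifted_sum4 b1 b2 b3 b4 ^+ 2 <= ((64 ^ 2) ^ size s * c *
    (common_part (ndist b1 b2) * common_part (ndist b1 b3) * common_part (ndist b1 b4)))%:R.
Proof.
rewrite shifted_sum4_prod /c /common_part /cond -prodrXl -!big_split /=.
have -> : ((64 ^ 2) ^ size s = \prod_(p <- s) 64 ^ 2)%N.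
  by rewrite big_const_seq count_predT iter_muln_1.
rewrite -!big_split /= rmorph_prod /= big_seq [X in _ <= X]big_seq.
apply: ler_prod => p pins; rewrite sqr_ge0 /=; have op := allP os p pins.
have [pp p2] := andP op.
set W := \sum_(x < p) _.
have Wp : W ^+ 2 <= (p * p)%:R.
  have : `|W| <= p%:R.
    apply: le_trans (ler_norm_sum _ _ _) _.
    apply: le_trans (_ : (\sum_(i < p) 1) <= _); last by rewrite sumr_const card_ord.
    by apply: ler_sum => x _; rewrite !normrM !mulr_ile1 ?mulr_ge0 ?chi_norm.
  have -> : W ^+ 2 = `|W| ^+ 2 by rewrite -normrX ger0_norm ?sqr_ge0.
  by move=> h; rewrite natrM -expr2; apply: lerXn2r; rewrite ?nnegrE ?normr_ge0 ?ler0n.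
have [h|h] := boolP [|| p %| ndist b1 b2, p %| ndist b1 b3 | p %| ndist b1 b4]%N.
  apply: le_trans Wp _; rewrite ler_nat.
  have p0 := prime_gt0 pp.
  have gp q : (0 < if p %| q then p else 1)%N by case: ifP.
  have : (p <= (if p %| ndist b1 b2 then p else 1) * (if p %| ndist b1 b3 then p else 1) *
                 (if p %| ndist b1 b4 then p else 1))%N.
    have g2 := gp (ndist b1 b2); have g3 := gp (ndist b1 b3); have g4 := gp (ndist b1 b4).
    case/or3P: h => hh; move: g2 g3 g4; rewrite hh; move: p0; clear.
    - move: (if (p %| ndist b1 b3)%N then p else 1%N) (if (p %| ndist b1 b4)%N then p else 1%N) => y z p0 _ y0 z0.
      by rewrite -mulnA leq_pmulr // muln_gt0 y0.
    - move: (if (p %| ndist b1 b2)%N then p else 1%N) (if (p %| ndist b1 b4)%N then p else 1%N) => y z p0 y0 _ z0.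
      by rewrite mulnAC leq_pmull // muln_gt0 y0.
    - move: (if (p %| ndist b1 b2)%N then p else 1%N) (if (p %| ndist b1 b3)%N then p else 1%N) => y z p0 y0 z0 _.
      by rewrite leq_pmull // muln_gt0 y0.
  by move=> h'; rewrite -mulnA [X in (_ <= X)%N]mulnC -mulnA; apply: leq_mul => //; apply: leq_trans h' _; rewrite leq_pmulr.
move: h; rewrite !negb_or => /and3P[h2 h3 h4].
rewrite (negPf h2) (negPf h3) (negPf h4) !muln1.
by apply: chi_quartic_sum => //; [move: h2|move: h3|move: h4]; apply: contra; exact: ndist_mod.
Qed.

Variable L : nat.
Hypothesis L4 : (L ^ 4 <= c)%N.

(** Zero on the diagonal, where the gcd with [0] would be all of [c] and spoil the sum over
    shifts. *)
Definition gcd_off (a b : nat) : nat := if a == b then 0%N else gcdn (ndist a b) c.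

(** [L ^ 4 <= c] says that a sum of size [sqrt c], multiplied by [L ^ 2], is still at most [c].
    Squaring and clearing denominators keep the estimate within the integers. *)
Lemma shifted_sum4_uniq b1 b2 b3 b4 : b1 != b2 -> b1 != b3 -> b1 != b4 ->
  `|shifted_sum4 b1 b2 b3 b4| * (L ^ 2)%:R <= (64 ^ size s * c * (gcd_off b1 b2 * gcd_off b1 b3 * gcd_off b1 b4))%:R.
Proof.
move=> h2 h3 h4; have H := shifted_sum4_sqr b1 b2 b3 b4.
have gE b : b1 != b -> (common_part (ndist b1 b) <= gcd_off b1 b)%N.
  move=> hb; rewrite /gcd_off (negPf hb) common_part_le // /ndist.
  by move: hb; clear; lia.
have g1 b : b1 != b -> (0 < gcd_off b1 b)%N.
  by move=> hb; rewrite /gcd_off (negPf hb) gcdn_gt0 c0 orbT.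
rewrite -(@ler_pXn2r _ 2) // ?nnegrE ?ler0n ?mulr_ge0 ?ler0n //.
rewrite exprMn -normrX ger0_norm ?sqr_ge0 //.
apply: le_trans (_ : ((64 ^ 2) ^ size s * c *
    (common_part (ndist b1 b2) * common_part (ndist b1 b3) * common_part (ndist b1 b4)))%:R * (L ^ 4)%:R <= _).
  rewrite -[(L ^ 4)%:R](_ : (L ^ 2)%:R ^+ 2 = _); last by rewrite -natrX -expnM.
  by apply: ler_wpM2r => //; rewrite exprn_ge0 ?ler0n.
rewrite -natrX -natrM ler_nat.
set G := (common_part _ * _ * _)%N; set G' := (gcd_off _ _ * _ * _)%N.
have GG : (G <= G')%N by rewrite /G /G' !leq_mul ?gE.
have G0 : (0 < G')%N by rewrite /G' !muln_gt0 !g1.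
rewrite -expnM [(2 * _)%N]mulnC expnM; move: (64 ^ size s)%N => K.
rewrite !expnS !expn0 !muln1.
move: L4; rewrite !expnS !expn0 !muln1 => L4'.
apply: leq_trans (_ : K * K * c * G' * c <= _)%N.
  by rewrite leq_mul // leq_mul // .
apply: leq_trans (_ : K * K * c * (G' * G') * c <= _)%N; last by rewrite eq_leq //; ring.
by rewrite leq_mul2r leq_mul2l leq_pmulr // !orbT.
Qed.

Definition pair_eq (a b a' b' : nat) : nat := ((a == b) * (a' == b'))%N.

(** Either some shift differs from the three others, and permuting it to the front allows
    [shifted_sum4_uniq], or every value occurs at least twice; this is one of the three pairings,
    where the trivial bound [c] is used. *)
Lemma shifted_sum4_bound b1 b2 b3 b4 :
  `|shifted_sum4 b1 b2 b3 b4| * (L ^ 2)%:R <=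
  (c * L ^ 2 * (pair_eq b1 b2 b3 b4 + pair_eq b1 b3 b2 b4 + pair_eq b1 b4 b2 b3) +
   64 ^ size s * c * (gcd_off b1 b2 * gcd_off b1 b3 * gcd_off b1 b4 + gcd_off b2 b1 * gcd_off b2 b3 * gcd_off b2 b4 +
      gcd_off b3 b1 * gcd_off b3 b2 * gcd_off b3 b4 + gcd_off b4 b1 * gcd_off b4 b2 * gcd_off b4 b3))%:R.
Proof.
have r12 (a b d e : int) : a * b * d * e = b * a * d * e by ring.
have r13 (a b d e : int) : a * b * d * e = d * b * a * e by ring.
have r14 (a b d e : int) : a * b * d * e = e * b * d * a by ring.
have C12 x y z w : shifted_sum4 x y z w = shifted_sum4 y x z w by apply: eq_bigr => i _; exact: r12.
have C13 x y z w : shifted_sum4 x y z w = shifted_sum4 z y x w by apply: eq_bigr => i _; exact: r13.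
have C14 x y z w : shifted_sum4 x y z w = shifted_sum4 w y z x by apply: eq_bigr => i _; exact: r14.
set S := (gcd_off b1 b2 * gcd_off b1 b3 * gcd_off b1 b4 + _ + _ + _)%N; set X := (c * L ^ 2 * _)%N.
have U (w : int) (G : nat) : `|w| * (L ^ 2)%:R <= (64 ^ size s * c * G)%:R -> (G <= S)%N ->
   `|w| * (L ^ 2)%:R <= (X + 64 ^ size s * c * S)%:R.
  move=> h m; apply: le_trans h _; rewrite ler_nat; apply: leq_trans (leq_addl _ _).
  by rewrite leq_mul2l m orbT.
have [/and3P[n2 n3 n4]|u1] := boolP [&& b1 != b2, b1 != b3 & b1 != b4].
  by apply: (U _ _ (shifted_sum4_uniq n2 n3 n4)); rewrite /S -!addnA leq_addr.
have [/and3P[n1 n3 n4]|u2] := boolP [&& b2 != b1, b2 != b3 & b2 != b4].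
  rewrite C12; apply: (U _ _ (shifted_sum4_uniq n1 n3 n4)).
  by rewrite /S; clear; lia.
have [/and3P[n1 n2 n4]|u3] := boolP [&& b3 != b1, b3 != b2 & b3 != b4].
  rewrite C13; apply: (U _ _ (shifted_sum4_uniq n2 n1 n4)).
  by rewrite /S [(gcd_off b3 b2 * _)%N]mulnC addnAC leq_addl.
have [/and3P[n1 n2 n3]|u4] := boolP [&& b4 != b1, b4 != b2 & b4 != b3].
  rewrite C14; apply: (U _ _ (shifted_sum4_uniq n2 n3 n1)).
  by rewrite /S mulnC mulnA leq_addl.
apply: le_trans (_ : (c * L ^ 2)%:R <= _).
  by rewrite natrM; apply: ler_wpM2r; rewrite ?ler0n ?shifted_sum4_le.
rewrite ler_nat; apply: leq_trans (leq_addr _ _).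
rewrite leq_pmulr // /pair_eq; move: u1 u2 u3 u4; clear; lia.
Qed.

Lemma sum_gcd_off (a : nat) : (a < L)%N -> (\sum_(b < L) gcd_off a b <= 2 * L * tau c)%N.
Proof.
move=> aL; pose g i := if i == 0%N then 0%N else gcdn i c.
have gs N : (N <= L.+1)%N -> (\sum_(0 <= i < N) g i <= L * tau c)%N.
  move=> NL; apply: leq_trans (_ : \sum_(0 <= i < L.+1) g i <= _)%N.
    by rewrite [X in (_ <= X)%N](big_cat_nat (n := N)) // leq_addr.
  rewrite big_nat_recl // add0n; apply: leq_trans (sum_gcd_le L c0).
  by rewrite big_add1.
have geE b : gcd_off a b = g (ndist a b).
  rewrite /gcd_off /g; congr (if _ then _ else _); rewrite /ndist; clear; lia.
rewrite -(big_mkord xpredT (gcd_off a)) (big_cat_nat (n := a)) //=; last exact: ltnW.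
rewrite -mulnA mul2n -addnn; apply: leq_add.
  rewrite big_nat_rev /= add0n.
  apply: leq_trans (gs a.+1 _); last by rewrite ltnS ltnW.
  rewrite big_nat_recl // add0n big_nat [X in (_ <= X)%N]big_nat; apply: leq_sum => i ia.
  by rewrite geE (_ : ndist _ _ = i.+1) // /ndist; move: ia; clear; lia.
rewrite -{1}[a]add0n big_addn.
apply: leq_trans (gs (L - a)%N _); last by rewrite leqW // leq_subr.
by apply: leq_sum => i _; rewrite geE (_ : ndist _ _ = i) // /ndist; clear; lia.
Qed.

Definition quad (f : nat -> nat -> nat -> nat -> nat) : nat :=
  (\sum_(a < L) \sum_(b < L) \sum_(d < L) \sum_(e < L) f a b d e)%N.

Lemma quad12 f : quad f = quad (fun a b => f b a).
Proof. by rewrite /quad exchange_big. Qed.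

Lemma quad23 f : quad f = quad (fun a b d => f a d b).
Proof. by apply: eq_bigr => a _; rewrite exchange_big. Qed.

Lemma quad34 f : quad f = quad (fun a b d e => f a b e d).
Proof. by apply: eq_bigr => a _; apply: eq_bigr => b _; rewrite exchange_big. Qed.

Lemma quadD f g : quad (fun a b d e => f a b d e + g a b d e)%N = (quad f + quad g)%N.
Proof.
by rewrite /quad; do 4! [rewrite -big_split; apply: eq_bigr => ? _].
Qed.

Lemma quadZ k f : quad (fun a b d e => k * f a b d e)%N = (k * quad f)%N.
Proof.
by rewrite /quad; do 4! [rewrite big_distrr; apply: eq_bigr => ? _].
Qed.

Lemma quad_pair_eq : (quad pair_eq <= L ^ 2)%N.
Proof.
have d1 : (\sum_(a < L) \sum_(b < L) (nat_of_ord a == b) <= L)%N.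
  rewrite -[X in (_ <= X)%N]card_ord -sum1_card; apply: leq_sum => a _.
  by rewrite (bigD1 a) //= eqxx big1 // => b /negPf ba; rewrite eq_sym [(_ == _)%N]ba.
have -> : quad pair_eq = ((\sum_(a < L) \sum_(b < L) (nat_of_ord a == b)) *
                    (\sum_(a < L) \sum_(b < L) (nat_of_ord a == b)))%N.
  rewrite /quad /pair_eq big_distrl; apply: eq_bigr => a _.
  rewrite big_distrl; apply: eq_bigr => b _.
  by rewrite big_distrr; apply: eq_bigr => d _; rewrite big_distrr.
by rewrite -mulnn leq_mul.
Qed.

Lemma quad_gcd_off : (quad (fun a b d e => gcd_off a b * gcd_off a d * gcd_off a e) <= L * (2 * L * tau c) ^ 3)%N.
Proof.
rewrite -[X in (_ <= X * _)%N]card_ord -sum1_card big_distrl /=; apply: leq_sum => a _.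
rewrite mul1n; have h := sum_gcd_off (ltn_ord a).
apply: leq_trans (_ : (\sum_(b < L) gcd_off a b) ^ 3 <= _)%N; last by rewrite leq_exp2r.
rewrite !expnS expn0 muln1 big_distrl; apply: leq_sum => b _.
rewrite big_distrl big_distrr; apply: leq_sum => d _.
by rewrite !big_distrr /=; apply: leq_sum => e _; rewrite mulnA.
Qed.

(** Each of the 3 pairings has at most [L ^ 2] quadruples, contributing [c] each. In the rest there
    are 4 positions for the shift that stands alone, each with three sums of gcds bounded by
    [2 L tau c], whence [32 = 4 * 2 ^ 3]. *)
Lemma fourth_moment :
  \sum_(x < c) (\sum_(b < L) psi s (x + b)) ^+ 4 <=
    ((3 + 32 * 64 ^ size s * tau c ^ 3) * c * L ^ 2)%:R.
Proof.
case: (posnP L) => [L0|L0].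
  rewrite big1 ?ler0n // => x _; rewrite big1 ?expr0n //= => b _.
  by case: b => b bL; exfalso; move: bL; rewrite L0.
have E : \sum_(x < c) (\sum_(b < L) psi s (x + b)) ^+ 4 =
   \sum_(b1 < L) \sum_(b2 < L) \sum_(b3 < L) \sum_(b4 < L) shifted_sum4 b1 b2 b3 b4.
  under eq_bigr => x _ do rewrite (@pow4_sum L (fun b => psi s (x + b))).
  rewrite exchange_big; apply: eq_bigr => b1 _; rewrite exchange_big; apply: eq_bigr => b2 _.
  by rewrite exchange_big; apply: eq_bigr => b3 _; rewrite exchange_big.
rewrite E -(@ler_pM2r _ (L ^ 2)%:R) ?ltr0n ?expn_gt0 ?L0 // -natrM.
pose bd b1 b2 b3 b4 := (c * L ^ 2 * (pair_eq b1 b2 b3 b4 + pair_eq b1 b3 b2 b4 + pair_eq b1 b4 b2 b3) +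
   64 ^ size s * c * (gcd_off b1 b2 * gcd_off b1 b3 * gcd_off b1 b4 + gcd_off b2 b1 * gcd_off b2 b3 * gcd_off b2 b4 +
      gcd_off b3 b1 * gcd_off b3 b2 * gcd_off b3 b4 + gcd_off b4 b1 * gcd_off b4 b2 * gcd_off b4 b3))%N.
apply: le_trans (_ : (\sum_(b1 < L) \sum_(b2 < L) \sum_(b3 < L) \sum_(b4 < L) bd b1 b2 b3 b4)%:R <= _).
  rewrite natr_sum mulr_suml; apply: ler_sum => b1 _.
  rewrite natr_sum mulr_suml; apply: ler_sum => b2 _.
  rewrite natr_sum mulr_suml; apply: ler_sum => b3 _.
  rewrite natr_sum mulr_suml; apply: ler_sum => b4 _.
  apply: le_trans (shifted_sum4_bound _ _ _ _); apply: ler_wpM2r; rewrite ?ler0n //; exact: ler_norm.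
rewrite ler_nat -/(quad bd) /bd !(quadD, quadZ).
have Qp2 : quad (fun a b d e => pair_eq a d b e) = quad pair_eq by rewrite quad23.
have Qp3 : quad (fun a b d e => pair_eq a e b d) = quad pair_eq by rewrite quad34 quad23.
set G := quad (fun a b d e => gcd_off a b * gcd_off a d * gcd_off a e)%N.
have G2 : quad (fun a b d e => gcd_off b a * gcd_off b d * gcd_off b e)%N = G by rewrite quad12.
have r3 x y z : (x * y * z = y * x * z)%N by rewrite [(x * y)%N]mulnC.
have G3 : quad (fun a b d e => gcd_off d a * gcd_off d b * gcd_off d e)%N = G by rewrite quad23 quad12.
have G4 : quad (fun a b d e => gcd_off e a * gcd_off e b * gcd_off e d)%N = G.
  by rewrite quad34 quad23 quad12.
rewrite Qp2 Qp3 G2 G3 G4.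
have h1 := quad_pair_eq; have h2 := quad_gcd_off; rewrite -/G in h2.
set K := (64 ^ size s)%N.
apply: leq_trans (_ : c * L ^ 2 * (L ^ 2 + L ^ 2 + L ^ 2) +
  K * c * (4 * (L * (2 * L * tau c) ^ 3)) <= _)%N.
  apply: leq_add; first by rewrite leq_mul2l !leq_add ?orbT.
  by rewrite leq_mul2l; apply/orP; right; move: h2; clear; lia.
rewrite eq_leq // !expnS !expn0; move: K (tau c) => K T; clear; ring.
Qed.
End FourthMoment.

(** * Counting integers coprime to a squarefree modulus *)

Section CoprimeCount.
Local Open Scope nat_scope.

Definition coprime_count (s : seq nat) (A : nat) := \sum_(1 <= a < A.+1) coprime a (cond s).

Lemma coprime_count_cons p s A : prime p -> all prime s -> p \notin s ->
  coprime_count (p :: s) A + coprime_count s (A %/ p) = coprime_count s A.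
Proof.
move=> pp ps pns; have p0 := prime_gt0 pp.
have cop : coprime p (cond s) by rewrite coprime_cond.
rewrite /coprime_count; elim: A => [|A IH]; first by rewrite div0n !big_geq.
rewrite divnS // !(big_nat_recr A.+1) //= -IH.
have -> : coprime A.+1 (cond (p :: s)) = ~~ (p %| A.+1) && coprime A.+1 (cond s).
  by rewrite cond_cons coprimeMr [coprime _ p]coprime_sym prime_coprime.
case: (boolP (p %| A.+1)) => pA; last by rewrite add0n andTb; lia.
have e : coprime A.+1 (cond s) = coprime (A %/ p).+1 (cond s).
  have -> : A.+1 = (A %/ p).+1 * p by rewrite -[in LHS](divnK pA) divnS // pA.
  by rewrite coprimeMl cop andbT.
rewrite e [(true + _)%N]add1n (big_nat_recr (A %/ p).+1) //= addn0.
by rewrite -addnA.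
Qed.

(** Both inequalities are proved together, because the recursion subtracts the count at [A / p]. The
    error triples with each prime: once for [A], once for [A / p], once for the rounding of
    [A / p]. *)
Lemma coprime_count_bounds s A : uniq s -> all prime s ->
  (\prod_(p <- s) p.-1) * A <= cond s * coprime_count s A + cond s * 3 ^ size s /\
  cond s * coprime_count s A <= (\prod_(p <- s) p.-1) * A + cond s * 3 ^ size s.
Proof.
elim: s A => [|p s IH] A.
  rewrite /coprime_count /cond !big_nil /=.
  under eq_bigr => a _ do rewrite coprimen1.
  by rewrite sum_nat_const_nat; lia.
move=> /= /andP[ps us] /andP[pp As].
have [h1 h2] := IH A us As; have [h3 h4] := IH (A %/ p) us As.
have e := coprime_count_cons A pp As ps.
rewrite !big_cons !cond_cons expnS.
have phic : \prod_(q <- s) q.-1 <= cond s by apply: leq_prod => q _; exact: leq_pred.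
move: h1 h2 h3 h4 e phic (prime_gt0 pp) (leq_trunc_div A p) (ltn_ceil A (prime_gt0 pp)).
have : 0 < 3 ^ size s by rewrite expn_gt0.
move: (A %/ p) (\prod_(q <- s) q.-1) (cond s) (3 ^ size s) (coprime_count s A) (coprime_count s (A %/ p)) (coprime_count (p :: s) A).
clear; case: p => // p B F c E al be al' E0 h1 h2 h3 h4 e Fc _ B1 B2 /=.
have k1 : F * (p.+1 * B) <= F * A by rewrite leq_mul2l mulnC B1 orbT.
have k2 : F * A <= F * (p.+1 * B.+1) by rewrite leq_mul2l [p.+1 * _]mulnC (ltnW B2) orbT.
have k3 : p.+1 * F <= p.+1 * c * E by rewrite -mulnA leq_mul2l orbC; apply/orP; left; rewrite (leq_trans Fc) // leq_pmulr.
rewrite -e in h1 h2.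
have k4 : p.+1 * (F * A) <= p.+1 * (c * (al' + be) + c * E) by rewrite leq_mul2l h1 orbT.
have k5 : p.+1 * (c * be) <= p.+1 * (F * B + c * E) by rewrite leq_mul2l h4 orbT.
have k6 : p.+1 * (c * (al' + be)) <= p.+1 * (F * A + c * E) by rewrite leq_mul2l h2 orbT.
have k7 : p.+1 * (F * B) <= p.+1 * (c * be + c * E) by rewrite leq_mul2l h3 orbT.
split; nia.
Qed.

Lemma coprime_count_lower s A : uniq s -> all prime s -> A <= 2 ^ size s * coprime_count s A + 6 ^ size s.
Proof.
move=> us ps; have [h _] := coprime_count_bounds A us ps.
have c0 := cond_gt0 ps.
have h2 : cond s <= 2 ^ size s * \prod_(p <- s) p.-1.
  elim: s ps {us h c0} => [|p s IH] /=; first by rewrite /cond !big_nil.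
  move=> /andP[pp /IH h]; rewrite cond_cons big_cons expnS.
  have : p <= 2 * p.-1 by have := prime_gt1 pp; clear; lia.
  by move=> h'; rewrite mulnACA leq_mul.
rewrite -(leq_pmul2l c0).
apply: leq_trans (_ : 2 ^ size s * (\prod_(p <- s) p.-1 * A) <= _).
  by rewrite mulnA leq_mul2r h2 orbT.
apply: leq_trans (_ : 2 ^ size s * (cond s * coprime_count s A + cond s * 3 ^ size s) <= _).
  by rewrite leq_mul2l h orbT.
rewrite -[6]/(2 * 3) expnMn eq_leq //; move: (2 ^ _) (3 ^ _) => *; ring.
Qed.
End CoprimeCount.

(** * Cauchy-Schwarz, and translation of sums *)

Section Sums.
Local Open Scope ring_scope.

Lemma cauchy_schwarz (I : finType) (P : pred I) (a b : I -> int) :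
  (\sum_(i | P i) a i * b i) ^+ 2 <= (\sum_(i | P i) a i ^+ 2) * (\sum_(i | P i) b i ^+ 2).
Proof.
have : 0 <= \sum_(i | P i) \sum_(j | P j) (a i * b j - a j * b i) ^+ 2.
  by apply: sumr_ge0 => i _; apply: sumr_ge0 => j _; exact: sqr_ge0.
have -> : \sum_(i | P i) \sum_(j | P j) (a i * b j - a j * b i) ^+ 2 =
  2%:R * ((\sum_(i | P i) a i ^+ 2) * (\sum_(i | P i) b i ^+ 2) - (\sum_(i | P i) a i * b i) ^+ 2).
  set SA := \sum_(i | P i) a i ^+ 2; set SB := \sum_(i | P i) b i ^+ 2.
  set SC := \sum_(i | P i) a i * b i.
  have -> : \sum_(i | P i) \sum_(j | P j) (a i * b j - a j * b i) ^+ 2 =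
    \sum_(i | P i) (a i ^+ 2 * SB + b i ^+ 2 * SA - 2%:R * SC * (a i * b i)).
    apply: eq_bigr => i _; rewrite !mulr_sumr mulr_suml -big_split -sumrB /=.
    by apply: eq_bigr => j _; ring.
  by rewrite sumrB big_split /= -!mulr_suml -mulr_sumr -/SA -/SB -/SC; ring.
by rewrite pmulr_rge0 // subr_ge0.
Qed.

Lemma shift_sum (f : nat -> int) D h : (forall n, `|f n| <= 1) ->
  `|\sum_(n < D) f (n + h)%N - \sum_(n < D) f n| <= (2 * h)%:R.
Proof.
move=> f1; elim: h => [|h IH].
  by under eq_bigr => n _ do rewrite addn0; rewrite subrr normr0.
have E : \sum_(n < D) f (n + h.+1)%N = \sum_(n < D) f (n + h)%N + (f (D + h)%N - f h).
  have := big_ord_recl D (fun n => f (n + h)%N) (op := +%R) (idx := 0).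
  rewrite big_ord_recr /= add0n => e.
  have -> : \sum_(n < D) f (n + h.+1)%N = \sum_(i < D) f (bump 0 i + h)%N.
    by apply: eq_bigr => i _; rewrite /bump add1n addSnnS.
  by rewrite addrA e [f h + _]addrC addrK.
rewrite E [X in `|X|](_ : _ = (\sum_(n < D) f (n + h)%N - \sum_(n < D) f n) + (f (D + h)%N - f h)); last by ring.
apply: le_trans (ler_normD _ _) _.
have -> : (2 * h.+1)%:R = (2 * h)%:R + 2%:R :> int by rewrite -natrD mulnS addnC.
by apply: lerD => //; apply: le_trans (ler_normB _ _) _; apply: le_trans (lerD (f1 (D + h)%N) (f1 h)) _.
Qed.

End Sums.

(** * Burgess' bound *)

Section Burgess.
Local Open Scope ring_scope.
Variable s : seq nat.
Hypotheses (us : uniq s) (os : all oddprime s).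
Let c := cond s.
Let ps : all prime s := oddprime_prime os.
Let c0 : (0 < c)%N := cond_gt0 ps.
Variables A L D T : nat.
Hypothesis tauT : forall y, (0 < y <= A * D)%N -> (tau y <= T)%N.

Let inv (a : nat) : nat := (egcdn a c).1.

Let invP a : (0 < a)%N -> coprime a c -> (a * inv a = 1 %[mod c])%N.
Proof.
move=> a0 co; rewrite /inv; case: egcdnP => // km kn E _ /=.
by rewrite mulnC E (eqP co) modnMDl.
Qed.

Let P (i : 'I_A * 'I_D) := coprime i.1.+1 c.
(* Shifting the summation variable by [a b] and dividing by [a] turns [psi (n + a b)] into
   [psi a * psi (n / a + b)]; [X] is the residue [n / a]. *)
Let X (i : 'I_A * 'I_D) : 'I_c := Ordinal (ltn_pmod (i.2.+1 * inv i.1.+1) c0).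
Let g (x : nat) : int := `|\sum_(b < L) psi s (x + b)|.

Lemma XP i : P i -> (i.1.+1 * X i = i.2.+1 %[mod c])%N.
Proof.
move=> Pi; rewrite /= modnMmr mulnCA -modnMmr invP // modnMmr muln1 //.
Qed.

Lemma term_le i : P i -> `|\sum_(b < L) psi s (i.2.+1 + i.1.+1 * b)| <= g (X i).
Proof.
move=> Pi; have E b : psi s (i.2.+1 + i.1.+1 * b) = psi s i.1.+1 * psi s (X i + b).
  rewrite -psiM // mulnDr -(periodic_modn _ (psi_periodic os)) -modnDml -XP //.
  by rewrite modnDml (periodic_modn _ (psi_periodic os)).
under eq_bigr => b _ do rewrite E.
by rewrite -mulr_sumr normrM ler_piMl ?normr_ge0 // psi_norm.
Qed.

Lemma sum_nat_eq_le1 (N k : nat) : (\sum_(n < N) (nat_of_ord n == k) <= 1)%N.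
Proof.
case: (ltnP k N) => kN; last first.
  by rewrite big1 // => n _; rewrite ltn_eqF // (leq_trans _ kN).
rewrite (bigD1 (Ordinal kN)) //= eqxx big1 // => n.
by rewrite -val_eqE /= => /negPf ->.
Qed.

Lemma count_mod N w : (\sum_(y < N) (y.+1 == w %[mod c]) <= N %/ c + 1)%N.
Proof.
have blk a r : (r <= c)%N -> (\sum_(y < r) ((a + y).+1 == w %[mod c]) <= 1)%N.
  move=> rc; have [/existsP[y0 y0E]|] := boolP [exists y : 'I_r, (a + y).+1 == w %[mod c]]; last first.
    by rewrite negb_exists => /forallP h; rewrite big1 // => y _; rewrite (negPf (h y)).
  rewrite (bigD1 y0) //= y0E big1 // => y yy0; apply/eqP; rewrite eqb0.
  apply: contra yy0 => h; apply/eqP/val_inj => /=.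
  have : ((a + y).+1 == (a + y0).+1 %[mod c])%N by rewrite (eqP h) (eqP y0E).
  rewrite -!addSn eqn_modDl !modn_small ?(leq_trans (ltn_ord _) rc) //.
  by move/eqP.
suff H k : (\sum_(y < k * c + N %% c) (y.+1 == w %[mod c]) <= k + 1)%N.
  by have := H (N %/ c)%N; rewrite -divn_eq.
elim: k => [|k IH].
  by rewrite mul0n; apply: (blk 0%N); rewrite ltnW // ltn_pmod.
have -> : (k.+1 * c + N %% c = c + (k * c + N %% c))%N by rewrite mulSn addnA.
rewrite big_split_ord /= addSn -add1n; apply: leq_add; first exact: (blk 0%N).
apply: leq_trans IH; rewrite leq_eqVlt; apply/orP; left; apply/eqP.
by apply: eq_bigr => y _; rewrite -addnS modnDl.
Qed.

Lemma count_prod Y : (0 < Y)%N ->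
  (\sum_(a < A) \sum_(n < D) (n.+1 * a.+1 == Y) <= tau Y)%N.
Proof.
move=> Y0; apply: leq_trans (_ : \sum_(a < A) (a.+1 %| Y) <= _)%N.
  apply: leq_sum => a _; case: (boolP (a.+1 %| Y)%N) => [/dvdnP[k kE]|h].
    have k0 : (0 < k)%N by move: Y0; rewrite kE muln_gt0 => /andP[].
    apply: leq_trans (sum_nat_eq_le1 D k.-1).
    by apply: leq_sum => n _; rewrite kE eqn_pmul2r // -{1}(prednK k0) eqSS.
  rewrite big1 // => n _; apply/eqP; rewrite eqb0; apply: contra h => /eqP <-; exact: dvdn_mull.
apply: leq_trans (_ : size [seq a <- iota 1 A | a %| Y] <= _)%N; last first.
  apply: size_divisors_le_tau => //; first by rewrite filter_uniq // iota_uniq.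
  by move=> d; rewrite mem_filter => /andP[].
have -> : iota 1 A = index_iota 1 A.+1 by rewrite /index_iota subSS subn0.
rewrite size_filter -sum1_count big_mkcond big_add1 /= big_mkord.
by rewrite [X in (_ <= X)%N]big_mkcond; apply: leq_sum => a _; case: (_ %| _)%N.
Qed.

(** [X i = X j] forces [n a' = n' a] modulo [c]. Given [a'] and [n], the product [n' a] takes at
    most [A D / c + 1] values up to [A D], each with at most [T] factorizations. *)
Lemma collisions :
  (\sum_(i | P i) \sum_(j | P j) (X i == X j) <= A * D * (A * D %/ c + 1) * T)%N.
Proof.
apply: leq_trans (_ : \sum_(i : 'I_A * 'I_D) \sum_(j : 'I_A * 'I_D)
    (i.2.+1 * j.1.+1 == j.2.+1 * i.1.+1 %[mod c]) <= _)%N.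
  rewrite big_mkcond; apply: leq_sum => i _; case: ifP => // Pi.
  rewrite big_mkcond; apply: leq_sum => j _; case: ifP => // Pj.
  case: eqP => // XE; rewrite (_ : (_ == _ %[mod c])%N = true) //; apply/eqP.
  rewrite -modnMml -(XP Pi) modnMml XE -[RHS]modnMml -(XP Pj) modnMml.
  by congr (_ %% _)%N; lia.
have -> : (\sum_(i : 'I_A * 'I_D) \sum_(j : 'I_A * 'I_D)
    (i.2.+1 * j.1.+1 == j.2.+1 * i.1.+1 %[mod c]) =
  \sum_(a < A) \sum_(n < D) \sum_(a' < A) \sum_(n' < D)
    (n.+1 * a'.+1 == n'.+1 * a.+1 %[mod c]))%N.
  rewrite [RHS]pair_bigA /=; apply: eq_bigr => -[a n] _.
  by rewrite [RHS]pair_bigA.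
under eq_bigr => a _ do rewrite exchange_big.
rewrite exchange_big /=.
under eq_bigr => a' _ do rewrite exchange_big /=.
apply: leq_trans (_ : \sum_(a' < A) \sum_(n < D) (A * D %/ c + 1) * T <= _)%N; last first.
  by rewrite !sum_nat_const !card_ord !mulnA.
apply: leq_sum => a' _; apply: leq_sum => n _; set w := (n.+1 * a'.+1)%N.
apply: leq_trans (_ : \sum_(y < A * D) (y.+1 == w %[mod c]) * T <= _)%N; last first.
  by rewrite -big_distrl /= leq_mul2r count_mod orbT.
apply: leq_trans (_ : \sum_(y < A * D) (y.+1 == w %[mod c]) * \sum_(a < A) \sum_(n' < D) (n'.+1 * a.+1 == y.+1) <= _)%N; last first.
  apply: leq_sum => y _; rewrite leq_mul2l (leq_trans (count_prod _)) ?orbT //.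
  by apply: tauT; rewrite ltn_ord.
under [X in (_ <= X)%N]eq_bigr => y _ do rewrite big_distrr /=.
rewrite [X in (_ <= X)%N]exchange_big /=; apply: leq_sum => a _.
under [X in (_ <= X)%N]eq_bigr => y _ do rewrite big_distrr /=.
rewrite [X in (_ <= X)%N]exchange_big /=; apply: leq_sum => n' _.
case: eqP => // wE.
have yl : ((n'.+1 * a.+1).-1 < A * D)%N.
  by rewrite prednK // mulnC leq_mul.
have yE : (nat_of_ord (Ordinal yl)).+1 = (n'.+1 * a.+1)%N by exact: (@prednK (n'.+1 * a.+1)).
by rewrite (bigD1 (Ordinal yl)) // yE eqxx muln1 -wE eqxx leq_addr.
Qed.

(** The pairs are grouped by their residue [x], with multiplicity [nu x], and Cauchy-Schwarz is
    applied twice; the second moment of [nu] counts collisions. *)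
Lemma burgess_main :
  (\sum_(i | P i) g (X i)) ^+ 4 <=
  ((coprime_count s A * D) ^ 2 * (A * D * (A * D %/ c + 1) * T))%:R * \sum_(x < c) g x ^+ 4.
Proof.
set M := \sum_(i | P i) g (X i).
pose nu (x : 'I_c) : int := (\sum_(i | P i) (X i == x))%:R.
have cardP : (\sum_(i | P i) 1 = coprime_count s A * D)%N.
  rewrite /coprime_count big_add1 /= big_mkord big_distrl big_mkcond /=.
  rewrite -(pair_bigA _ (fun (a : 'I_A) (n : 'I_D) => if coprime a.+1 c then 1%N else 0%N)) /=.
  apply: eq_bigr => a _; rewrite sum_nat_const card_ord mulnC -/c.
  by case: (coprime _ _).
have h1 : M ^+ 2 <= (coprime_count s A * D)%:R * \sum_(i | P i) g (X i) ^+ 2.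
  have := cauchy_schwarz P (fun=> 1) (fun i => g (X i)).
  rewrite (eq_bigr (fun i => g (X i))) => [|i _]; last by rewrite mul1r.
  rewrite [X in _ <= X * _ -> _](_ : _ = (coprime_count s A * D)%:R) //.
  by rewrite -cardP natr_sum; apply: eq_bigr => i _; rewrite expr1n.
have h2 : \sum_(i | P i) g (X i) ^+ 2 = \sum_x nu x * g x ^+ 2.
  under [RHS]eq_bigr => x _ do rewrite /nu natr_sum mulr_suml.
  rewrite exchange_big /=; apply: eq_bigr => i _.
  rewrite (bigD1 (X i)) //= eqxx mul1r big1 ?addr0 // => x /negPf.
  by rewrite eq_sym => ->; rewrite mul0r.
have h3 := cauchy_schwarz xpredT nu (fun x => g x ^+ 2).
have h4 : \sum_x nu x ^+ 2 <= (A * D * (A * D %/ c + 1) * T)%:R.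
  apply: le_trans (_ : (\sum_(i | P i) \sum_(j | P j) (X i == X j))%:R <= _); last first.
    by rewrite ler_nat collisions.
  rewrite le_eqVlt; apply/orP; left; apply/eqP.
  have E x : nu x ^+ 2 = (\sum_(i | P i) \sum_(j | P j) (X i == x) * (X j == x))%:R.
    rewrite expr2 /nu -natrM big_distrl /=; congr (_%:R).
    by apply: eq_bigr => i _; rewrite big_distrr.
  rewrite (eq_bigr _ (fun x _ => E x)) -natr_sum; congr (_%:R).
  rewrite exchange_big; apply: eq_bigr => i _.
  rewrite exchange_big; apply: eq_bigr => j _.
  rewrite (bigD1 (X i)) //= eqxx mul1n big1 ?addn0 ?[X j == _]eq_sym // => x /negPf.
  by rewrite eq_sym => ->.
have M0 : 0 <= M by apply: sumr_ge0 => i _; exact: normr_ge0.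
have -> : M ^+ 4 = (M ^+ 2) ^+ 2 by rewrite -exprM.
apply: le_trans (_ : ((coprime_count s A * D)%:R * \sum_(i | P i) g (X i) ^+ 2) ^+ 2 <= _).
  by apply: lerXn2r; rewrite ?nnegrE ?sqr_ge0 // (le_trans (sqr_ge0 _) h1).
rewrite exprMn [X in _ <= X * _]natrM natrX -[X in _ <= X]mulrA; apply: ler_wpM2l; first exact: sqr_ge0.
rewrite h2; apply: le_trans h3 _.
under [X in _ * X <= _]eq_bigr => x _ do rewrite -exprM.
by apply: ler_wpM2r => //; apply: sumr_ge0 => x _; rewrite exprn_ge0 // normr_ge0.
Qed.

(** Averaging over the translations by [a b] with [a] coprime to [c]: each changes the sum by at
    most [2 A L], and the averaged sum is controlled by its inner sums over [b]. *)
Lemma burgess_sum :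
  (coprime_count s A * L)%:R * `|\sum_(n < D) psi s n.+1| <=
  (coprime_count s A * L)%:R * (2 * (A * L))%:R + \sum_(i | P i) g (X i).
Proof.
set S := \sum_(n < D) _.
have cardE : (coprime_count s A * L)%:R = \sum_(a < A | coprime a.+1 c) \sum_(b < L) (1 : int).
  under eq_bigr => a _ do rewrite sumr_const card_ord.
  rewrite /coprime_count big_add1 /= big_mkord big_distrl natr_sum big_mkcond [RHS]big_mkcond /=.
  apply: eq_bigr => a _; rewrite -/c.
  by case: (coprime _ _); rewrite ?mul1n ?mul0n.
pose Q a b := \sum_(n < D) psi s (n.+1 + a.+1 * b).
have QE (a : 'I_A) (b : 'I_L) : `|S - Q a b| <= (2 * (A * L))%:R.
  have := shift_sum D (a.+1 * b) (fun n => psi_norm s n.+1) => /= h.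
  rewrite distrC; apply: le_trans h _.
  rewrite ler_nat leq_mul2l /=; apply: leq_mul; [exact: ltn_ord|exact: ltnW].
have -> : (coprime_count s A * L)%:R * `|S| = `|\sum_(a < A | coprime a.+1 c) \sum_(b < L) S|.
  rewrite -[(coprime_count s A * L)%:R]normr_nat -normrM cardE mulr_suml; congr `|_|.
  by apply: eq_bigr => a _; rewrite mulr_suml; apply: eq_bigr => b _; rewrite mul1r.
have -> : \sum_(a < A | coprime a.+1 c) \sum_(b < L) S =
   \sum_(a < A | coprime a.+1 c) \sum_(b < L) (S - Q a b) +
   \sum_(a < A | coprime a.+1 c) \sum_(b < L) Q a b.
  by rewrite -big_split; apply: eq_bigr => a _; rewrite -big_split; apply: eq_bigr => b _; rewrite /= subrK.
apply: le_trans (ler_normD _ _) _; apply: lerD.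
  rewrite cardE mulr_suml; apply: le_trans (ler_norm_sum _ _ _) _; apply: ler_sum => a _.
  rewrite mulr_suml; apply: le_trans (ler_norm_sum _ _ _) _; apply: ler_sum => b _.
  by rewrite mul1r; exact: QE.
have -> : \sum_(a < A | coprime a.+1 c) \sum_(b < L) Q a b =
  \sum_(i | P i) \sum_(b < L) psi s (i.2.+1 + i.1.+1 * b).
  rewrite [RHS]big_mkcond -(pair_bigA _ (fun (a : 'I_A) (n : 'I_D) =>
    if P (a, n) then \sum_(b < L) psi s (n.+1 + a.+1 * b) else 0)) /= big_mkcond /=.
  apply: eq_bigr => a _; rewrite /P /=; case: (coprime _ _); last by rewrite big1.
  by rewrite exchange_big.
apply: le_trans (ler_norm_sum _ _ _) _; apply: ler_sum => i; exact: term_le.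
Qed.
End Burgess.

(** * Choice of parameters in Burgess' bound *)

Section BurgessBound.

(** The fourth power of [2 t M <= al L D], [M] being the sum bounded in [burgess_main]: [al] counts
    integers coprime to [c], [q] is [A D / c + 1], [kap] is the constant of the fourth moment. The
    last two hypotheses match the two terms of [A D + c]. *)
Lemma burgess_numeric (t al A L D c T kap q : nat) : 0 < t ->
  T <= t -> kap <= t ^ 2 -> c * q <= A * D + c -> A <= t * al ->
  32 * t ^ 9 <= L ^ 2 -> 32 * t ^ 9 * c <= A * L ^ 2 * D ->
  16 * t ^ 4 * ((al * D) ^ 2 * (A * D * q * T) * (kap * c * L ^ 2)) <= (al * L * D) ^ 4.
Proof.
move=> t0 Tt kt cq At Lt ct.
have h1 : 16 * t ^ 9 * (A * D + c) <= A * L ^ 2 * D.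
  have : 32 * t ^ 9 * (A * D) <= L ^ 2 * (A * D) by rewrite leq_mul2r Lt orbT.
  move: ct; rewrite mulnDr; move: (t ^ 9) (L ^ 2) => u v; clear; lia.
have h2 : 16 * t ^ 7 * A * (A * D + c) <= al ^ 2 * L ^ 2 * D.
  rewrite -(@leq_pmul2l (t ^ 2)) ?expn_gt0 ?t0 //.
  apply: leq_trans (_ : A * (A * L ^ 2 * D) <= _).
    apply: leq_trans (_ : A * (16 * t ^ 9 * (A * D + c)) <= _); last by rewrite leq_mul2l h1 orbT.
    by rewrite eq_leq // -[9]/(2 + 7) expnD; ring.
  have : A ^ 2 <= (t * al) ^ 2 by rewrite leq_exp2r.
  move=> h; apply: leq_trans (_ : A ^ 2 * (L ^ 2 * D) <= _); first by rewrite eq_leq //; ring.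
  apply: leq_trans (_ : (t * al) ^ 2 * (L ^ 2 * D) <= _); first by rewrite leq_mul2r h orbT.
  by rewrite eq_leq //; ring.
apply: leq_trans (_ : 16 * t ^ 4 * ((al * D) ^ 2 * (A * D * t) * (t ^ 2 * L ^ 2)) * (A * D + c) <= _).
  apply: leq_trans (_ : 16 * t ^ 4 * ((al * D) ^ 2 * (A * D * T) * (kap * L ^ 2)) * (c * q) <= _).
    by rewrite eq_leq //; ring.
  by apply: leq_mul => //; rewrite leq_mul2l; apply/orP; right; apply: leq_mul; [rewrite !leq_mul2l Tt !orbT|rewrite leq_mul2r kt orbT].
apply: leq_trans (_ : (al ^ 2 * D ^ 3 * L ^ 2) * (16 * t ^ 7 * A * (A * D + c)) <= _).
  by rewrite eq_leq // -[7]/(4 + 3) expnD; ring.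
apply: leq_trans (_ : (al ^ 2 * D ^ 3 * L ^ 2) * (al ^ 2 * L ^ 2 * D) <= _).
  by rewrite leq_mul2l h2 orbT.
by rewrite eq_leq //; ring.
Qed.

Local Open Scope ring_scope.

(** [4 A L t <= D] keeps the translation error within half of the target, and the fourth moment
    keeps the main sum within the other half. Constants of the shape [C ^ size s] are bounded by
    powers of [2 ^ size s <= tau (cond s)], hence absorbed by [t]. *)
Lemma burgess_step (s : seq nat) (A L D t : nat) : uniq s -> all oddprime s ->
  (4 <= t)%N -> (35 <= t)%N -> (0 < L)%N -> (0 < D)%N -> (t ^ 2 <= A)%N ->
  (L ^ 4 <= cond s)%N -> (tau (cond s) ^ 9 <= t)%N ->
  (forall y, (0 < y <= A * D)%N -> (tau y <= t)%N) ->
  (4 * A * L * t <= D)%N -> (32 * t ^ 9 <= L ^ 2)%N -> (32 * t ^ 9 * cond s <= A * L ^ 2 * D)%N ->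
  `|\sum_(d < D) psi s d.+1| * t%:R <= D%:R.
Proof.
move=> us os t4 t35 L0 D0 At L4 tauc tauy ALD Lt ct.
have ps := oddprime_prime os; have c0 := cond_gt0 ps.
set S := `|_|; set c := cond s in L4 tauc ct c0 *; set al := coprime_count s A.
have tc1 : (0 < tau c)%N := tau_gt0 c0.
have k2 : (2 ^ size s <= tau c)%N := tau_cond us ps.
have tauj j : (j <= 9)%N -> (tau c ^ j <= t)%N.
  by move=> j9; apply: leq_trans tauc; rewrite leq_pexp2l.
have t0 : (0 < t)%N by apply: leq_trans t4.
have Aal : (A <= t * al)%N.
  have := coprime_count_lower A us ps; rewrite -/al.
  have h6 : (6 ^ size s <= t)%N.
    apply: leq_trans (tauj 3%N isT); apply: leq_trans (_ : (2 ^ size s) ^ 3 <= _)%N; last by rewrite leq_exp2r.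
    by rewrite -expnM mulnC expnM; case: (size s) => // k; rewrite leq_exp2r.
  have h22 : (2 * 2 ^ size s <= t)%N.
    have := tauj 2 isT; have := k2; rewrite expnS expn1; move: t4; clear; move: (2 ^ size s)%N (tau c); nia.
  move: At t4 h6 h22; rewrite expnS expn1; move: (6 ^ size s)%N (2 ^ size s)%N; clear; nia.
have al0 : (0 < al)%N.
  rewrite lt0n; apply/eqP => al0; move: Aal; rewrite al0 muln0 leqn0 => /eqP A0.
  by move: At; rewrite A0 leqn0 expn_eq0 => /andP[/eqP]; lia.
set M := \sum_(i : 'I_A * 'I_D | coprime i.1.+1 c) `|\sum_(b < L) psi s ((i.2.+1 * (egcdn i.1.+1 c).1) %% c + b)|.
have hsum : (al * L)%:R * S <= (al * L)%:R * (2 * (A * L))%:R + M by exact: burgess_sum.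
have M0 : 0 <= M by apply: sumr_ge0.
have hM : M ^+ 4 <= ((al * D) ^ 2 * (A * D * (A * D %/ c + 1) * t) *
    ((3 + 32 * 64 ^ size s * tau c ^ 3) * c * L ^ 2))%:R.
  apply: le_trans (burgess_main us os L tauy) _; rewrite [X in _ <= X]natrM.
  apply: ler_wpM2l; first exact: ler0n.
  apply: le_trans (fourth_moment us os L4); rewrite le_eqVlt; apply/orP; left; apply/eqP.
  by apply: eq_bigr => x _; rewrite -normrX ger0_norm // (exprM _ 2 2) sqr_ge0.
have kap : (3 + 32 * 64 ^ size s * tau c ^ 3 <= t ^ 2)%N.
  apply: leq_trans (_ : 35 * tau c ^ 9 <= _)%N; last by rewrite -(mulnn t) leq_mul.
  have h : (64 ^ size s * tau c ^ 3 <= tau c ^ 9)%N.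
    rewrite -[9%N]/(6 + 3)%N [X in (_ <= X)%N]expnD leq_mul2r; apply/orP; right.
    apply: leq_trans (_ : (2 ^ size s) ^ 6 <= _)%N; last by rewrite leq_exp2r.
    by rewrite -expnM mulnC expnM.
  have : (0 < tau c ^ 9)%N by rewrite expn_gt0 tc1.
  by move: h; rewrite -mulnA; move: (_ * _)%N (tau c ^ 9)%N; clear; lia.
have cq : (c * (A * D %/ c + 1) <= A * D + c)%N.
  by rewrite mulnDr muln1 leq_add2r mulnC leq_trunc_div.
have num := burgess_numeric t0 (leqnn t) kap cq Aal Lt ct.
have tM : (2 * t)%:R * M <= (al * L * D)%:R.
  rewrite -(@ler_pXn2r _ 4) ?nnegrE ?mulr_ge0 ?ler0n //.
  rewrite exprMn -natrX expnMn -[(2 ^ 4)%N]/16%N.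
  apply: le_trans (_ : (16 * t ^ 4)%:R * _ <= _); first by apply: ler_wpM2l hM; exact: ler0n.
  by rewrite -natrM -natrX ler_nat.
have S0 : 0 <= S by exact: normr_ge0.
have aL0 : 0 < (al * L)%:R :> int by rewrite ltr0n muln_gt0 al0.
have K : (2 * (al * L))%:R * (S * t%:R) <= (2 * (al * L))%:R * D%:R.
  have e1 : (2 * (al * L))%:R * (S * t%:R) = (2 * t)%:R * ((al * L)%:R * S) by rewrite !natrM; ring.
  rewrite e1; apply: le_trans (_ : (2 * t)%:R * ((al * L)%:R * (2 * (A * L))%:R + M) <= _).
    by apply: ler_wpM2l hsum; exact: ler0n.
  rewrite mulrDr; apply: le_trans (lerD (lexx _) tM) _.
  rewrite -!natrM -natrD ler_nat.
  have : (al * L * (4 * A * L * t) <= al * L * D)%N by rewrite leq_mul2l ALD orbT.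
  clear; lia.
by move: K; rewrite ler_pM2l // ltr0n !muln_gt0 al0.
Qed.

(** Up to [t ^ (6 * n - 1)] completing the sum is enough. Above, [A L = D / t ^ 2] leaves a
    tradeoff: [L ^ 4 <= cond s] wants [L] short, while [cond s * t ^ 10 <= A * L ^ 2 * D] wants it
    long. Two values of [L], according to [cond s <= t ^ (11 * n)] or not, cover the range. *)
Lemma burgess_bound n : (20 <= n)%N -> exists t0, forall t s, (t0 <= t)%N ->
  uniq s -> all oddprime s -> s != [::] -> (cond s <= t ^ (14 * n))%N ->
  `|\sum_(d < t ^ (6 * n)) psi s d.+1| * t%:R <= (t ^ (6 * n))%:R.
Proof.
move=> n20; have M0 : (0 < 14 * n)%N by clear -n20; lia.
have [t1 H1] := tau_small 9 M0; have [t2 H2] := tau_small 1 M0.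
exists (t1 + t2 + 35)%N => t s tt us os s0 cs.
have t35 : (35 <= t)%N by apply: leq_trans tt; rewrite leq_addl.
have c0 := cond_gt0 (oddprime_prime os).
have tau9 : (tau (cond s) ^ 9 <= t)%N.
  by apply: H1 => //; apply: leq_trans tt; rewrite -addnA leq_addr.
have t0 : (0 < t)%N by apply: leq_trans t35.
have t1' : (1 < t)%N by apply: leq_trans t35.
have tauy y : (0 < y <= t ^ (14 * n))%N -> (tau y <= t)%N.
  move=> /andP[y0 yt]; rewrite -[tau y]expn1; apply: H2 => //.
  by apply: leq_trans tt; rewrite addnAC leq_addl.
have [csmall|clarge] := leqP (cond s) (t ^ (6 * n - 1)).
  apply: le_trans (_ : (cond s)%:R * t%:R <= _).
    by apply: ler_wpM2r; rewrite ?ler0n //; exact: psi_sum_bound.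
  rewrite -natrM ler_nat; apply: leq_trans (_ : t ^ (6 * n - 1) * t <= _)%N; first by rewrite leq_mul2r csmall orbT.
  by rewrite -expnSr leq_pexp2l //; clear -n20; lia.
have step a l : (a + l + 2 = 6 * n)%N -> (2 <= a)%N -> (5 <= l)%N ->
    ((t ^ l) ^ 4 <= cond s)%N -> (cond s * t ^ 10 <= t ^ (a + 2 * l + 6 * n))%N ->
    `|\sum_(d < t ^ (6 * n)) psi s d.+1| * t%:R <= (t ^ (6 * n))%:R.
  move=> al a2 l5 l4 cE.
  have t32 : (32 <= t)%N by apply: leq_trans t35.
  apply: (@burgess_step s (t ^ a) (t ^ l)) => //; rewrite ?expn_gt0 ?t0 //.
  - by apply: leq_trans t35.
  - by rewrite leq_pexp2l.
  - move=> y; rewrite -expnD => /andP[y0 yt]; apply: tauy; rewrite y0 /=; apply: leq_trans yt _.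
    by rewrite leq_pexp2l //; clear -al; lia.
  - rewrite -mulnA mulnACA; apply: leq_trans (_ : t * t ^ (a + l + 1) <= _)%N.
      rewrite 2!expnD expn1; move: (t ^ a)%N (t ^ l)%N t35; clear; nia.
    by rewrite -expnS leq_pexp2l //; clear -al; lia.
  - apply: leq_trans (_ : t * t ^ 9 <= _)%N; first by rewrite leq_mul2r t32 orbT.
    by rewrite -expnS -expnM leq_pexp2l //; clear -l5; lia.
  - rewrite -expnM -!expnD; apply: leq_trans (_ : cond s * t ^ 10 <= _)%N.
      by rewrite mulnC leq_mul2l expnS leq_mul2r t32 !orbT.
    by apply: leq_trans cE _; rewrite leq_pexp2l //; clear; lia.
have [c11|c11] := leqP (cond s) (t ^ (11 * n)).
  apply: (step (5 * n - 2)%N n); try (clear -n20; lia).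
    apply: leq_trans (ltnW clarge); rewrite -expnM leq_pexp2l //; clear -n20; lia.
  apply: leq_trans (_ : t ^ (11 * n) * t ^ 10 <= _)%N; first by rewrite leq_mul2r c11 orbT.
  by rewrite -expnD leq_pexp2l //; clear -n20; lia.
(* [L] is just long enough: [a + 2 l + 6 n = 14 n + 10], while [4 l = 8 n + 48 <= 11 n] uses
   [20 <= n]. *)
apply: (step (4 * n - 14)%N (2 * n + 12)%N); try (clear -n20; lia).
  apply: leq_trans (ltnW c11); rewrite -expnM leq_pexp2l //; clear -n20; lia.
apply: leq_trans (_ : t ^ (14 * n) * t ^ 10 <= _)%N; first by rewrite leq_mul2r cs orbT.
by rewrite -expnD leq_pexp2l //; clear -n20; lia.
Qed.
End BurgessBound.

(** * A large-values estimate *)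

Section LargeValues.
Local Open Scope ring_scope.

Lemma chi1 p : oddprime p -> chi p 1 = 1.
Proof.
move=> op; have := chiM op 1 1; rewrite muln1 -expr2 chi_sqr //.
by case/andP: op => /prime_gt1 p1 _; rewrite gtnNdvd.
Qed.

Lemma psi1 s : all oddprime s -> psi s 1 = 1.
Proof.
by move=> os; rewrite /psi big_seq big1 // => p /(allP os); exact: chi1.
Qed.

Lemma psi_prod s (l : nat) (f : 'I_l -> nat) : all oddprime s ->
  psi s (\prod_(i < l) f i) = \prod_(i < l) psi s (f i).
Proof.
move=> os; apply: (big_morph (psi s)); last exact: psi1.
by move=> m n; exact: psiM.
Qed.

Lemma card_divisor_tuples (D l Y : nat) : (0 < Y)%N ->
  (#|[pred g : {ffun 'I_l -> 'I_D} | \prod_(i < l) (g i).+1 == Y]%N| <= tau Y ^ l)%N.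
Proof.
move=> Y0; pose B := [pred d : 'I_D | (d.+1 %| Y)%N].
apply: leq_trans (_ : #|B| ^ l <= _)%N.
  rewrite -[l in (_ ^ l)%N]card_ord -card_ffun_on; apply/subset_leq_card/fintype.subsetP => g.
  rewrite inE => /eqP gY; apply/ffun_onP => i; rewrite inE -gY.
  by rewrite (bigD1 i) //= dvdn_mulr.
case: l => // l; rewrite leq_exp2r //.
have -> : #|B| = size [seq d.+1 | d : 'I_D <- enum B].
  by rewrite size_map -cardE.
apply: size_divisors_le_tau => //; first by rewrite map_inj_uniq ?enum_uniq // => x y [/val_inj].
by move=> d /mapP[x + ->]; rewrite mem_enum.
Qed.

(** There are [K] characters of conductor at most [P]; [R] is both a bound for the divisor function
    and the loss allowed in a nearly trivial sum. *)
Variables (D l P R K : nat) (s : 'I_K -> seq nat).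
Let N := (D ^ l)%N.
Hypotheses (us : forall v, uniq (s v)) (os : forall v, all oddprime (s v)).
Hypotheses (D0 : (0 < D)%N) (condP : forall v, (cond (s v) <= P)%N) (PN : (K * P ^ 2 <= N)%N).
Hypothesis tauR : forall y, (0 < y <= N)%N -> (tau y <= R)%N.
Hypothesis sep : forall v v', v != v' -> exists p,
   (p \in s v) && (p \notin s v') || (p \in s v') && (p \notin s v).

Let F v := \sum_(d < D) psi (s v) d.+1.
Hypothesis large : forall v, D%:R <= R%:R * `|F v|.

Let ppi (f : {ffun 'I_l -> 'I_D}) : nat := \prod_(i < l) (f i).+1.

Let ppi_bound f : (0 < ppi f <= N)%N.
Proof.
apply/andP; split; first by rewrite prodn_gt0.
rewrite /N -[l in (_ ^ l)%N]card_ord -prod_nat_const; apply: leq_prod => i _; exact: ltn_ord.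
Qed.

Let ppi_lt f : ((ppi f).-1 < N)%N.
Proof. by have /andP[h1 h2] := ppi_bound f; rewrite prednK. Qed.

Let idx f : 'I_N := Ordinal (ppi_lt f).
Let a (n : 'I_N) : nat := \sum_(f : {ffun 'I_l -> 'I_D}) (idx f == n).
Let sg v : int := Num.sg (F v ^+ l).
Let b (n : 'I_N) : int := \sum_v sg v * psi (s v) n.+1.

Let sgn_le v : `|sg v| <= 1.
Proof. by rewrite /sg normr_sg lern1 leq_b1. Qed.

Let sum_large : \sum_v `|F v| ^+ l = \sum_n (a n)%:R * b n.
Proof.
have E v : `|F v| ^+ l = \sum_f sg v * psi (s v) (ppi f).
  rewrite -normrX normrEsg -/(sg v) -mulr_sumr; congr (_ * _).
  rewrite -[l in LHS]card_ord -prodr_const /F bigA_distr_bigA /=.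
  by apply: eq_bigr => f _; rewrite psi_prod.
rewrite (eq_bigr _ (fun v _ => E v)) exchange_big /=.
under [RHS]eq_bigr => n _ do rewrite /a natr_sum mulr_suml.
rewrite [RHS]exchange_big /=; apply: eq_bigr => f _.
rewrite [RHS](bigD1 (idx f)) //= eqxx mul1r [X in _ = _ + X]big1 ?addr0.
  by rewrite /b; apply: eq_bigr => v _; rewrite /= prednK //; case/andP: (ppi_bound f).
by move=> n /negPf; rewrite eq_sym => ->; rewrite mul0r.
Qed.

Let sum_a : \sum_n (a n)%:R ^+ 2 <= (N * R ^ l)%:R :> int.
Proof.
have -> : \sum_n (a n)%:R ^+ 2 = (\sum_f \sum_g (idx f == idx g))%:R :> int.
  have E n : (a n)%:R ^+ 2 = (\sum_f \sum_g (idx f == n) * (idx g == n))%:R :> int.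
    rewrite expr2 /a -natrM big_distrl /=; congr (_%:R).
    by apply: eq_bigr => i _; rewrite big_distrr.
  rewrite (eq_bigr _ (fun x _ => E x)) -natr_sum; congr (_%:R).
  rewrite exchange_big; apply: eq_bigr => f _.
  rewrite exchange_big; apply: eq_bigr => g _.
  rewrite (bigD1 (idx f)) //= eqxx mul1n big1 ?addn0 ?[idx g == _]eq_sym // => n /negPf.
  by rewrite eq_sym => ->.
rewrite ler_nat; have -> : (N * R ^ l = \sum_(f : {ffun 'I_l -> 'I_D}) R ^ l)%N.
  by rewrite sum_nat_const card_ffun !card_ord.
apply: leq_sum => f _; have /andP[f0 fN] := ppi_bound f.
apply: leq_trans (_ : tau (ppi f) ^ l <= _)%N; last first.
  by case: (l) => // l'; rewrite leq_exp2r // tauR // f0 fN.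
apply: leq_trans (card_divisor_tuples D l f0).
rewrite -sum1_card [X in (_ <= X)%N]big_mkcond; apply: leq_sum => g _; rewrite inE -/(ppi g).
case: eqP => // - [e]; rewrite (_ : ppi g == ppi f) //.
have /andP[g0 _] := ppi_bound g; by rewrite -(prednK f0) -(prednK g0) e.
Qed.

(** After expanding the square, the [K] diagonal terms are at most [N]. For the others [sep]
    provides a prime in only one of the two moduli, so [psi_orth] bounds them by [P ^ 2], and
    [K P ^ 2 <= N] makes them harmless. *)
Let sum_b : \sum_n b n ^+ 2 <= (2 * K * N)%:R.
Proof.
have -> : \sum_n b n ^+ 2 = \sum_v \sum_v' sg v * sg v' * \sum_(n < N) psi (s v) n.+1 * psi (s v') n.+1.
  under [LHS]eq_bigr => n _ do rewrite expr2 /b mulr_suml.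
  rewrite exchange_big; apply: eq_bigr => v _ /=.
  under [LHS]eq_bigr => n _ do rewrite mulr_sumr.
  rewrite exchange_big; apply: eq_bigr => v' _ /=.
  by rewrite mulr_sumr; apply: eq_bigr => n _; ring.
apply: le_trans (_ : (\sum_(v < K) (N + K * P ^ 2))%:R <= _); last first.
  rewrite ler_nat sum_nat_const card_ord; move: PN; move: (P ^ 2)%N; clear; nia.
rewrite natr_sum; apply: ler_sum => v _; rewrite (bigD1 v) //= natrD; apply: lerD.
  apply: le_trans (ler_norm _) _; rewrite !normrM; apply: le_trans (_ : 1 * N%:R <= _); last by rewrite mul1r.
  apply: ler_pM; rewrite ?mulr_ge0 ?normr_ge0 //; first by rewrite mulr_ile1 ?normr_ge0 ?sgn_le.
  apply: le_trans (ler_norm_sum _ _ _) _.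
  apply: le_trans (_ : (\sum_(i < N) 1) <= _); last by rewrite sumr_const card_ord.
  by apply: ler_sum => n _; rewrite normrM mulr_ile1 ?normr_ge0 ?psi_norm.
apply: le_trans (_ : \sum_(v' | v' != v) (P ^ 2)%:R <= _); last first.
  apply: le_trans (_ : \sum_(v' : 'I_K) (P ^ 2)%:R <= _).
    by rewrite [X in X <= _]big_mkcond; apply: ler_sum => v' _; case: ifP => // _; exact: ler0n.
  by rewrite sumr_const card_ord natrM mulr_natl.
apply: ler_sum => v' vv'.
apply: le_trans (ler_norm _) _; rewrite !normrM -[(P ^ 2)%:R]mul1r.
apply: ler_pM; rewrite ?mulr_ge0 ?normr_ge0 //; first by rewrite mulr_ile1 ?normr_ge0 ?sgn_le.
have bound x y : (cond (s x) * cond (s y))%:R <= (P ^ 2)%:R :> int.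
  by rewrite ler_nat -mulnn leq_mul.
have [p /orP[/andP[h1 h2]|/andP[h1 h2]]] := sep vv'.
  rewrite (eq_bigr (fun n : 'I_N => psi (s v') n.+1 * psi (s v) n.+1)) => [|n _]; last exact: mulrC.
  by apply: le_trans (psi_orth _ _ _ _ h1 h2) _.
by apply: le_trans (psi_orth _ _ _ _ h1 h2) _.
Qed.

(* The [l]-th power of each sum is a sum over [n <= D^l], long enough for the characters to be nearly
   orthogonal; [a n] counts the factorizations of [n] and is at most a power of the divisor function. *)
Lemma large_values_bound : (K <= 2 * R ^ (3 * l))%N.
Proof.
case: (posnP K) => [->//|K0].
have N0 : (0 < N)%N by rewrite expn_gt0 D0.
have h := cauchy_schwarz xpredT (fun n => (a n)%:R) b.
rewrite -sum_large in h.
have h1 : (K * N)%:R <= (R ^ l)%:R * \sum_v `|F v| ^+ l.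
  rewrite mulr_sumr -[K in (K * _)%N]card_ord -sum_nat_const natr_sum; apply: ler_sum => v _.
  rewrite /N natrX natrX -exprMn; apply: lerXn2r; rewrite ?nnegrE ?ler0n ?mulr_ge0 ?ler0n ?normr_ge0 //.
have h2 : ((K * N) ^ 2)%:R <= ((R ^ l) ^ 2 * (N * R ^ l * (2 * K * N)))%:R :> int.
  rewrite natrX; apply: le_trans (_ : ((R ^ l)%:R * \sum_v `|F v| ^+ l) ^+ 2 <= _).
    by apply: lerXn2r; rewrite ?nnegrE ?ler0n ?(le_trans _ h1) ?ler0n.
  rewrite exprMn -natrX [X in _ <= X]natrM; apply: ler_wpM2l; first exact: ler0n.
  apply: le_trans h _; rewrite natrM.
  by apply: ler_pM => //; apply: sumr_ge0 => n _; exact: sqr_ge0.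
move: h2; rewrite ler_nat.
have -> : ((R ^ l) ^ 2 * (N * R ^ l * (2 * K * N)) = (K * N * N) * (2 * R ^ (3 * l)))%N.
  by rewrite -[3%N]/(1 + 2)%N mulnDl mul1n mul2n -addnn !expnD; ring.
have -> : ((K * N) ^ 2 = (K * N * N) * K)%N by ring.
by rewrite leq_pmul2l // !muln_gt0 K0 N0.
Qed.
End LargeValues.

(** * Squares in the progression *)

Section Geometry.
Local Open Scope ring_scope.

Definition has_square (q1 q2 X1 X2 : nat) :=
  exists x1 x2 m : int, [/\ `|x1| <= X1%:Z, `|x2| <= X2%:Z, m != 0 & x1 * q1%:Z + x2 * q2%:Z = m ^+ 2].

Lemma has_square_sym q1 q2 X1 X2 : has_square q1 q2 X1 X2 -> has_square q2 q1 X2 X1.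
Proof. by case=> x1 [x2 [m [h1 h2 h3 h4]]]; exists x2, x1, m; rewrite addrC. Qed.

Lemma sqr_absz (x : int) : x ^+ 2 = (absz x ^ 2)%N%:Z.
Proof. by rewrite -mulnn PoszM -expr2 abszE -normrX ger0_norm ?sqr_ge0. Qed.

Lemma sqr_absz_scaled (d h : nat) (e : int) :
  d%:Z * (h%:Z * e) ^+ 2 = (d * h ^ 2 * absz e ^ 2)%N%:Z.
Proof. by rewrite exprMn !sqr_absz absz_nat -!PoszM mulnA. Qed.

Lemma absz_le (x : int) (n : nat) : `|x| <= n%:Z -> (absz x <= n)%N.
Proof. by rewrite -abszE lez_nat. Qed.

Lemma thue (c mu M E : nat) : (0 < c)%N -> (c < M.+1 * E.+1)%N ->
  exists m e : int, [/\ (m != 0) || (e != 0), `|m| <= M%:Z, `|e| <= E%:Z &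
    exists k : int, m = mu%:Z * e + c%:Z * k].
Proof.
(* [nu] is [- mu] modulo [c], so that pigeonholing stays within [nat]. *)
move=> c0 lt; pose nu := (c - mu %% c)%N.
pose f (x : 'I_M.+1 * 'I_E.+1) : 'I_c := Ordinal (ltn_pmod (x.1 + nu * x.2) c0).
have : ~~ injectiveb f.
  apply/negP => /injectiveP /leq_card; rewrite card_prod !card_ord => h.
  by move: (leq_trans lt h); rewrite ltnn.
case/injectivePn => -[i j] [[i' j'] ne /(congr1 val) /= eqm].
exists (i%:Z - i'%:Z), (j%:Z - j'%:Z); split.
- move: ne; apply: contraR; rewrite negb_or !negbK !subr_eq0 => /andP[/eqP[e1] /eqP[e2]].
  by apply/eqP; congr (_, _); apply: val_inj.
- by have := ltn_ord i; have := ltn_ord i'; clear; lia.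
- by have := ltn_ord j; have := ltn_ord j'; clear; lia.
have e1 := divn_eq (i + nu * j) c; have e2 := divn_eq (i' + nu * j') c.
have e3 := divn_eq mu c; have e4 := ltn_pmod mu c0.
exists (((i + nu * j) %/ c)%N%:Z - ((i' + nu * j') %/ c)%N%:Z + (j'%:Z - j%:Z) * ((mu %/ c)%N%:Z + 1)).
rewrite eqm in e1; have nuE : nu%:Z = c%:Z - (mu %% c)%N%:Z by rewrite /nu; move: e4; clear; lia.
have e1' : i%:Z + nu%:Z * j%:Z = ((i + nu * j) %/ c)%N%:Z * c%:Z + ((i' + nu * j') %% c)%N%:Z.
  by rewrite -!PoszM -!PoszD -e1.
have e2' : i'%:Z + nu%:Z * j'%:Z = ((i' + nu * j') %/ c)%N%:Z * c%:Z + ((i' + nu * j') %% c)%N%:Z.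
  by rewrite -!PoszM -!PoszD -e2.
have e3' : mu%:Z = (mu %/ c)%N%:Z * c%:Z + (mu %% c)%N%:Z by rewrite -!PoszM -!PoszD -e3.
move: e1' e2' e3' nuE; clear.
move: ((i + nu * j) %/ c)%N ((i' + nu * j') %/ c)%N ((i' + nu * j') %% c)%N (mu %/ c)%N (mu %% c)%N.
move=> a b w u z; move: (nat_of_ord i) (nat_of_ord j) (nat_of_ord i') (nat_of_ord j') => I J I' J'.
move=> h1 h2 h3 h4; rewrite h3; rewrite h4 in h1 h2.
have -> : I%:Z = a%:Z * c%:Z + w%:Z - (c%:Z - z%:Z) * J%:Z by rewrite -h1; ring.
have -> : I'%:Z = b%:Z * c%:Z + w%:Z - (c%:Z - z%:Z) * J'%:Z by rewrite -h2; ring.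
ring.
Qed.

(* Guarantees that the squares produced below are not [0]. *)
Lemma combination_eq0 (q1 q2 X1 X2 : nat) (x1 x2 : int) : coprime q1 q2 -> (X1 < q1)%N -> (X2 < q2)%N ->
  `|x1| <= X1%:Z -> `|x2| <= X2%:Z -> x1 * q1%:Z + x2 * q2%:Z = 0 -> x1 = 0 /\ x2 = 0.
Proof.
move=> co h1 h2 b1 b2 /eqP; rewrite addr_eq0 => /eqP e.
have q10 : (0 < q1)%N by apply: leq_ltn_trans h1.
have q20 : (0 < q2)%N by apply: leq_ltn_trans h2.
have eN : (`|x1| * q1 = `|x2| * q2)%N.
  by have := congr1 absz e; rewrite abszN !abszM.
have [x10|x10] := eqVneq x1 0.
  split=> //; move: e; rewrite x10 mul0r => /esym/eqP; rewrite oppr_eq0 mulf_eq0.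
  by case/orP => /eqP // []; move: q20; clear; lia.
have d1 : (q2 %| `|x1|)%N by rewrite -(@Gauss_dvdl _ _ q1) 1?coprime_sym // eN dvdn_mull.
have a10 : (0 < `|x1|)%N by rewrite absz_gt0.
have a20 : (0 < `|x2|)%N by move: a10 eN q10; clear; nia.
have d2 : (q1 %| `|x2|)%N by rewrite -(@Gauss_dvdl _ _ q2) // -eN dvdn_mull.
have := dvdn_leq a10 d1; have := dvdn_leq a20 d2.
by move: b1 b2 h1 h2; clear; lia.
Qed.

Lemma sqr_congr_form (c mu a : nat) (m e k : int) : (mu ^ 2 = a %[mod c])%N ->
  m = mu%:Z * e + c%:Z * k -> exists j : int, m ^+ 2 = a%:Z * e ^+ 2 + c%:Z * j.
Proof.
move=> muE mE.
have e1 := divn_eq (mu ^ 2) c; have e2 := divn_eq a c; rewrite muE in e1.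
have e3 : mu%:Z ^+ 2 = a%:Z + c%:Z * ((mu ^ 2 %/ c)%N%:Z - (a %/ c)%N%:Z).
  have : (mu ^ 2)%N%:Z = (mu ^ 2 %/ c)%N%:Z * c%:Z + (a %% c)%N%:Z by rewrite -!PoszM -!PoszD -e1.
  have : a%:Z = (a %/ c)%N%:Z * c%:Z + (a %% c)%N%:Z by rewrite -!PoszM -!PoszD -e2.
  rewrite -mulnn !PoszM; move: (_ %/ _)%N (_ %/ _)%N (_ %% _)%N; clear=> x y w.
  by move=> h1 h2; rewrite expr2 h2 h1; ring.
exists (((mu ^ 2 %/ c)%N%:Z - (a %/ c)%N%:Z) * e ^+ 2 + 2%:R * mu%:Z * e * k + c%:Z * k ^+ 2).
rewrite mE; move: e3; move: (_ - _) => w e3.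
by rewrite sqrrD exprMn e3; ring.
Qed.

(** The coefficients are [x1 = d (h e) ^ 2] and [x2 = j] with [c j = m ^ 2 - d q1 e ^ 2]. Since
    [q2 j] is a difference of two numbers between [0] and [q2 X2], no factor is lost in bounding
    [j]. *)
Lemma has_square_generator (q1 q2 X1 X2 h c d mu M E : nat) : coprime q1 q2 -> (X1 < q1)%N -> (X2 < q2)%N ->
  (0 < d)%N -> q2 = (h ^ 2 * c)%N -> (mu ^ 2 = d * q1 %[mod c])%N ->
  (c < M.+1 * E.+1)%N -> (M ^ 2 <= c * X2)%N -> (d * h ^ 2 * E ^ 2 <= X1)%N ->
  (q1 * (d * h ^ 2 * E ^ 2) <= q2 * X2)%N -> has_square q1 q2 X1 X2.
Proof.
move=> co lt1 lt2 d0 q2E muE cME hM hE hE2.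
have q20 : (0 < q2)%N by apply: leq_ltn_trans lt2.
have h0 : (0 < h)%N by move: q20; rewrite q2E; case: (h).
have c0 : (0 < c)%N by move: q20; rewrite q2E muln_gt0 => /andP[].
have [m [e [ne mM eE [k mE]]]] := thue mu c0 cME.
have [j] := sqr_congr_form muE mE; rewrite PoszM => jE.
exists (d%:Z * (h%:Z * e) ^+ 2), j, (h%:Z * m).
have b1 : `|d%:Z * (h%:Z * e) ^+ 2| <= X1%:Z.
  rewrite sqr_absz_scaled ger0_norm // lez_nat; apply: leq_trans hE.
  by rewrite leq_mul2l leq_exp2r // absz_le ?orbT.
have b2 : `|j| <= X2%:Z.
  have q2j : q2%:Z * j = (h%:Z * m) ^+ 2 - q1%:Z * (d%:Z * (h%:Z * e) ^+ 2).
    by rewrite q2E PoszM -mulnn PoszM exprMn jE; ring.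
  have u1 : 0 <= (h%:Z * m) ^+ 2 <= q2%:Z * X2%:Z.
    rewrite sqr_ge0 /= -[(h%:Z * m) ^+ 2]mul1r -[1]/(1%:Z) sqr_absz_scaled mul1n -PoszM lez_nat.
    rewrite q2E -mulnA leq_mul2l; apply/orP; right.
    by apply: leq_trans hM; rewrite leq_exp2r // absz_le.
  have u2 : 0 <= q1%:Z * (d%:Z * (h%:Z * e) ^+ 2) <= q2%:Z * X2%:Z.
    rewrite sqr_absz_scaled -!PoszM lez_nat /=; apply: leq_trans hE2; rewrite leq_mul2l; apply/orP; right.
    by rewrite leq_mul2l leq_exp2r // absz_le ?orbT.
  move: q2j u1 u2; move: (_ ^+ 2) (_ * (_ * _)) => a b; move: q20; clear; nia.
split => //; last first.
  by rewrite !exprMn jE q2E PoszM -mulnn PoszM; ring.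
apply: contraTneq ne => /eqP; rewrite mulf_eq0 => /orP[/eqP[]|/eqP m0]; first by move: h0; clear; lia.
have [z1 _] : d%:Z * (h%:Z * e) ^+ 2 = 0 /\ j = 0.
  apply: (combination_eq0 co lt1 lt2 b1 b2).
  have -> : 0 = (h%:Z * m) ^+ 2 by rewrite m0 mulr0 expr0n.
  by rewrite !exprMn jE q2E PoszM -mulnn PoszM; ring.
move: z1 => /eqP; rewrite m0 eqxx /= mulf_eq0 expf_eq0 /= mulf_eq0.
by case/or3P => /eqP z; move: d0 h0; rewrite ?z; [case: z => ->|case: z => ->|rewrite eqxx].
Qed.

(** With [w = (h m) ^ 2] and [z = d (h e) ^ 2], the square is [w = j r + z q2], so the coefficients
    are [j] and [v j + z], where [r j = w - q2 z] and [r (v j + z) = v w + q1 z]. In both, half of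
    the room goes to [w <= r Y / 2] and half to [z <= v X1 / 2]; [X1 q1 <= X2 q2] serves the
    second. *)
Lemma has_square_combination (q1 q2 X1 X2 v Y h c d mu M E : nat) :
  coprime q1 q2 -> (X1 < q1)%N -> (X2 < q2)%N -> (0 < v)%N ->
  (0 < d)%N -> (q1 + v * q2 = h ^ 2 * c)%N -> (mu ^ 2 = d * q2 %[mod c])%N ->
  (c < M.+1 * E.+1)%N -> (2 * M ^ 2 <= c * Y)%N -> (Y <= X1)%N -> (v * Y <= X2)%N ->
  (2 * (d * h ^ 2 * E ^ 2) <= v * X1)%N -> (X1 * q1 <= X2 * q2)%N ->
  has_square q1 q2 X1 X2.
Proof.
move=> co lt1 lt2 v0 d0 rE muE cME hM YX vYX hE X12.
have q10 : (0 < q1)%N by apply: leq_ltn_trans lt1.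
have q20 : (0 < q2)%N by apply: leq_ltn_trans lt2.
set r := (q1 + v * q2)%N in rE; have r0 : (0 < r)%N by rewrite /r addn_gt0 q10.
have h0 : (0 < h)%N by move: r0; rewrite rE; case: (h).
have c0 : (0 < c)%N by move: r0; rewrite rE muln_gt0 => /andP[].
have [m [e [ne mM eE [k mE]]]] := thue mu c0 cME.
have [j jE] := sqr_congr_form muE mE.
pose z := (d * h ^ 2 * absz e ^ 2)%N.
have zE : z%:Z = d%:Z * h%:Z ^+ 2 * e ^+ 2 by rewrite /z -sqr_absz_scaled exprMn mulrA.
pose w := (h ^ 2 * absz m ^ 2)%N.
have wE : w%:Z = h%:Z ^+ 2 * m ^+ 2 by rewrite -exprMn -[RHS]mul1r (sqr_absz_scaled 1) mul1n.
have zle : (2 * z <= v * X1)%N.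
  by apply: leq_trans hE; rewrite /z !leq_mul2l leq_exp2r // absz_le ?orbT.
have wle : (2 * w <= r * Y)%N.
  rewrite rE /w mulnCA -mulnA leq_mul2l; apply/orP; right; apply: leq_trans hM.
  by rewrite leq_mul2l leq_exp2r // absz_le ?orbT.
have x1E : r%:Z * j = w%:Z - q2%:Z * z%:Z.
  by rewrite rE wE zE jE PoszM -mulnn !PoszM; ring.
have x2E : r%:Z * (v%:Z * j + z%:Z) = v%:Z * w%:Z + q1%:Z * z%:Z.
  by rewrite mulrDr mulrCA x1E /r PoszD PoszM; ring.
have b1 : `|j| <= X1%:Z.
  have h1 : (2 * (q2 * z) <= r * X1)%N.
    apply: leq_trans (_ : q2 * (v * X1) <= _)%N; first by rewrite mulnCA leq_mul2l zle orbT.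
    by rewrite mulnA leq_mul2r /r [(q2 * v)%N]mulnC leq_addl orbT.
  have h2 : (2 * w <= r * X1)%N by apply: leq_trans wle _; rewrite leq_mul2l YX orbT.
  move: x1E h1 h2 r0; rewrite -!PoszM; move: (q2 * z)%N => u; clear; nia.
have b2 : `|v%:Z * j + z%:Z| <= X2%:Z.
  have h1 : (2 * (q1 * z) <= r * X2)%N.
    apply: leq_trans (_ : q1 * (v * X1) <= _)%N; first by rewrite mulnCA leq_mul2l zle orbT.
    apply: leq_trans (_ : v * (X2 * q2) <= _)%N; last by rewrite /r mulnDl mulnA [(v * q2 * X2)%N]mulnAC leq_addl.
    by rewrite mulnCA leq_mul2l [(q1 * X1)%N]mulnC X12 orbT.
  have h2 : (2 * (v * w) <= r * X2)%N.
    apply: leq_trans (_ : v * (r * Y) <= _)%N; first by rewrite mulnCA leq_mul2l wle orbT.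
    by rewrite mulnCA leq_mul2l vYX orbT.
  move: x2E h1 h2 r0; rewrite -!PoszM; move: (q1 * z)%N (v * w)%N (_ + _) => u u' x; clear; nia.
have sol : j * q1%:Z + (v%:Z * j + z%:Z) * q2%:Z = (h%:Z * m) ^+ 2.
  have -> : j * q1%:Z + (v%:Z * j + z%:Z) * q2%:Z = r%:Z * j + q2%:Z * z%:Z.
    by rewrite /r PoszD PoszM; ring.
  by rewrite x1E subrK wE exprMn.
exists j, (v%:Z * j + z%:Z), (h%:Z * m); split => //.
apply: contraTneq ne => /eqP; rewrite mulf_eq0 => /orP[/eqP[]|/eqP m0]; first by move: h0; clear; lia.
rewrite m0 mulr0 expr0n /= in sol.
have [j0] := combination_eq0 co lt1 lt2 b1 b2 sol; rewrite j0 mulr0 add0r => - [] z0.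
by rewrite m0 eqxx /= -absz_eq0; move: z0; rewrite /z; move: d0 h0; clear; case: (absz e) => // a; lia.
Qed.

Lemma sqrt_exists (a b : nat) : (0 < b)%N -> exists M, (b * M ^ 2 <= a)%N /\ (a < b * M.+1 ^ 2)%N.
Proof.
move=> b0; have [M /andP[h1 h2]] := sqrt_nat (a %/ b)%N; exists M; split.
  by apply: leq_trans (leq_trunc_div a b); rewrite mulnC leq_mul2r h1 orbT.
by move: h2; rewrite ltn_divLR // mulnC.
Qed.

Lemma sqr_lt_of (c x y : nat) : (c ^ 2 < x ^ 2 * y ^ 2)%N -> (c < x * y)%N.
Proof. by rewrite -expnMn ltn_exp2r. Qed.

(** [M] and [E] are taken maximal, about [sqrt (c Y / 2)] and [sqrt (v X1 / (2 D h ^ 2))]; the last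
    hypothesis then yields Thue's condition [c < (M + 1) (E + 1)]. *)
Lemma has_square_combination_class (q1 q2 X1 X2 v Y h c d mu D : nat) :
  coprime q1 q2 -> (X1 < q1)%N -> (X2 < q2)%N -> (0 < v)%N ->
  (0 < d <= D)%N -> (q1 + v * q2 = h ^ 2 * c)%N -> (mu ^ 2 = d * q2 %[mod c])%N ->
  (Y <= X1)%N -> (v * Y <= X2)%N -> (X1 * q1 <= X2 * q2)%N ->
  (4 * D * (q1 + v * q2) <= Y * (v * X1))%N -> has_square q1 q2 X1 X2.
Proof.
move=> co lt1 lt2 v0 /andP[d0 dD] rE muE YX vYX X12 big.
have q10 : (0 < q1)%N by apply: leq_ltn_trans lt1.
have r0 : (0 < h ^ 2 * c)%N by rewrite -rE addn_gt0 q10.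
have [h0 c0] : (0 < h ^ 2)%N /\ (0 < c)%N by apply/andP; rewrite -muln_gt0.
have D0 : (0 < D)%N by apply: leq_trans dD.
have Dh a : (0 < a)%N -> (0 < a * h ^ 2)%N by move=> a0; rewrite muln_gt0 a0.
have [M [M1 M2]] := @sqrt_exists (c * Y) 2 isT.
have [E [E1 E2]] := sqrt_exists (v * X1) (Dh (2 * D)%N (ltac:(by rewrite muln_gt0 D0))).
apply: (@has_square_combination _ _ _ _ _ _ _ _ _ _ M E co lt1 lt2 v0 d0 rE muE _ M1 YX vYX _ X12).
  apply: sqr_lt_of; have g : (0 < 4 * D * h ^ 2)%N by apply: Dh; rewrite muln_gt0 D0.
  rewrite -(ltn_pmul2l g).
  have K1 : (4 * D * h ^ 2 * c ^ 2 <= (c * Y) * (v * X1))%N.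
    have : (c * (4 * D * (q1 + v * q2)) <= c * (Y * (v * X1)))%N by rewrite leq_mul2l big orbT.
    by rewrite rE -mulnn; move: (h ^ 2)%N => H; clear; lia.
  apply: leq_ltn_trans K1 _.
  apply: leq_trans (_ : (2 * M.+1 ^ 2) * (2 * D * h ^ 2 * E.+1 ^ 2) <= _)%N.
    by apply: ltn_mul.
  rewrite eq_leq //; move: (M.+1 ^ 2)%N (E.+1 ^ 2)%N (h ^ 2)%N => a b e; clear; lia.
apply: leq_trans E1; rewrite -!mulnA leq_mul2l /= leq_mul2r.
by rewrite dD orbT.
Qed.

(** [E] is subject to two upper bounds, combined in [Z], the minimum of [X1] and [q2 X2 / q1]; the
    two hypotheses on [D] give Thue's condition in the two cases of the minimum. *)
Lemma has_square_generator_class (q1 q2 X1 X2 h c d mu D : nat) :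
  coprime q1 q2 -> (X1 < q1)%N -> (X2 < q2)%N ->
  (0 < d <= D)%N -> (q2 = h ^ 2 * c)%N -> (mu ^ 2 = d * q1 %[mod c])%N ->
  (D * q2 <= X1 * X2)%N -> (D * q1 <= X2 ^ 2)%N -> has_square q1 q2 X1 X2.
Proof.
move=> co lt1 lt2 /andP[d0 dD] rE muE big1 big2.
have q10 : (0 < q1)%N by apply: leq_ltn_trans lt1.
have q20 : (0 < q2)%N by apply: leq_ltn_trans lt2.
have r0 : (0 < h ^ 2 * c)%N by rewrite -rE.
have [h0 c0] : (0 < h ^ 2)%N /\ (0 < c)%N by apply/andP; rewrite -muln_gt0.
have D0 : (0 < D)%N by apply: leq_trans dD.
have Dh a : (0 < a)%N -> (0 < a * h ^ 2)%N by move=> a0; rewrite muln_gt0 a0.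
have [M [M1 M2]] := @sqrt_exists (c * X2) 1 isT; rewrite !mul1n in M1 M2.
pose Z := minn X1 (q2 * X2 %/ q1).
have [E [E1 E2]] := sqrt_exists Z (Dh D D0).
have Z1 : (D * q2 <= X2 * Z.+1)%N.
  rewrite /Z /minn; case: ifP => _.
    by apply: leq_trans big1 _; rewrite mulnC leq_mul2l leqnSn orbT.
  rewrite -(leq_pmul2r q10) -[X in (_ <= X)%N]mulnA.
  apply: leq_trans (_ : X2 * (q2 * X2) <= _)%N.
    rewrite mulnAC -mulnn in big2 *; move: big2; clear; nia.
  by rewrite leq_mul2l; apply/orP; right; apply/ltnW; rewrite ltn_ceil.
have dE : (d * h ^ 2 * E ^ 2 <= Z)%N.
  by apply: leq_trans E1; rewrite -!mulnA leq_mul2r dD orbT.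
apply: (@has_square_generator _ _ _ _ _ _ _ _ M E co lt1 lt2 d0 rE muE _ M1).
- apply: sqr_lt_of; have g : (0 < D * h ^ 2)%N by exact: Dh.
  rewrite -(ltn_pmul2l g).
  have K1 : (D * h ^ 2 * c ^ 2 <= (c * X2) * Z.+1)%N.
    have : (c * (D * q2) <= c * (X2 * Z.+1))%N by rewrite leq_mul2l Z1 orbT.
    by rewrite rE -mulnn; move: (h ^ 2)%N => H; clear; lia.
  apply: leq_ltn_trans K1 _.
  apply: leq_trans (_ : M.+1 ^ 2 * (D * h ^ 2 * E.+1 ^ 2) <= _)%N; last by rewrite eq_leq //; move: (M.+1 ^ 2)%N (E.+1 ^ 2)%N (h ^ 2)%N => a b e; clear; lia.
  apply: leq_trans (_ : M.+1 ^ 2 * Z.+1 <= _)%N; first by rewrite ltn_pmul2r.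
  by rewrite leq_mul2l E2 orbT.
- by apply: leq_trans dE _; rewrite geq_minl.
apply: leq_trans (_ : q1 * Z <= _)%N; first by rewrite leq_mul2l dE orbT.
apply: leq_trans (_ : q1 * (q2 * X2 %/ q1) <= _)%N; first by rewrite leq_mul2l geq_minr orbT.
by rewrite mulnC leq_trunc_div.
Qed.

End Geometry.

(** * The long and the short case, and the count for integer sides *)

Section Cases.
Local Open Scope ring_scope.

Lemma cond_dvd v n : uniq v -> all prime v -> (forall p, p \in v -> (p %| n)%N) -> (cond v %| n)%N.
Proof.
elim: v => [|p v IH] /=; first by rewrite /cond big_nil dvd1n.
move=> /andP[pv uv] /andP[pp pvs] H; rewrite cond_cons Gauss_dvd ?coprime_cond //.
rewrite H ?mem_head //=; apply: IH => // q qv; apply: H; by rewrite inE qv orbT.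
Qed.

(** [R] bounds [2 ^ size so], the number of characters in the expansion of [class_exists]; if all
    nonprincipal sums are below [D / R], that lemma applies. *)
Lemma class_or_large (r q D R : nat) : (0 < r)%N -> (0 < D)%N -> (0 < R)%N ->
  (forall y, (y %| r)%N -> (tau y <= R)%N) ->
  (exists h c d mu, [/\ (0 < d <= D)%N, r = (h ^ 2 * c)%N & (mu ^ 2 = d * q %[mod c])%N]) \/
  (exists s, [/\ uniq s, all oddprime s, s != [::], (cond s %| r)%N &
     D%:R <= R%:R * `|\sum_(d < D) psi s d.+1|]).
Proof.
move=> r0 D0 R0 HR.
have [|no] := pselect (exists s, [/\ uniq s, all oddprime s, s != [::], (cond s %| r)%N &
     D%:R <= R%:R * `|\sum_(d < D) psi s d.+1|]); first by right.
left; have [h [s [us ps rE]]] := squarefree_decomp r0.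
have cr : (cond s %| r)%N by rewrite rE dvdn_mull.
(* Modulo [2] everything is a square, so only odd primes impose a condition. *)
pose so := [seq p <- s | odd p].
have uso : uniq so by rewrite filter_uniq.
have oso : all oddprime so.
  by apply/allP => p; rewrite mem_filter /oddprime => /andP[-> /(allP ps) ->].
have sub_dvd v : uniq v -> {subset v <= so} -> (cond v %| r)%N.
  move=> uv sv; have sv' p : p \in v -> p \in s by move=> /sv; rewrite mem_filter => /andP[].
  apply: cond_dvd => //; first by apply/allP => p /sv' /(allP ps).
  by move=> p /sv' /dvdn_cond h1; exact: dvdn_trans h1 cr.
have [|||d [dD dE]] := @class_exists so q D ((D.-1 %/ R)%N%:Z) uso oso.
- by [].
- move=> v v0 uv sv; rewrite leNgt; apply/negP => big; apply: no; exists v; split=> //.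
  + by apply/allP => p /sv /(allP oso).
  + exact: sub_dvd.
  + have := ltn_ceil D.-1 R0; rewrite prednK // => h1.
    apply: le_trans (_ : (((D.-1 %/ R).+1) * R)%:R <= _); first by rewrite ler_nat.
    rewrite mulnC natrM; apply: ler_wpM2l; first exact: ler0n.
    by move: big; clear; lia.
- apply: le_lt_trans (_ : D.-1%:R < _); last by rewrite ltr_nat prednK.
  apply: le_trans (_ : (R * (D.-1 %/ R))%:R <= _); last by rewrite ler_nat mulnC leq_trunc_div.
  rewrite natrM [X in _ <= _ * X]natz -natrX; apply: ler_wpM2r => //; rewrite ler_nat.
  apply: leq_trans (tau_cond uso (oddprime_prime oso)) (HR _ _).
  exact: sub_dvd.
have [mu muE] : exists m, (m ^ 2 = d * q %[mod cond s])%N.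
  apply: sqr_mod_cond => // p pins; have [op|np] := boolP (odd p).
    have pso : p \in so by rewrite mem_filter op.
    by apply: chi_ge0_sqr; [exact: (allP oso)|exact: dE].
  exists (d * q)%N; have -> : p = 2%N.
    have pp := allP ps p pins; case: (even_prime pp) => // op; by rewrite op in np.
  by rewrite !modn2 oddX.
by exists h, (cond s), d, mu.
Qed.

(** [R] is the maximum of [tau] on the range rather than [t] itself: the contradictions come from
    comparing [t] with a power of [R]. *)
Lemma uniform_tau (N k t : nat) : (0 < N)%N -> (0 < k)%N ->
  (forall y, (0 < y <= N)%N -> (tau y ^ k <= t)%N) ->
  exists R, [/\ (0 < R)%N, forall y, (0 < y <= N)%N -> (tau y <= R)%N & (R ^ k <= t)%N].
Proof.
move=> N0 k0 H; exists (\max_(y < N) tau y.+1)%N.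
have ub y : (0 < y <= N)%N -> (tau y <= \max_(y < N) tau y.+1)%N.
  case: y => // y /= yN; exact: (leq_bigmax (Ordinal yN)).
split=> //.
  by apply: leq_trans (ub 1%N _) => //; rewrite N0.
elim/big_ind: _ => [|x y hx hy|y _]; first by rewrite exp0n.
  by rewrite /maxn; case: ifP.
by apply: H; rewrite ltn_ord.
Qed.

Lemma has_square_both_long (n : nat) : exists t0, forall t q1 q2 X1 X2 : nat, (t0 <= t)%N ->
  coprime q1 q2 -> (X1 < q1)%N -> (X2 < q2)%N ->
  (X1 * q1 <= X2 * q2)%N -> (X2 * q2 <= t ^ (27 * n))%N ->
  (t ^ (20 * n + 3) <= X1 * X2)%N ->
  (4 * t ^ (7 * n + 1) <= X1)%N -> (4 * t ^ (7 * n + 1) <= X2)%N ->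
  has_square q1 q2 X1 X2.
Proof.
(* With [T = t ^ (27 * n)] and [D = t ^ 2], [D ^ l = T ^ 2 t ^ 4] exceeds [t (2 T) ^ 2], the length
   required for [t] characters of conductor up to [2 T]. The exponent [6 * l] makes [R ^ (3 * l)] at
   most [sqrt t]. *)
pose l := (27 * n + 2)%N; have M0 : (0 < 2 * l)%N by rewrite /l; lia.
have [t1 H1] := tau_small (6 * l) M0.
exists (t1 + 16)%N => t q1 q2 X1 X2 tt co lt1 lt2 X12 X2T N X1l X2l.
have [//|nosq] := pselect (has_square q1 q2 X1 X2); exfalso.
have t16 : (16 <= t)%N by apply: leq_trans tt; rewrite leq_addl.
have t0 : (0 < t)%N by apply: leq_trans t16.
have tp k : (0 < t ^ k)%N by rewrite expn_gt0 t0.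
have q10 : (0 < q1)%N by apply: leq_ltn_trans lt1.
have q20 : (0 < q2)%N by apply: leq_ltn_trans lt2.
(* [v] runs over the [t] values [V - i], where [V] is the largest with [V Y <= X2]; [4 t <= V] keeps
   them all comparable with [X2 / Y]. *)
pose D := (t ^ 2)%N; pose Y := (t ^ (7 * n))%N; pose V := (X2 %/ Y)%N.
have X10 : (0 < X1)%N by apply: leq_trans X1l; rewrite muln_gt0 tp.
have X20 : (0 < X2)%N by apply: leq_trans X2l; rewrite muln_gt0 tp.
have YX : (t ^ (7 * n + 1) = t * Y)%N by rewrite addn1 expnS.
have V4 : (4 * t <= V)%N.
  by rewrite /V leq_divRL ?tp // -mulnA -YX.
have VY : (V * Y <= X2)%N by exact: leq_trunc_div.
have VY2 : (X2 < V.+1 * Y)%N by apply: ltn_ceil; exact: tp.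
have NN : (0 < D ^ l)%N by rewrite /D -expnM.
have k0 : (0 < 6 * l)%N by rewrite /l; lia.
have [|R [R0 Rtau Rt]] := @uniform_tau (D ^ l) (6 * l) t NN k0.
  move=> y /andP[y0 yN]; apply: H1 => //; first by apply: leq_trans tt; rewrite leq_addr.
  by rewrite expnM.
pose r (i : 'I_t) := (q1 + (V - i) * q2)%N.
have T27 : (t ^ (54 * n + 4) = D ^ l)%N by rewrite /D -expnM /l; congr (_ ^ _)%N; lia.
have T27' : (t ^ (54 * n) = (t ^ (27 * n)) ^ 2)%N by rewrite -expnM; congr (_ ^ _)%N; lia.
set T := (t ^ (27 * n))%N in X2T T27'.
have T0 : (0 < T)%N by exact: tp.
have DlE : (D ^ l = T ^ 2 * t ^ 4)%N by rewrite -T27 expnD T27'.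
have q1T : (q1 <= T)%N.
  by apply: leq_trans X2T; apply: leq_trans X12; rewrite leq_pmull.
have rT i : (r i <= 2 * T)%N.
  rewrite mul2n -addnn leq_add //; apply: leq_trans X2T; rewrite leq_mul2r.
  apply/orP; right; apply: leq_trans (leq_subr _ _) _; apply: leq_trans VY.
  by rewrite leq_pmulr // tp.
have r0 i : (0 < r i)%N by rewrite addn_gt0 q10.
have rN i : (r i <= D ^ l)%N.
  apply: leq_trans (rT i) _; rewrite DlE -mulnn.
  have : (16 <= t ^ 4)%N by apply: leq_trans t16 _; rewrite -{1}[t]expn1 leq_pexp2l.
  by move: T0; move: (t ^ 4)%N; clear; nia.
have big i : (4 * D * r i <= Y * ((V - i) * X1))%N.
  have it := ltn_ord i.
  have v2 : (X2 <= 2 * ((V - i) * Y))%N.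
    apply: leq_trans (ltnW VY2) _; rewrite mulnA leq_mul2r; apply/orP; right.
    by move: it V4 t16; clear; lia.
  have tD : (16 * D * T <= t ^ (20 * n + 3) * Y)%N.
    have -> : (t ^ (20 * n + 3) * Y = t * D * T)%N.
      by rewrite /Y /T /D -expnS -!expnD; congr (_ ^ _)%N; lia.
    by apply: leq_mul => //; apply: leq_mul.
  have NY : (16 * D * T <= X1 * X2 * Y)%N by apply: leq_trans tD _; rewrite leq_mul2r N orbT.
  have h1 : (8 * D * q2 <= Y * X1)%N.
    rewrite -(leq_pmul2r X20); apply: leq_trans (_ : 16 * D * T <= _)%N; last by apply: leq_trans NY _; rewrite eq_leq //; ring.
    rewrite -mulnA [(q2 * X2)%N]mulnC; apply: leq_mul => //; rewrite leq_mul2r; by rewrite orbT.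
  have h2 : (8 * D * q1 <= Y * ((V - i) * X1))%N.
    rewrite -(leq_pmul2r X10).
    apply: leq_trans (_ : 8 * D * T <= _)%N.
      by rewrite -mulnA leq_mul2l [(q1 * X1)%N]mulnC (leq_trans X12 X2T) orbT.
    have YX1 : (Y <= X1)%N by apply: leq_trans X1l; rewrite YX; move: t0; clear; nia.
    have : (X1 * X2 * Y <= X1 * (2 * ((V - i) * Y)) * X1)%N.
      by apply: leq_mul => //; rewrite leq_mul2l v2 orbT.
    by move=> h3; move: (leq_trans NY h3); clear; move: (V - i)%N; lia.
  rewrite /r mulnDr -(leq_pmul2l (isT : 0 < 2)%N).
  have h3 : ((V - i) * (8 * D * q2) <= (V - i) * (Y * X1))%N by rewrite leq_mul2l h1 orbT.
  by move: h2 h3; rewrite -!mulnA; move: (V - i)%N => v; clear; nia.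
have lg i : exists s, [/\ uniq s, all oddprime s, s != [::], (cond s %| r i)%N &
     D%:R <= R%:R * `|\sum_(d < D) psi s d.+1|].
  have [|[h [c [d [mu [dD rE muE]]]]]|//] := @class_or_large (r i) q2 D R (r0 i) (tp 2%N) R0.
    move=> y yr; apply: Rtau; rewrite (dvdn_gt0 (r0 i) yr) /=.
    exact: leq_trans (dvdn_leq (r0 i) yr) (rN i).
  exfalso; apply: nosq; have it := ltn_ord i.
  have v0 : (0 < V - i)%N by move: it V4; clear; lia.
  apply: (has_square_combination_class co lt1 lt2 v0 dD rE muE _ _ X12 (big i)).
    apply: leq_trans X1l; rewrite YX; move: t0; clear; nia.
  by apply: leq_trans VY; rewrite leq_mul2r leq_subr orbT.
have {lg} [s sP] := fin_all_exists lg.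
have us i : uniq (s i) by case: (sP i).
have os i : all oddprime (s i) by case: (sP i).
have cr i : (cond (s i) %| r i)%N by case: (sP i).
have lg i : D%:R <= R%:R * `|\sum_(d < D) psi (s i) d.+1| by case: (sP i).
have l0 : (0 < l)%N by rewrite /l; lia.
have RR : (2 * R ^ (3 * l) < t)%N.
  have : ((R ^ (3 * l)) ^ 2 <= t)%N by rewrite -expnM; apply: leq_trans Rt; rewrite leq_pexp2l //; lia.
  by rewrite -mulnn; move: t16; move: (R ^ _)%N; clear; nia.
have Rlt : (R <= t)%N.
  by apply: leq_trans Rt; rewrite -{1}[R]expn1 leq_pexp2l.
(* [psi_sum_bound] bounds the sum by the conductor, so a nearly trivial sum forces a conductor of at
   least [D / R], hence at least [t]. *)
have ct i : (t <= cond (s i))%N.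
  have s0 : s i != [::] by case: (sP i).
  have := psi_sum_bound D (us i) (os i) s0 => h1.
  have : D%:R <= (R * cond (s i))%:R :> int.
    by apply: le_trans (lg i) _; rewrite natrM; apply: ler_wpM2l h1; exact: ler0n.
  rewrite ler_nat /D -mulnn => h2.
  have h3 : (t * t <= t * cond (s i))%N by apply: leq_trans h2 _; rewrite leq_mul2r Rlt orbT.
  by rewrite leq_pmul2l in h3.
have cP i : (cond (s i) <= 2 * T)%N by apply: leq_trans (dvdn_leq (r0 i) (cr i)) (rT i).
have sep i j : i != j -> exists p, (p \in s i) && (p \notin s j) || (p \in s j) && (p \notin s i).
  move=> ij; have [/allP h1|/allPn[p p1 p2]] := boolP (all (mem (s j)) (s i)); last by exists p; rewrite p1 p2.
  have [/allP h2|/allPn[p p1 p2]] := boolP (all (mem (s i)) (s j)); last by exists p; rewrite p1 p2 orbT.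
  exfalso; have pe : perm_eq (s i) (s j).
    by apply: uniq_perm => // p; apply/idP/idP => [/h1|/h2].
  have ce : cond (s i) = cond (s j) by exact: perm_big.
  have ci := cr i; have cj := cr j; rewrite -ce in cj.
  have cq2 : coprime (cond (s i)) q2.
    by apply: coprime_dvdl ci _; rewrite /r addnC coprime_sym /coprime gcdnMDl gcdnC.
  (* A common conductor would divide [r a - r b = (b - a) q2]; being coprime to [q2] and at least
     [t], it cannot. *)
  have dvd (a b : 'I_t) : (a < b)%N -> (cond (s i) %| r a)%N -> (cond (s i) %| r b)%N -> False.
    move=> ab ha hb; have e : (r a = (b - a) * q2 + r b)%N.
      rewrite /r addnCA -mulnDl; congr (_ + _ * _)%N; have := ltn_ord b; move: ab V4; clear; lia.
    move: ha; rewrite e dvdn_addl // Gauss_dvdl // => /dvdn_leq h3.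
    have := h3 ltac:(by rewrite subn_gt0); have := ct i; have := ltn_ord b; clear; lia.
  by case: (ltngtP i j) => [h|h|/val_inj h]; [exact: dvd h ci cj|exact: dvd h cj ci|rewrite h eqxx in ij].
have PN : (t * (2 * T) ^ 2 <= D ^ l)%N.
  rewrite DlE expnMn -[(2 ^ 2)%N]/4%N; have : (4 * t <= t ^ 4)%N.
    rewrite expnS [(4 * t)%N]mulnC leq_mul2l; apply/orP; right.
    apply: leq_trans (_ : t <= _)%N; first by apply: leq_trans t16.
    by rewrite -{1}[t]expn1 leq_pexp2l.
  by move: (t ^ 4)%N (T ^ 2)%N; clear; nia.
have := large_values_bound us os (tp 2%N) cP PN Rtau sep lg.
by rewrite leqNgt RR.
Qed.
(** [t ^ (13 * n + 1) <= X2] confines [q2], hence every conductor, to [t ^ (14 * n)], where Burgess'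
    bound handles sums of length [t ^ (6 * n)]; the same length is allowed by
    [D * q2 <= X1 * X2]. *)
Lemma has_square_one_short (n : nat) : (20 <= n)%N -> exists t0, forall t q1 q2 X1 X2 : nat, (t0 <= t)%N ->
  coprime q1 q2 -> (X1 < q1)%N -> (X2 < q2)%N ->
  (X1 * q1 <= t ^ (27 * n))%N -> (X2 * q2 <= t ^ (27 * n))%N ->
  (t ^ (20 * n + 3) <= X1 * X2)%N -> (X1 < 4 * t ^ (7 * n + 1))%N ->
  has_square q1 q2 X1 X2.
Proof.
move=> n20; have M0 : (0 < 14 * n)%N by move: n20; clear; lia.
have [t1 H1] := tau_small 2 M0; have [t2 H2] := burgess_bound n20.
exists (t1 + t2 + 16)%N => t q1 q2 X1 X2 tt co lt1 lt2 X1T X2T N X1s.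
have t16 : (16 <= t)%N by apply: leq_trans tt; rewrite leq_addl.
have t0 : (0 < t)%N by apply: leq_trans t16.
have tp k : (0 < t ^ k)%N by rewrite expn_gt0 t0.
have q10 : (0 < q1)%N by apply: leq_ltn_trans lt1.
have q20 : (0 < q2)%N by apply: leq_ltn_trans lt2.
have X12 : (0 < X1 * X2)%N by apply: leq_trans N.
have [X10 X20] : (0 < X1)%N /\ (0 < X2)%N by apply/andP; rewrite -muln_gt0.
have X2l : (t ^ (13 * n + 1) <= X2)%N.
  rewrite -(leq_pmul2l (tp (7 * n + 2)%N)) -expnD.
  rewrite [(_ + (13 * n + 1))%N](_ : _ = 20 * n + 3)%N; last by clear; lia.
  apply: leq_trans N _; rewrite leq_mul2r; apply/orP; right; apply: leq_trans (ltnW X1s) _.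
  have -> : (t ^ (7 * n + 2) = t * t ^ (7 * n + 1))%N by rewrite -expnS; congr (_ ^ _)%N; clear; lia.
  rewrite leq_mul2r; apply/orP; right; exact: leq_trans t16.
have q2T : (q2 <= t ^ (14 * n))%N.
  rewrite -(leq_pmul2l (tp (13 * n)%N)) -expnD -mulnDl.
  apply: leq_trans X2T; rewrite leq_mul2r; apply/orP; right; apply: leq_trans X2l.
  by rewrite leq_pexp2l // leq_addr.
have [|R [R0 Rtau Rt]] := @uniform_tau (t ^ (14 * n)) 2 t (tp _) isT.
  move=> y /andP[y0 yN]; apply: H1 => //; by apply: leq_trans tt; rewrite -addnA leq_addr.
have Rlt : (R < t)%N by move: Rt t16; rewrite -mulnn; clear; nia.
have [|[h [c [d [mu [dD rE muE]]]]]|] := @class_or_large q2 q1 (t ^ (6 * n)) R q20 (tp _) R0.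
- move=> y yq; apply: Rtau; rewrite (dvdn_gt0 q20 yq) /=.
  exact: leq_trans (dvdn_leq q20 yq) q2T.
- apply: (has_square_generator_class co lt1 lt2 dD rE muE).
    apply: leq_trans N; apply: leq_trans (_ : t ^ (6 * n) * t ^ (14 * n) <= _)%N.
      by rewrite leq_mul2l q2T orbT.
    by rewrite -expnD leq_pexp2l //; clear; lia.
  (* Multiplying by [X1] brings in the bound for [X1 q1]; in exponents, [6 + 27 <= 13 + 20]. *)
  rewrite -(leq_pmul2r X10); apply: leq_trans (_ : t ^ (6 * n) * t ^ (27 * n) <= _)%N.
    by rewrite -mulnA leq_mul2l [(q1 * X1)%N]mulnC X1T orbT.
  apply: leq_trans (_ : t ^ (13 * n + 1) * t ^ (20 * n + 3) <= _)%N.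
    by rewrite -!expnD leq_pexp2l //; clear; lia.
  by rewrite -mulnn -mulnA; apply: leq_mul => //; rewrite [(X2 * X1)%N]mulnC.
case=> s [us os s0 cs lg]; exfalso.
have cT : (cond s <= t ^ (14 * n))%N by apply: leq_trans (dvdn_leq q20 cs) q2T.
have h := H2 t s _ us os s0 cT.
have {}h := h (leq_trans (leq_trans (leq_addl _ _) (leq_addr _ _)) tt).
have : (t ^ (6 * n))%:R * t%:R <= R%:R * (t ^ (6 * n))%:R :> int.
  apply: le_trans (_ : R%:R * `|\sum_(d < t ^ (6 * n)) psi s d.+1| * t%:R <= _).
    by apply: ler_wpM2r lg; exact: ler0n.
  by rewrite -mulrA; apply: ler_wpM2l h; exact: ler0n.
by rewrite -!natrM ler_nat mulnC leq_pmul2r // leqNgt Rlt.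
Qed.

(** [q1 <= X1] would put the square [q1 * q1] into the progression, so [X1 < q1], and likewise
    [X2 < q2]. This also settles a vanishing side, since the other one then satisfies
    [X ^ 2 <= t ^ (27 * n)]. For positive sides [2 X + 1 <= 3 X] explains the [9]. *)
Lemma count_bound (n : nat) : (20 <= n)%N -> exists t0, forall t q1 q2 X1 X2 : nat, (t0 <= t)%N ->
  (0 < q1)%N -> (0 < q2)%N -> coprime q1 q2 ->
  (X1 * q1 <= t ^ (27 * n))%N -> (X2 * q2 <= t ^ (27 * n))%N ->
  ~ has_square q1 q2 X1 X2 -> ((2 * X1 + 1) * (2 * X2 + 1) <= 9 * t ^ (20 * n + 3))%N.
Proof.
move=> n20; have [ta Ha] := has_square_both_long n; have [tb Hb] := has_square_one_short n20.
exists (ta + tb + 1)%N => t q1 q2 X1 X2 tt q10 q20 co X1T X2T nosq.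
have t0 : (0 < t)%N by apply: leq_trans tt; rewrite addn1.
have tat : (ta <= t)%N by apply: leq_trans tt; rewrite -addnA leq_addr.
have tbt : (tb <= t)%N by apply: leq_trans tt; rewrite addnAC leq_addl.
have co' : coprime q2 q1 by rewrite coprime_sym.
have lt1 : (X1 < q1)%N.
  rewrite ltnNge; apply/negP => h; apply: nosq; exists q1%:Z, 0, q1%:Z; split.
  - by rewrite ger0_norm // lez_nat.
  - by rewrite normr0.
  - by move: q10; case: (q1).
  - by rewrite mul0r addr0 expr2.
have lt2 : (X2 < q2)%N.
  rewrite ltnNge; apply/negP => h; apply: nosq; exists 0, q2%:Z, q2%:Z; split.
  - by rewrite normr0.
  - by rewrite ger0_norm // lez_nat.
  - by move: q20; case: (q2).
  - by rewrite mul0r add0r expr2.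
have small X q : (X < q)%N -> (X * q <= t ^ (27 * n))%N -> (X <= t ^ (20 * n + 3))%N.
  move=> h1 h2; rewrite -(@leq_exp2r _ _ 2) // -mulnn -expnM.
  apply: leq_trans (_ : X * q <= _)%N; first by rewrite leq_mul2l (ltnW h1) orbT.
  by apply: leq_trans h2 _; rewrite leq_pexp2l //; clear; lia.
have tp : (0 < t ^ (20 * n + 3))%N by rewrite expn_gt0 t0.
case: (posnP X1) => [X10|X10].
  by rewrite X10; have := small _ _ lt2 X2T; move: tp; clear; lia.
case: (posnP X2) => [X20|X20].
  by rewrite X20; have := small _ _ lt1 X1T; move: tp; clear; lia.
suff : (X1 * X2 < t ^ (20 * n + 3))%N by move: X10 X20; clear; nia.
rewrite ltnNge; apply/negP => N; have N' := N; rewrite [(X1 * X2)%N]mulnC in N'.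
case: (ltnP X1 (4 * t ^ (7 * n + 1))) => h1; first by apply: nosq; apply: (Hb t).
case: (ltnP X2 (4 * t ^ (7 * n + 1))) => h2.
  by apply/nosq/has_square_sym; apply: (Hb t).
case/orP: (leq_total (X1 * q1) (X2 * q2)) => h; first by apply: nosq; apply: (Ha t).
by apply/nosq/has_square_sym; apply: (Ha t).
Qed.
End Cases.

(** * Passage to real parameters *)

Local Open Scope classical_set_scope.
Local Open Scope ring_scope.

Lemma abs_le_truncn (R : realType) (X : R) (x : int) : 0 < X ->
  (`|x%:~R : R| <= X) = (`|x| <= (Num.truncn X)%:Z).
Proof.
by move=> X0; rewrite -intr_norm -abszE lez_nat Num.Theory.truncn_ge_nat //; exact: ltW.
Qed.

Lemma card_progression2_le (R : realType) (q1 q2 : nat) (X1 X2 : R) : 0 < X1 -> 0 < X2 ->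
  (#|` fset_set (progression2 q1 q2 X1 X2)| <=
     (2 * Num.truncn X1 + 1) * (2 * Num.truncn X2 + 1))%N.
Proof.
move=> X10 X20; pose ints (N : nat) := [seq (i : nat)%:Z - N%:Z | i <- iota 0 (2 * N + 1)].
have intsP (N : nat) (x : int) : `|x| <= N%:Z -> x \in ints N.
  move=> xN; apply/mapP; exists (absz (x + N%:Z)); last by move: xN; lia.
  by rewrite mem_iota; move: xN; lia.
pose s := [seq x1 * q1%:Z + x2 * q2%:Z | x1 <- ints (Num.truncn X1), x2 <- ints (Num.truncn X2)].
have -> : ((2 * Num.truncn X1 + 1) * (2 * Num.truncn X2 + 1))%N = size s.
  by rewrite size_allpairs !size_map !size_iota.
apply: uniq_leq_size; first exact: fset_uniq.
move=> a; rewrite in_fset_set; last exact: finite_progression2.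
rewrite inE => -[x1 [x2 [-> h1 h2]]].
by apply: allpairs_f; apply: intsP; rewrite -(@abs_le_truncn R).
Qed.

Theorem theorem1 (R : realType) (eps : R) (heps : 0 < eps) :
  exists C : R, 0 < C /\
    forall (q1 q2 : nat) (X1 X2 T : R),
      (0 < q1)%N -> (0 < q2)%N -> coprime q1 q2 ->
      0 < X1 -> 0 < X2 -> 1 <= T ->
      [set (a%:~R : R) | a in progression2 q1 q2 X1 X2] `<=` `[- T, T] ->
      ~ (exists a : int,
           [/\ progression2 q1 q2 X1 X2 a, a <> 0 & perfect_square a]) ->
      (#|` fset_set (progression2 q1 q2 X1 X2)|)%:R
        <= C * T `^ (20%:R / 27%:R + eps).
Proof.
(* The three spare powers of [t] cost [T ^ (3 / (27 n)) = T ^ (1 / (9 n))], which [1 / n <= eps]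
   absorbs. *)
pose n := (Num.truncn (eps^-1) + 20)%N.
have n20 : (20 <= n)%N by rewrite leq_addl.
have n0 : 0 < n%:R :> R by rewrite ltr0n; apply: leq_trans n20.
have neps : n%:R^-1 <= eps.
  rewrite -[eps]invrK lef_pV2 ?posrE ?invr_gt0 //.
  apply: ltW; apply: lt_le_trans (truncnS_gt _) _.
  by rewrite ler_nat /n addnS ltnS leq_addr.
have [t0 Ht0] := count_bound n20.
exists (9%:R * (t0 + 2)%:R ^+ (20 * n + 3)); split.
  by rewrite mulr_gt0 // exprn_gt0 // ltr0n addn2.
move=> q1 q2 X1 X2 T q10 q20 co X10 X20 T1 AT nosq.
have T0 : 0 <= T by apply: le_trans T1.
pose a := T `^ (27 * n)%:R^-1.
have a1 : 1 <= a by rewrite -(powRr0 T); apply: ler_powR => //; rewrite invr_ge0 ler0n.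
have a0 : 0 <= a by apply: le_trans a1.
have aT : a ^+ (27 * n) = T.
  rewrite -powR_mulrn // /a -powRrM mulVf ?powRr1 //.
  by rewrite pnatr_eq0 muln_eq0 /= -lt0n; apply: leq_trans n20.
(* Adding [t0] makes [t] large enough for every [T >= 1]; it costs only the constant factor
   [(t0 + 2) ^ (20 n + 3)]. *)
pose t := (t0 + (Num.truncn a).+1)%N.
have at_ : a <= t%:R.
  by apply: ltW; apply: lt_le_trans (truncnS_gt _) _; rewrite ler_nat leq_addl.
have ta : t%:R <= (t0 + 2)%:R * a.
  have h1 : (Num.truncn a)%:R <= a by rewrite truncn_le.
  have h2 : (t0%:R : R) <= t0%:R * a by rewrite ler_peMr.
  rewrite /t natrD -addn1 natrD [(t0 + 2)%:R]natrD mulrDl; lra.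
have Tt : T <= (t ^ (27 * n))%:R.
  by rewrite -aT natrX; apply: lerXn2r; rewrite ?nnegrE ?ler0n.
have inA (x1 x2 : int) : `|x1| <= (Num.truncn X1)%:Z -> `|x2| <= (Num.truncn X2)%:Z ->
    progression2 q1 q2 X1 X2 (x1 * q1%:Z + x2 * q2%:Z).
  by move=> h1 h2; exists x1, x2; rewrite !abs_le_truncn.
have leT (x : nat) : progression2 q1 q2 X1 X2 x%:Z -> (x <= t ^ (27 * n))%N.
  move=> xA; rewrite -(ler_nat R); apply: le_trans Tt.
  have : `[- T, T]%classic (x%:R : R) by apply: AT; exists x%:Z.
  by rewrite /= in_itv /= => /andP[].
have h1 : (Num.truncn X1 * q1 <= t ^ (27 * n))%N.
  apply: leT; rewrite -[X in progression2 _ _ _ _ X]addr0 -(mul0r q2%:Z) PoszM.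
  by apply: inA; rewrite ?normr0 // ger0_norm.
have h2 : (Num.truncn X2 * q2 <= t ^ (27 * n))%N.
  apply: leT; rewrite -[X in progression2 _ _ _ _ X]add0r -(mul0r q1%:Z) PoszM.
  by apply: inA; rewrite ?normr0 // ger0_norm.
have nosq' : ~ has_square q1 q2 (Num.truncn X1) (Num.truncn X2).
  move=> [x1 [x2 [m [b1 b2 m0 e]]]]; apply: nosq; exists (m ^+ 2); split.
  - by rewrite -e; exact: inA.
  - by apply/eqP; rewrite sqrf_eq0.
  - by exists m.
have := Ht0 t q1 q2 _ _ (leq_addr _ _) q10 q20 co h1 h2 nosq'.
move/(leq_trans (@card_progression2_le R q1 q2 X1 X2 X10 X20)).
rewrite -(ler_nat R) natrM natrX => h; apply: le_trans h _.
rewrite -mulrA ler_pM2l //; apply: le_trans (_ : ((t0 + 2)%:R * a) ^+ (20 * n + 3) <= _).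
  by apply: lerXn2r; rewrite ?nnegrE ?ler0n ?mulr_ge0 ?ler0n.
rewrite exprMn ler_pM2l; last by rewrite exprn_gt0 // ltr0n addn2.
rewrite -powR_mulrn // /a -powRrM; apply: ler_powR => //.
have -> : (27 * n)%:R^-1 * (20 * n + 3)%:R = 20%:R / 27%:R + (9%:R * n%:R)^-1 :> R.
  by rewrite natrM natrD natrM; field; rewrite pnatr_eq0 -lt0n; apply: leq_trans n20.
rewrite lerD2l; apply: le_trans neps.
by rewrite lef_pV2 ?posrE ?mulr_gt0 // ler_peMl ?ler1n // ltW.
Qed.
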